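(* Let $\beta>0$ be fixed and assume $\lambda_n\to\lambda\in[0,1]$. Given $G_n$, sample $T_n,T_n'$ independently from $\mu_{G_n,\beta}$. Then \[\mathsf R(T_n,T_n')\to\begin{cases}0&\text{if }\lambda\in\{0,1\}\text{ or }\beta<1,\\ f(\lambda)&\text{if }\lambda\in(0,1)\text{ and }\beta>1\end{cases}\] in probability, where $f(\lambda)=(1-\lambda)\,\mathbb E[1/X\mid X>0]$ with $X\sim\mathrm{Poisson}(\log(1/\lambda))$.
   Context: Let $(\alpha_n)$ be a sequence in $(0,\infty)$ with $0<\liminf\alpha_n\le\limsup\alpha_n<\infty$, $q_n=\alpha_n\log n/n$, $G_n\sim\mathcal G(n,q_n)$ on $\{1,\dots,n\}$. Let $d_n^*=\min\{d\in\mathbb Z:(nq_n)^d\ge n/(\log\log n)^2\}$ and $\lambda_n\in(0,1)$ with $\log(1/\lambda_n)=(nq_n)^{d_n^*}/n$. Let $\overline G_n$ be the component of $G_n$ containing $1$, vertex set $\overline V_n$; $\mu_{G_n,\beta}(T)\propto\exp\big(-\beta\log\log(n)\sum_{v\in\overline V_n}\mathsf d_T(1,v)\big)$ on spanning trees $T$ of $\overline G_n$. Trees are rooted at $1$ with edges directed toward children; $\mathsf R(T,T')=|T\cap T'|/\sqrt{|T||T'|}$ where $T\cap T'$ is the set of common directed edges and $|T|$ the number of edges. *)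

(* Defs.v *)
From HB Require Import structures.
From mathcomp Require Export all_boot all_order all_algebra.
From mathcomp Require Export all_classical all_reals all_analysis.

Set Implicit Arguments.
Unset Strict Implicit.
Unset Printing Implicit Defensive.

Import Order.TTheory GRing.Theory Num.Theory.
Export numFieldNormedType.Exports.

Local Open Scope classical_set_scope.
Local Open Scope ring_scope.

(* A simple graph on V is given by its edge set, a set of 2-element subsets
   of V. *)
Section graphs.
Variable V : finType.
Implicit Types (G T : {set {set V}}) (x y r : V).

Definition all_edges : {set {set V}} := [set e : {set V} | #|e| == 2%N].

Definition adj G : rel V := fun x y => [set x; y]%SET \in G.

Definition component G r : {set V} := [set v | connect (adj G) r v].

Definition component_edges G r : {set {set V}} :=
  [set e in G | e \subset component G r].

Definition acyclic T : Prop :=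
  forall c : seq V, (2 < size c)%N -> uniq c -> ~~ cycle (adj T) c.

(* T is a spanning tree of the connected component of r in G. *)
Definition spanning_tree G r T : Prop :=
  [/\ T \subset component_edges G r,
      {in component G r &, forall x y, connect (adj T) x y}
    & acyclic T].

(* Length of a shortest path; in a graph on V this is < #|V| whenever x and y
   are connected, and the default value is #|V| otherwise. *)
Definition gdist T x y : nat :=
  \big[minn/#|V|]_(k < #|V| |
     [exists p : k.-tuple V, path (adj T) x p && (last x p == y)]) k.

(* The edges of the tree T rooted at r, as pairs (parent, child). *)
Definition directed_edges r T : {set V * V} :=
  [set p | adj T p.1 p.2 & gdist T r p.2 == (gdist T r p.1).+1].

Definition overlap (R : realType) r T T' : R :=
  #|directed_edges r T :&: directed_edges r T'|%SET%:R
  / Num.sqrt (#|T|%:R * #|T'|%:R).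

(* Probability of the edge set G under the law G(#|V|, p). *)
Definition erdos_renyi (R : realType) (p : R) G : R :=
  if G \subset all_edges
  then \prod_(e in all_edges) (if e \in G then p else 1 - p) else 0.

Definition gibbs_weight (R : realType) (b : R) G r T : R :=
  if `[< spanning_tree G r T >]
  then expR (- b * \sum_(v in component G r) (gdist T r v)%:R) else 0.

Definition gibbs (R : realType) (b : R) G r T : R :=
  gibbs_weight b G r T / \sum_(S : {set {set V}}) gibbs_weight b G r S.

(* Probability that (G, T, T') satisfies E when G follows G(#|V|, p) and, given
   G, T and T' are independent with law gibbs b G r. *)
Definition replica_prob (R : realType) (p b : R) r
    (E : {set {set V}} -> {set {set V}} -> {set {set V}} -> bool) : R :=
  \sum_(G : {set {set V}}) erdos_renyi p G *
    \sum_(T : {set {set V}}) \sum_(T' : {set {set V}} | E G T T')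
      gibbs b G r T * gibbs b G r T'.

End graphs.

Section model.
Variable R : realType.
Implicit Types (alpha : nat -> R) (n : nat).

Definition q_ alpha n : R := alpha n * ln n%:R / n%:R.

Definition is_dstar alpha n (d : int) : Prop :=
  let reaches (k : int) := n%:R / (ln (ln n%:R)) ^+ 2 <= (n%:R * q_ alpha n) ^ k in
  reaches d /\ forall k, reaches k -> d <= k.

(* The minimum exists when log n > 1 and n q_n > 1 (dstarP below), hence for all
   large n if liminf alpha_n > 0; the default 0 covers the other n. *)
Definition dstar alpha n : int := xget 0 (is_dstar alpha n).

(* The solution of log (1 / lambda_n) = (n q_n)^(d_n^* ) / n, see
   ln_lambda_ and lambda_itv below. *)
Definition lambda_ alpha n : R :=
  expR (- ((n%:R * q_ alpha n) ^ (dstar alpha n) / n%:R)).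

(* The graph G_n with n = m.+1 lives on 'I_m.+1, and the root, vertex 1, is
   ord0.  The edge probability is truncated at 1 so that the law is always a
   probability; this only affects finitely many n since q_n --> 0. *)
Definition overlap_tail alpha (beta c eps : R) (m : nat) : R :=
  let n := m.+1 in
  @replica_prob 'I_m.+1 R (Num.min (q_ alpha n) 1) (beta * ln (ln n%:R)) ord0
    (fun _ T T' => eps < `|overlap R ord0 T T' - c|).

Definition overlap_cvg_in_prob alpha (beta c : R) : Prop :=
  forall eps : R, 0 < eps ->
    overlap_tail alpha beta c eps m @[m --> \oo] --> (0 : R).

(* E[g | A] for an event A of positive probability. *)
Definition cond_expectation d (T : measurableType d) (P : probability T R)
    (A : set T) (g : T -> R) : R :=
  (\int[P]_(x in A) g x) / fine (P A).

(* The second argument of poisson_prob is a dummy. *)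
Definition f_overlap (lambda : R) : R :=
  (1 - lambda) *
  cond_expectation (poisson_prob (ln lambda^-1) 0) [set k : nat | (0 < k)%N]
    (fun k => (k%:R : R)^-1).

Lemma dstarP alpha n : 1 < ln n%:R :> R -> 1 < n%:R * q_ alpha n ->
  is_dstar alpha n (dstar alpha n).
Proof.
move=> lnn a1; rewrite /dstar; case: xgetP => [d _ //|] noex; exfalso.
set a := n%:R * q_ alpha n in a1; set y : R := n%:R / ln (ln n%:R) ^+ 2.
have a0 : 0 < a by apply: lt_trans a1.
have lna0 : 0 < ln a by exact: ln_gt0.
have n0 : (0 : R) < n%:R.
  by rewrite ltr0n lt0n; apply: contraTneq lnn => ->; rewrite ln0// ltr10.
have y0 : 0 < y by rewrite divr_gt0// exprn_gt0// ln_gt0.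
have aE (k : int) : a ^ k = expR (k%:~R * ln a).
  case: k => m; first by rewrite -pmulrn expRM_natl lnK.
  by rewrite NegzE mulrNz mulNr expRN -pmulrn expRM_natl lnK.
have reachE (k : int) : (y <= a ^ k) = (Num.ceil (ln y / ln a) <= k).
  by rewrite aE -{1}(lnK y0) ler_expR -ler_pdivrMr// ceil_le_int.
apply: (noex (Num.ceil (ln y / ln a))); split => [|k].
  by rewrite -/a -/y reachE.
by rewrite -/a -/y reachE.
Qed.

Lemma ln_lambda_ alpha n :
  ln (lambda_ alpha n)^-1 = (n%:R * q_ alpha n) ^ (dstar alpha n) / n%:R.
Proof. by rewrite /lambda_ -expRN opprK expRK. Qed.

Lemma lambda_itv alpha n : 0 < n%:R * q_ alpha n -> 0 < lambda_ alpha n < 1.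
Proof.
move=> a0; rewrite expR_gt0 /= expR_lt1 oppr_lt0 divr_gt0 ?exprz_gt0//.
case: n a0 => [|n _]; last by rewrite ltr0n.
by rewrite mul0r ltxx.
Qed.

End model.

(* Main.v *)
Require Import Defs.
From mathcomp Require Import all_boot all_order all_algebra.
From mathcomp Require Import all_classical all_reals all_analysis.
From mathcomp Require Import fintype finset ring lra zify.

Set Implicit Arguments.
Unset Strict Implicit.
Unset Printing Implicit Defensive.

Import Order.TTheory GRing.Theory Num.Theory.
Import numFieldNormedType.Exports.

Local Open Scope ring_scope.
Local Open Scope set_scope.

(** A spanning tree is determined by its parent function, and a vertex whose
    tree distance to the root exceeds its graph distance costs a factor
    [expR (- b)].  Hence the two-replica exponential moment of the number of
    common directed edges is at most a product over the vertices, up to the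
    squared weight of the breadth-first trees.  The square of the partition
    function is bounded below by trees built from independent choices of
    parents, so that the overlap concentrates by Chernoff's bound.

    If [beta > 1], or [beta = 1] and [lambda = 0], breadth-first trees are the
    right comparison, and the overlap is close to the mean over the vertices of
    the inverse number of parents.  Almost all vertices lie in the layers
    [D.+1] and [D.+2], where [D.+1 = dstar].  In the layer [D.+2] the number of
    parents diverges; a vertex belongs to the layer [D.+1] when it has a
    neighbour in the layer [D], and the number of such neighbours is asymptotically
    Poisson with mean [log (1 / lambda)].  If [beta < 1] or [lambda = 1], the
    comparison trees attach almost all vertices to a set of small vertex density
    in the layer [D.+1], which leaves them many possible parents, and the
    overlap vanishes.

    The layers are explored one at a time, so that given the explored ball the
    number of neighbours of an outer vertex in the last layer is binomial;
    moments of the layer sizes then give all estimates on the random graph. *)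

(** * Product Bernoulli measures on finite sets *)

(** Since [b = beta * ln (ln n)], attaching a vertex to a neighbour off the shortest paths has
    weight at most [(log n)^(-beta)], while a typical vertex has of order [log n] neighbours. The
    total weight [(log n)^(1 - beta)] competes with the number of breadth-first parents, whence the
    threshold [beta = 1]. The regimes differ in what a comparison may lose per vertex. In the
    breadth-first regime the Chernoff parameter is of order [eps], so the comparison must be sharp
    up to [o(1)] per vertex on average. In the displaced regime the parameter is a small multiple of
    [log log n]; a factor polynomial in [log log n] at each vertex, that is, a loss of order
    [log log log n] in the exponent, is then affordable, and crude estimates suffice. The threshold
    [n / (log log n)^2] in [dstar] serves both: the layer [D] is negligible, while the layer [D.+1]
    is large enough to give most remaining vertices at least of order [log n / (log log n)^2]
    neighbours in it. No maximal degree is ever bounded; degrees enter the random estimates only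
    through the expectation of their sum. *)

Section product_bernoulli.
Variables (R : realType) (T : finType) (p : T -> R).
Hypothesis p01 : forall e, 0 <= p e <= 1.

Definition bweight (G : {set T}) : R :=
  \prod_e (if e \in G then p e else 1 - p e).

Definition Ex (f : {set T} -> R) : R := \sum_G bweight G * f G.

Lemma bweight_ge0 G : 0 <= bweight G.
Proof.
apply: prodr_ge0 => e _; have /andP[p0 p1] := p01 e.
by case: ifP => // _; rewrite subr_ge0.
Qed.

Lemma Ex_cst c : Ex (fun=> c) = c.
Proof.
rewrite /Ex -mulr_suml.
suff -> : \sum_(G : {set T}) bweight G = 1 by rewrite mul1r.
transitivity (\prod_(e : T) (p e + (1 - p e))).
  by rewrite bigA_distr.
by apply: big1 => e _; rewrite addrC subrK.
Qed.

Lemma eq_Ex f g : (forall G, f G = g G) -> Ex f = Ex g.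
Proof. by move=> fg; apply: eq_bigr => G _; rewrite fg. Qed.

Lemma ExD f g : Ex (fun G => f G + g G) = Ex f + Ex g.
Proof. by rewrite -big_split; apply: eq_bigr => G _; rewrite mulrDr. Qed.

Lemma ExZ c f : Ex (fun G => c * f G) = c * Ex f.
Proof. by rewrite mulr_sumr; apply: eq_bigr => G _; rewrite mulrCA. Qed.

Lemma ExZr c f : Ex (fun G => f G * c) = Ex f * c.
Proof. by rewrite mulr_suml; apply: eq_bigr => G _; rewrite mulrA. Qed.

Lemma ExN f : Ex (fun G => - f G) = - Ex f.
Proof. by rewrite -sumrN; apply: eq_bigr => G _; rewrite mulrN. Qed.

Lemma ExB f g : Ex (fun G => f G - g G) = Ex f - Ex g.
Proof. by rewrite ExD ExN. Qed.

Lemma Ex_sum (I : Type) (s : seq I) (P : pred I) (f : I -> {set T} -> R) :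
  Ex (fun G => \sum_(i <- s | P i) f i G) = \sum_(i <- s | P i) Ex (f i).
Proof.
rewrite /Ex exchange_big /=; apply: eq_bigr => G _.
by rewrite mulr_sumr.
Qed.

Lemma le_Ex f g : (forall G, f G <= g G) -> Ex f <= Ex g.
Proof.
by move=> fg; apply: ler_sum => G _; apply: ler_wpM2l; rewrite ?bweight_ge0.
Qed.

Lemma Ex_ge0 f : (forall G, 0 <= f G) -> 0 <= Ex f.
Proof. by move=> f0; rewrite -[leLHS](Ex_cst 0); exact: le_Ex. Qed.

Definition Pr (A : {set T} -> bool) : R := Ex (fun G => (A G)%:R).

Lemma le_Pr (A B : {set T} -> bool) : (forall G, A G -> B G) -> Pr A <= Pr B.
Proof.
move=> AB; apply: le_Ex => G; rewrite ler_nat.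
by case: (A G) (AB G) => // /(_ isT) ->.
Qed.

Lemma Pr_or (A B : {set T} -> bool) : Pr (fun G => A G || B G) <= Pr A + Pr B.
Proof.
rewrite -ExD; apply: le_Ex => G.
by case: (A G); case: (B G); rewrite /= ?addr0 ?add0r ?lerDl ?ler01 ?lexx.
Qed.

Lemma markov_Ex (c : R) f : 0 < c -> (forall G, 0 <= f G) ->
  Pr (fun G => c <= f G) <= Ex f / c.
Proof.
move=> c0 f0; rewrite -ExZr; apply: le_Ex => G.
have [cf|_] := leP c (f G); first by rewrite ler_pdivlMr// mul1r.
by rewrite divr_ge0// ltW.
Qed.

(** Integrates [2 * |f| <= c + f ^+ 2 / c]. It replaces the Cauchy-Schwarz inequality when [c] can
    be set to the expected scale of [f]. *)
Lemma Ex_normr_le (c : R) f : 0 < c ->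
  Ex (fun G => `|f G|) <= (c + Ex (fun G => f G ^+ 2) / c) / 2.
Proof.
move=> c0.
rewrite -{1}(Ex_cst c) -ExZr -ExD -ExZr; apply: le_Ex => G.
rewrite ler_pdivlMr// -subr_ge0 -[f G ^+ 2]real_normK ?num_real//.
have -> : c + `|f G| ^+ 2 / c - `|f G| * 2 = (c - `|f G|) ^+ 2 / c.
  by field; exact: lt0r_neq0.
by rewrite divr_ge0 ?sqr_ge0 ?(ltW c0).
Qed.

Lemma Ex_normr_sqrt f : Ex (fun G => `|f G|) <= Num.sqrt (Ex (fun G => f G ^+ 2)).
Proof.
set v := Ex (fun G => f G ^+ 2).
have v0 : 0 <= v by apply: Ex_ge0 => G; exact: sqr_ge0.
have [v00|vn0] := eqVneq v 0; last first.
  have s0 : 0 < Num.sqrt v by rewrite sqrtr_gt0 lt0r vn0.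
  apply: le_trans (Ex_normr_le f s0) _; rewrite -/v.
  have -> : v / Num.sqrt v = Num.sqrt v.
    by rewrite -[X in X / _](sqr_sqrtr v0) expr2 mulfK ?gt_eqF.
  lra.
rewrite v00 sqrtr0; apply/ler_addgt0Pr => e e0; rewrite add0r.
apply: le_trans (Ex_normr_le f e0) _; rewrite -/v v00 mul0r addr0.
by rewrite ler_pdivrMr// mulr_natr mulr2n lerDl ltW.
Qed.

(** The finite form of measurability with respect to the coordinates in [S]. *)
Definition depends_on (A : Type) (S : {set T}) (f : {set T} -> A) :=
  forall G G', G :&: S = G' :&: S -> f G = f G'.

Lemma depends_onS (A : Type) (S S' : {set T}) (f : {set T} -> A) :
  S \subset S' -> depends_on S f -> depends_on S' f.
Proof.
move=> SS' dep G G' GG'; apply: dep; apply/setP => e.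
move/setP/(_ e): GG'; rewrite !inE.
by case: (boolP (e \in S)) => [/(fintype.subsetP SS') ->|]; rewrite ?andbT ?andbF.
Qed.

Definition set_swap (S : {set T}) (GG : {set T} * {set T}) :=
  ((GG.1 :&: S) :|: (GG.2 :\: S), (GG.2 :&: S) :|: (GG.1 :\: S)).

Lemma set_swapK S : involutive (set_swap S).
Proof.
by move=> [G G']; congr pair; apply/setP => e; rewrite !inE /=;
  case: (e \in S); rewrite ?andbT ?andbF ?orbF.
Qed.

Lemma bweight_swap S GG :
  bweight (set_swap S GG).1 * bweight (set_swap S GG).2
  = bweight GG.1 * bweight GG.2.
Proof.
rewrite /bweight -!big_split /=; apply: eq_bigr => e _; rewrite !inE.
by case: (e \in S); rewrite ?andbT ?andbF ?orbF // mulrC.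
Qed.

(* Exchanging the parts outside S of two independent copies preserves their
   joint weight. *)
Lemma Ex_indep S f g : depends_on S f -> depends_on (~: S) g ->
  Ex (fun G => f G * g G) = Ex f * Ex g.
Proof.
move=> fS gS.
have prodE (F H : {set T} -> {set T} -> R) (K : {set T} * {set T} -> R) :
    (forall G G', K (G, G') = F G G' * H G G') ->
    \sum_GG bweight GG.1 * bweight GG.2 * K GG
    = \sum_G \sum_G' bweight G * bweight G' * (F G G' * H G G').
  by move=> KE; rewrite pair_bigA /=; apply: eq_bigr => -[G G'] _ /=; rewrite KE.
transitivity (\sum_GG bweight GG.1 * bweight GG.2 * (f GG.1 * g GG.1)).
  rewrite (prodE (fun G _ => f G) (fun G _ => g G))//.
  apply: eq_bigr => G _.
  rewrite -[LHS]mulr1 -[X in _ * X = _](Ex_cst 1) mulr_sumr.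
  by apply: eq_bigr => G' _; rewrite mulr1 [RHS]mulrAC.
rewrite (reindex_inj (inv_inj (set_swapK S))) /=.
transitivity (\sum_GG bweight GG.1 * bweight GG.2 * (f GG.1 * g GG.2)).
  apply: eq_bigr => GG _; have := bweight_swap S GG; rewrite /= => ->.
  congr (_ * (_ * _)); [apply: fS|apply: gS]; apply/setP => e; rewrite !inE;
  by case: (e \in S); rewrite ?andbT ?andbF ?orbF.
rewrite (prodE (fun G _ => f G) (fun _ G => g G))// mulr_suml.
apply: eq_bigr => G _; rewrite mulr_sumr; apply: eq_bigr => G' _.
by rewrite mulrACA.
Qed.

End product_bernoulli.
Arguments depends_on {T A}.

(** * Binomial expectations *)

Section binomial_expectation.
Variables (R : realType).
Implicit Types (q : R) (g : nat -> R).

(* The expectation of g(X) for X binomial with parameters m and q. *)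
Fixpoint binexp q (m : nat) g : R :=
  if m is m'.+1 then (1 - q) * binexp q m' g + q * binexp q m' (fun j => g j.+1)
  else g 0%N.

Lemma eq_binexp q m g g' : (forall j, g j = g' j) -> binexp q m g = binexp q m g'.
Proof.
elim: m g g' => [|m IH] g g' gg' //=; rewrite (IH g g')//.
by rewrite (IH (fun j => g j.+1) (fun j => g' j.+1)).
Qed.

Lemma binexpD q m g g' :
  binexp q m (fun j => g j + g' j) = binexp q m g + binexp q m g'.
Proof. by elim: m g g' => [|m IH] g g' //=; rewrite !IH; ring. Qed.

Lemma binexpZ q m c g : binexp q m (fun j => c * g j) = c * binexp q m g.
Proof. by elim: m g => [|m IH] g //=; rewrite !IH; ring. Qed.

Lemma binexp_cst q m c : binexp q m (fun=> c) = c.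
Proof. by elim: m => [|m IH] //=; rewrite !IH; ring. Qed.

Lemma le_binexp q m g g' : 0 <= q <= 1 -> (forall j, g j <= g' j) ->
  binexp q m g <= binexp q m g'.
Proof.
move=> /andP[q0 q1]; elim: m g g' => [|m IH] g g' gg' //=.
by rewrite lerD// ler_wpM2l// ?subr_ge0 ?IH.
Qed.

Lemma binexp_id q m : binexp q m (fun j => j%:R) = m%:R * q.
Proof.
elim: m => [|m IH] /=; first by rewrite mul0r.
rewrite IH; rewrite (@eq_binexp _ _ _ (fun j => 1 + j%:R)).
  by rewrite binexpD binexp_cst IH -[in RHS]natr1; ring.
by move=> j; rewrite -natr1 addrC.
Qed.

Lemma binexp_sqr q m :
  binexp q m (fun j => j%:R ^+ 2) = m%:R * q * (1 - q) + (m%:R * q) ^+ 2.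
Proof.
elim: m => [|m IH] /=; first by rewrite !mul0r expr0n /= addr0.
rewrite IH; rewrite (@eq_binexp _ _ _ (fun j => (1 + 2 * j%:R) + j%:R ^+ 2)).
  by rewrite !binexpD binexpZ binexp_cst binexp_id IH -[in RHS]natr1; ring.
by move=> j; rewrite -natr1; ring.
Qed.

Lemma binexp_pos q m :
  binexp q m (fun j => (0 < j)%:R) = 1 - (1 - q) ^+ m.
Proof.
elim: m => [|m IH] /=; first by rewrite expr0 subrr.
by rewrite IH binexp_cst exprS; ring.
Qed.

(** Each of the [k] additional trials succeeds with probability [q], and a success changes [g] by at
    most 1. *)
Lemma binexp_lipschitz q m k g : 0 <= q <= 1 ->
  (forall j, `|g j.+1 - g j| <= 1) ->
  `|binexp q (m + k) g - binexp q m g| <= k%:R * q.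
Proof.
move=> q01 g1; have /andP[q0 q1] := q01.
elim: k => [|k IH]; first by rewrite addn0 subrr normr0 mul0r.
rewrite addnS /= (_ : k.+1%:R * q = k%:R * q + q); last first.
  by rewrite -natr1 mulrDl mul1r.
set X := binexp q (m + k) g in IH *.
set Y := binexp q (m + k) (fun j => g j.+1).
have -> : (1 - q) * X + q * Y - binexp q m g = (X - binexp q m g) + q * (Y - X).
  by ring.
apply: le_trans (ler_normD _ _) _; apply: lerD => //.
rewrite normrM ger0_norm// ler_piMr//.
have -> : Y - X = binexp q (m + k) (fun j => g j.+1 - g j).
  by rewrite binexpD (@eq_binexp _ _ (fun j => - g j) (fun j => -1 * g j)) ?binexpZ;
    [rewrite mulN1r|move=> j; rewrite mulN1r].
rewrite ler_norml; apply/andP; split.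
  rewrite -[leLHS](binexp_cst q (m + k)); apply: le_binexp => // j.
  by have := g1 j; rewrite ler_norml => /andP[].
rewrite -[leRHS](binexp_cst q (m + k)); apply: le_binexp => // j.
by have := g1 j; rewrite ler_norml => /andP[].
Qed.

Lemma binexp_formula q m g :
  binexp q m g = \sum_(j < m.+1) 'C(m, j)%:R * q ^+ j * (1 - q) ^+ (m - j) * g j.
Proof.
elim: m g => [|m IH] g.
  by rewrite big_ord_recl big_ord0 /= !expr0 bin0 !mul1r addr0.
rewrite /= !IH [RHS]big_ord_recl /= bin0 expr0 !mul1r subn0.
have -> : \sum_(i < m.+1)
    'C(m.+1, bump 0 i)%:R * q ^+ (bump 0 i) * (1 - q) ^+ (m.+1 - bump 0 i) *
    g (bump 0 i) =
    q * (\sum_(j < m.+1) 'C(m, j)%:R * q ^+ j * (1 - q) ^+ (m - j) * g j.+1)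
  + \sum_(j < m.+1) 'C(m, j.+1)%:R * q ^+ j.+1 * (1 - q) ^+ (m - j) * g j.+1.
  rewrite mulr_sumr -big_split /=; apply: eq_bigr => i _.
  rewrite /bump leq0n add1n binS natrD subSS exprS.
  move: ((1 - q) ^+ (m - i)) (q ^+ i) => A B.
  ring.
rewrite [X in _ = _ + (_ + X)]big_ord_recr /= bin_small// !mul0r addr0.
rewrite [X in (1 - q) * X + _]big_ord_recl /= bin0 expr0 !mul1r subn0.
rewrite mulrDr mulrA -exprS mulr_sumr -addrA; congr (_ + _).
rewrite addrC; congr (_ + _); apply: eq_bigr => i _.
rewrite /bump leq0n add1n -[in RHS](@subnSK i m)// (exprS (1 - q)).
move: ((1 - q) ^+ (m - i.+1)) (q ^+ i.+1) => A B; ring.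
Qed.

(* Chebyshev's inequality gives P(X <= m q / 2) <= 4 / (m q). *)
Lemma binexp_inv_le q m : 0 <= q <= 1 -> 0 < m%:R * q ->
  binexp q m (fun j => (maxn 1 j)%:R^-1) <= 6 / (m%:R * q).
Proof.
move=> q01 mq0; set y := m%:R * q in mq0 *; have /andP[q0 q1] := q01.
apply: le_trans (_ : binexp q m (fun j =>
    (4 / y ^+ 2) * (j%:R ^+ 2 + ((- 2 * y) * j%:R + y ^+ 2)) + 2 / y) <= _).
  apply: le_binexp => // j.
  set t : R := j%:R.
  have -> : (4 / y ^+ 2) * (t ^+ 2 + ((- 2 * y) * t + y ^+ 2)) + 2 / y =
      4 * (t - y) ^+ 2 / y ^+ 2 + 2 / y by field; exact: lt0r_neq0.
  have m1 : 1 <= (maxn 1 j)%:R :> R by rewrite ler1n leq_maxl.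
  have m0 : 0 < (maxn 1 j)%:R :> R by apply: lt_le_trans m1.
  have [ty|ty] := leP t (y / 2).
    apply: (@le_trans _ _ 1); first by rewrite invf_le1.
    apply: ler_wpDr; first by rewrite divr_ge0// ltW.
    rewrite ler_pdivlMr ?exprn_gt0// mul1r.
    have : 0 <= y / 2 - t by rewrite subr_ge0.
    have : 0 <= t by rewrite ler0n.
    nra.
  apply: ler_wpDl; first by rewrite mulr_ge0 ?invr_ge0 ?sqr_ge0// mulr_ge0 ?sqr_ge0.
  have tm : t <= (maxn 1 j)%:R by rewrite ler_nat leq_maxr.
  rewrite -[leRHS]invf_div lef_pV2 ?posrE ?divr_gt0//.
  by apply: le_trans tm; exact: ltW.
rewrite binexpD binexpZ !binexpD binexpZ !binexp_cst binexp_sqr binexp_id -/y.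
have -> : 4 / y ^+ 2 * (y * (1 - q) + y ^+ 2 + (- 2 * y * y + y ^+ 2)) + 2 / y =
   4 * (1 - q) / y + 2 / y by field; exact: lt0r_neq0.
rewrite -mulrDl ler_pM2r ?invr_gt0//.
lra.
Qed.

(** Chebyshev's inequality in pointwise form: with [y = m q], the indicator is at most
    [4 (j - y)^2 / y^2], whose expectation needs only two moments. *)
Lemma binexp_lower_tail q m : 0 <= q <= 1 -> 0 < m%:R * q ->
  binexp q m (fun j => (j%:R < m%:R * q / 2)%R%:R) <= 4 / (m%:R * q).
Proof.
move=> q01 mq0; set y := m%:R * q in mq0 *; have /andP[q0 q1] := q01.
apply: le_trans (_ : binexp q m (fun j =>
    (4 / y ^+ 2) * (j%:R ^+ 2 + ((- 2 * y) * j%:R + y ^+ 2))) <= _).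
  apply: le_binexp => // j.
  set t : R := j%:R.
  have -> : (4 / y ^+ 2) * (t ^+ 2 + ((- 2 * y) * t + y ^+ 2)) =
      4 * (t - y) ^+ 2 / y ^+ 2 by field; exact: lt0r_neq0.
  have [ty|ty] := ltP t (y / 2); last first.
    by rewrite mulr_ge0 ?invr_ge0 ?sqr_ge0// mulr_ge0 ?sqr_ge0.
  rewrite ler_pdivlMr ?exprn_gt0// mul1r.
  have : 0 <= y / 2 - t by rewrite subr_ge0 ltW.
  have : 0 <= t by rewrite ler0n.
  nra.
rewrite binexpZ !binexpD binexpZ !binexp_cst binexp_sqr binexp_id -/y.
have -> : 4 / y ^+ 2 * (y * (1 - q) + y ^+ 2 + (- 2 * y * y + y ^+ 2)) =
   4 * (1 - q) / y by field; exact: lt0r_neq0.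
rewrite ler_pM2r ?invr_gt0//.
lra.
Qed.

End binomial_expectation.

(** * Exploration of an Erdos-Renyi graph *)

(* The probability that a vertex has a neighbour in a given set of size s. *)
Definition hit_prob (R : realType) (q : R) (s : nat) : R := 1 - (1 - q) ^+ s.

Section erdos_renyi_measure.
Variables (R : realType) (V : finType) (q : R).
Hypothesis q01 : 0 <= q <= 1.
Implicit Types (G : {set {set V}}) (A B L W : {set V}).

(** The value 0 on sets that are not edges turns [erdos_renyi q] into a product measure on all of
    [{set {set V}}]. *)
Definition edge_prob (e : {set V}) : R := if e \in all_edges V then q else 0.

Lemma edge_prob01 e : 0 <= edge_prob e <= 1.
Proof. by rewrite /edge_prob; case: ifP; rewrite ?lexx ?ler01. Qed.

Local Notation EG := (Ex edge_prob).

Lemma erdos_renyiE G : erdos_renyi q G = bweight edge_prob G.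
Proof.
rewrite /erdos_renyi /bweight; case: ifPn => [GE|/subsetPn[e eG eE]].
  rewrite big_mkcond /=; apply: eq_bigr => e _; rewrite /edge_prob.
  case: ifPn => // eE; case: ifPn => [/(subsetP GE)|].
    by rewrite (negbTE eE).
  by rewrite subr0.
by rewrite (bigD1 e)//= eG /edge_prob (negbTE eE) mul0r.
Qed.

Lemma Ex_mem e : EG (fun G => (e \in G)%:R) = edge_prob e.
Proof.
(* Replacing the factor of an absent [e] by 0 encodes the indicator, so that the sum expands a
   product again. *)
transitivity (\sum_(G : {set {set V}}) \prod_(e' : {set V}) (if e' \in G then edge_prob e'
    else (if e' == e then 0 else 1 - edge_prob e'))).
  apply: eq_bigr => G _; rewrite /bweight; case: (boolP (e \in G)) => eG.
    rewrite mulr1; apply: eq_bigr => e' _; case: ifPn => // e'G.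
    by case: eqP => // ee'; rewrite ee' eG in e'G.
  by rewrite mulr0 [RHS](bigD1 e)//= (negbTE eG) eqxx mul0r.
have := bigA_distr 1 (@GRing.add R) edge_prob
  (fun e' => if e' == e then 0 else 1 - edge_prob e').
move=> <-; rewrite (bigD1 e)//= eqxx addr0 big1 ?mulr1// => e' /negbTE ->.
by rewrite addrC subrK.
Qed.

(** Splitting off one edge of [F] at a time reproduces the recursion of [binexp]. *)
Lemma Ex_card (F : {set {set V}}) (g : nat -> R) : F \subset all_edges V ->
  EG (fun G => g #|G :&: F|) = binexp q #|F| g.
Proof.
elim: {F}#|F| {-2}F (erefl #|F|) g => [|m IH] F Fm g FE.
  rewrite (eq_Ex _ (g := fun=> g 0%N)); first by rewrite Ex_cst Fm.
  by move=> G; rewrite (cards0_eq Fm) setI0 cards0.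
have /set0Pn[e eF] : F != set0 by rewrite -card_gt0 Fm.
have F'm : #|F :\ e| = m by have := cardsD1 e F; rewrite eF Fm add1n => -[].
have F'E : F :\ e \subset all_edges V by apply: subset_trans FE; exact: subD1set.
have dep1 : depends_on [set e] (fun G : {set {set V}} => (e \in G)%:R : R).
  by move=> G G' /setP/(_ e); rewrite !inE eqxx !andbT => ->.
have dep2 : depends_on [set e] (fun G : {set {set V}} => 1 - (e \in G)%:R : R).
  by move=> G G' /setP/(_ e); rewrite !inE eqxx !andbT => ->.
have dep3 g' : depends_on (~: [set e]) (fun G => g' #|G :&: (F :\ e)| : R).
  move=> G G' GG'; congr (g' #|pred_of_set _|); apply/setP => e'.
  move/setP/(_ e'): GG'; rewrite !inE; case: (e' == e); rewrite ?andbF//=.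
  by rewrite !andbT => ->.
have eE : EG (fun G => (e \in G)%:R) = q.
  by rewrite Ex_mem /edge_prob (subsetP FE).
rewrite (eq_Ex _ (g := fun G => (1 - (e \in G)%:R) * g #|G :&: (F :\ e)| +
   (e \in G)%:R * g #|G :&: (F :\ e)|.+1)); last first.
  move=> G; rewrite (cardsD1 e (G :&: F)) inE eF andbT.
  have -> : (G :&: F) :\ e = G :&: (F :\ e) by rewrite setIDA.
  by case: (e \in G); rewrite /= ?subrr ?mul0r ?add0r ?mul1r ?add1n ?subr0 ?mul1r ?addr0 ?add0n.
rewrite ExD (Ex_indep _ dep2 (dep3 g)).
rewrite (Ex_indep _ dep1 (dep3 (fun j => g j.+1))).
rewrite ExB Ex_cst eE Fm /=.
by rewrite (IH _ F'm g F'E) (IH _ F'm (fun j => g j.+1) F'E) F'm.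
Qed.

Definition nb G A (v : V) : nat := #|[set u in A | [set u; v] \in G]|.

Definition star A (v : V) : {set {set V}} := [set [set u; v] | u in A].

Lemma set2_injl (v u u' : V) : [set u; v] = [set u'; v] -> u = u'.
Proof.
move=> /setP uu'; have := uu' u; have := uu' u'.
rewrite !inE !eqxx /= => /orP[/eqP ->//|/eqP u'v].
by rewrite u'v orbb => /esym/eqP ->.
Qed.

Lemma nb_star G A v : nb G A v = #|G :&: star A v|.
Proof.
rewrite /nb -(card_imset _ (@set2_injl v)); congr #|pred_of_set _|.
apply/setP => e; rewrite !inE; apply/imsetP/andP.
  move=> [u]; rewrite inE => /andP[uA uG ->]; split => //.
  by apply/imsetP; exists u.
by move=> [eG /imsetP[u uA eu]]; exists u; rewrite // inE uA -eu.
Qed.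

Lemma card_star A v : #|star A v| = #|A|.
Proof. by rewrite card_imset//; exact: set2_injl. Qed.

Lemma star_edges A v : v \notin A -> star A v \subset all_edges V.
Proof.
move=> vA; apply/subsetP => e /imsetP[u uA ->].
have uv : u != v by apply: contraNneq vA => <-.
by rewrite inE cards2 uv.
Qed.

Lemma nb_dep A v : depends_on (star A v) (fun G => nb G A v).
Proof. by move=> G G' GG'; rewrite !nb_star GG'. Qed.

Lemma star_disjoint A v w : v \notin A -> v != w -> star A w \subset ~: star A v.
Proof.
move=> vA vw; apply/subsetP => e /imsetP[u uA ->]; rewrite inE.
apply/negP => /imsetP[u' u'A /setP/(_ v)]; rewrite !inE eqxx orbT.
by rewrite (negbTE vw) orbF => /eqP vu; rewrite vu uA in vA.
Qed.

Lemma Ex_nb A v (f : nat -> R) : v \notin A ->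
  EG (fun G => f (nb G A v)) = binexp q #|A| f.
Proof.
move=> vA; rewrite -(card_star A v) -Ex_card ?star_edges//.
by apply: eq_Ex => G; rewrite nb_star.
Qed.

Lemma Ex_sum_nb A W (f : nat -> R) : [disjoint W & A] ->
  EG (fun G => \sum_(v in W) f (nb G A v)) = #|W|%:R * binexp q #|A| f.
Proof.
move=> WA; rewrite Ex_sum -sum1_card natr_sum mulr_suml; apply: eq_bigr => v vW.
by rewrite mul1r Ex_nb// (disjointFr WA vW).
Qed.

(** The centred terms of distinct vertices read disjoint stars, so only the diagonal of the double
    sum survives. *)
Lemma Var_sum_nb A W (f : nat -> R) : [disjoint W & A] ->
  EG (fun G => (\sum_(v in W) f (nb G A v) - #|W|%:R * binexp q #|A| f) ^+ 2)
  <= #|W|%:R * binexp q #|A| (fun j => f j ^+ 2).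
Proof.
move=> WA; set mu := binexp q #|A| f; pose h j := f j - mu.
rewrite (eq_Ex _ (g := fun G => \sum_(v in W) \sum_(w in W)
    h (nb G A v) * h (nb G A w))); last first.
  move=> G; have -> : \sum_(v in W) f (nb G A v) - #|W|%:R * mu =
      \sum_(v in W) h (nb G A v).
    by rewrite sumrB sumr_const mulr_natl.
  by rewrite expr2 mulr_suml; apply: eq_bigr => v _; rewrite mulr_sumr.
rewrite Ex_sum -sum1_card natr_sum mulr_suml; apply: ler_sum => v vW.
rewrite mul1r.
have vA : v \notin A by rewrite (disjointFr WA vW).
have h0 : binexp q #|A| h = 0.
  by rewrite /h binexpD binexp_cst -/mu subrr.
rewrite Ex_sum (bigD1 v)//= big1 ?addr0; last first.
  move=> w /andP[wW wv].
  have wA : w \notin A by rewrite (disjointFr WA wW).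
  rewrite (@Ex_indep _ _ _ (star A v)).
  - by rewrite (Ex_nb h vA) h0 mul0r.
  - by move=> G G' /nb_dep ->.
  - apply: (depends_onS (@star_disjoint A v w vA _)); first by rewrite eq_sym.
    by move=> G G' /nb_dep ->.
rewrite (Ex_nb (fun j => h j * h j) vA).
rewrite (@eq_binexp _ _ _ _ (fun j => f j ^+ 2 + ((- 2 * mu) * f j + mu ^+ 2))).
  rewrite !binexpD binexpZ binexp_cst -/mu gerDl.
  by have := sqr_ge0 mu; rewrite expr2 -mulrA; lra.
by move=> j; rewrite /h; ring.
Qed.

Definition bfs_next G B L : {set V} := [set v in ~: B | (0 < nb G L v)%N].

Fixpoint bfs (r : V) G (k : nat) : {set V} * {set V} :=
  if k is k'.+1 then
    let L := bfs_next G (bfs r G k').1 (bfs r G k').2 in ((bfs r G k').1 :|: L, L)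
  else ([set r], [set r]).

Definition bfs_ball r G k := (bfs r G k).1.
Definition bfs_layer r G k := (bfs r G k).2.

Lemma layer_sub_ball r G k : bfs_layer r G k \subset bfs_ball r G k.
Proof. by case: k => [|k] //=; rewrite /bfs_ball /bfs_layer /= subsetUr. Qed.

Lemma ballS r G k : bfs_ball r G k.+1 = bfs_ball r G k :|: bfs_layer r G k.+1.
Proof. by []. Qed.

Lemma layerS r G k : bfs_layer r G k.+1 = bfs_next G (bfs_ball r G k) (bfs_layer r G k).
Proof. by []. Qed.

Lemma next_disjoint G B L : [disjoint B & bfs_next G B L].
Proof.
rewrite -setI_eq0; apply/eqP/setP => v; rewrite !inE.
by case: (v \in B).
Qed.

Lemma ballD_layer r G k : bfs_ball r G k.+1 :\: bfs_layer r G k.+1 = bfs_ball r G k.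
Proof.
rewrite ballS setDUl setDv setU0; apply/setDidPl.
by rewrite layerS next_disjoint.
Qed.

(** The edges still unrevealed once the ball [B] with last layer [L] is explored. Edges inside [L]
    are among them: the exploration has read only edges that meet an earlier layer. *)
Definition off_edges B L : {set {set V}} := [set e : {set V} | [disjoint e & B :\: L]].

Lemma nb_off_dep B L A v : A \subset L -> v \notin B :\: L ->
  depends_on (off_edges B L) (fun G => nb G A v).
Proof.
move=> AL vBL; apply: depends_onS (@nb_dep A v).
apply/subsetP => e /imsetP[u uA ->].
rewrite inE disjoints_subset subUset !sub1set !inE.
by rewrite (subsetP AL u uA) /=; move: vBL; rewrite !inE => ->.
Qed.

Lemma next_off_dep B L : depends_on (off_edges B L) (fun G => bfs_next G B L).
Proof.
move=> G G' GG'; apply/setP => v; rewrite !inE.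
case: (boolP (v \in B)) => //= vB; congr (0 < _)%N.
by apply: nb_off_dep GG' => //; rewrite inE (negbTE vB) andbF.
Qed.

(** The exploration up to level [k] reads only edges that meet the interior of the ball it finds.
    Hence the event that it returns a given pair is determined by the edges meeting the interior of
    that pair. *)
Lemma bfs_expose r G G' k :
  (forall e : {set V}, ~~ [disjoint e & bfs_ball r G k :\: bfs_layer r G k] ->
     (e \in G) = (e \in G')) ->
  bfs r G' k = bfs r G k.
Proof.
elim: k => [//|k IH] agree.
have agree' : forall e : {set V}, ~~ [disjoint e & bfs_ball r G k] -> (e \in G) = (e \in G').
  by move=> e eB; apply: agree; rewrite ballD_layer.
have IH' : bfs r G' k = bfs r G k.
  apply: IH => e eB; apply: agree'; apply: contra eB => eB.
  by apply: disjointWr eB; exact: subsetDl.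
have nE : bfs_next G' (bfs r G k).1 (bfs r G k).2 = bfs_next G (bfs r G k).1 (bfs r G k).2.
  apply/setP => v; rewrite !inE; congr (_ && (0 < _)%N).
  apply: eq_card => u; rewrite !inE.
  case: (boolP (u \in (bfs r G k).2)) => //= uL; rewrite -agree'//.
  rewrite disjoints_subset subUset !sub1set !inE negb_and negbK.
  by rewrite (subsetP (layer_sub_ball r G k)).
by rewrite /= IH' nE.
Qed.

(** A spatial Markov property: given the explored pair, the unrevealed edges are distributed as in a
    fresh graph [G']. The sum is split by the value of the pair, and each summand is a product of
    functions of complementary sets of edges. *)
Lemma bfs_exposure r k (Psi : {set V} -> {set V} -> {set {set V}} -> R) :
  (forall B L, depends_on (off_edges B L) (Psi B L)) ->
  EG (fun G => Psi (bfs_ball r G k) (bfs_layer r G k) G) =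
  EG (fun G => EG (fun G' => Psi (bfs_ball r G k) (bfs_layer r G k) G')).
Proof.
move=> dep.
pose at_ (BL : {set V} * {set V}) G : R := (bfs r G k == BL)%:R.
have decomp (F : {set V} * {set V} -> {set {set V}} -> R) :
    EG (fun G => F (bfs r G k) G) = \sum_BL EG (fun G => at_ BL G * F BL G).
  rewrite -Ex_sum; apply: eq_Ex => G.
  rewrite (bigD1 (bfs r G k))//= /at_ eqxx mul1r big1 ?addr0// => BL.
  by rewrite eq_sym => /negbTE ->; rewrite mul0r.
rewrite (decomp (fun BL => Psi BL.1 BL.2)).
rewrite (decomp (fun BL _ => EG (Psi BL.1 BL.2))).
apply: eq_bigr => BL _; rewrite ExZr.
apply: (@Ex_indep _ _ _ (~: off_edges BL.1 BL.2)); last by rewrite setCK; exact: dep.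
have key G G' : G :&: ~: off_edges BL.1 BL.2 = G' :&: ~: off_edges BL.1 BL.2 ->
    bfs r G k == BL -> bfs r G' k == BL.
  move=> GG' /eqP GBL; rewrite (@bfs_expose r G G' k) ?GBL// => e eB.
  have /setP/(_ e) := GG'; rewrite !inE.
  by move: eB; rewrite /bfs_ball /bfs_layer GBL => ->; rewrite !andbT.
move=> G G' GG'; rewrite /at_; congr (_%:R : R); congr nat_of_bool.
by apply/idP/idP; exact: key.
Qed.

Local Notation n := (#|V|%:R : R).
Local Notation a := (n * q).
Local Notation mu := (hit_prob q).

Lemma bernoulli_upper (s : nat) : mu s <= s%:R * q.
Proof.
have /andP[q0 q1] := q01; rewrite /hit_prob.
elim: s => [|s IH]; first by rewrite expr0 subrr mul0r.
rewrite exprS -natr1.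
have : (1 - q) ^+ s <= 1 by rewrite exprn_ile1// ?subr_ge0// lerBlDr lerDl.
have : 0 <= (1 - q) ^+ s by rewrite exprn_ge0// subr_ge0.
move: ((1 - q) ^+ s) IH => y IH y0 y1; nra.
Qed.

Lemma bernoulli_lower (s : nat) : s%:R * q - (s%:R * q) ^+ 2 <= mu s.
Proof.
have /andP[q0 q1] := q01; rewrite /hit_prob.
elim: s => [|s IH]; first by rewrite expr0 subrr mul0r expr0n subrr.
rewrite (exprS _ s) -natr1.
have : 0 <= (1 - q) ^+ s by rewrite exprn_ge0// subr_ge0.
have : 0 <= s%:R :> R by rewrite ler0n.
move: ((1 - q) ^+ s) (s%:R : R) IH => y t IH t0 y0.
have : 0 <= (1 - t * q + (t * q) ^+ 2 - y) * (1 - q).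
  by apply: mulr_ge0; lra.
have := sqr_ge0 q; have : 0 <= t * q by apply: mulr_ge0.
have : 0 <= t * q * q by rewrite !mulr_ge0.
have : 0 <= t * q * (t * q) * q by rewrite !mulr_ge0.
nra.
Qed.

Lemma mu_ge0 s : 0 <= mu s.
Proof.
have /andP[q0 q1] := q01.
by rewrite /hit_prob subr_ge0 exprn_ile1// ?subr_ge0// lerBlDr lerDl.
Qed.

Lemma card_le_n A : #|A|%:R <= n.
Proof. by rewrite ler_nat max_card. Qed.

Lemma next_sum G B L : (#|bfs_next G B L|%:R : R) =
  \sum_(v in ~: B) (0 < nb G L v)%:R.
Proof.
rewrite -sum1_card natr_sum big_mkcond [RHS]big_mkcond /=.
apply: eq_bigr => v _; rewrite !inE.
by case: (v \in B) => //=; case: (0 < _)%N.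
Qed.

Section fixed_layer.
Variables (B L : {set V}).
Hypothesis LB : L \subset B.

Let dBL : [disjoint ~: B & L].
Proof. by rewrite disjoint_sym disjoints_subset setCK. Qed.

Let qq := andP q01.

Lemma Ex_next : EG (fun G => #|bfs_next G B L|%:R) = #|~: B|%:R * mu #|L|.
Proof.
rewrite (eq_Ex _ (fun G => next_sum G B L)) (Ex_sum_nb (fun j => (0 < j)%:R))//.
by rewrite binexp_pos.
Qed.

Lemma Var_next : EG (fun G => (#|bfs_next G B L|%:R - #|~: B|%:R * mu #|L|) ^+ 2)
  <= #|~: B|%:R * mu #|L|.
Proof.
have := Var_sum_nb (fun j => (0 < j)%:R) dBL; rewrite binexp_pos.
rewrite (@eq_binexp _ _ _ (fun j => (0 < j)%:R ^+ 2) (fun j => (0 < j)%:R)).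
  by rewrite binexp_pos; under eq_Ex do rewrite -next_sum.
by move=> j; case: (0 < j)%N; rewrite ?expr1n// expr0n.
Qed.

Lemma mean_next_le : #|~: B|%:R * mu #|L| <= a * #|L|%:R.
Proof.
rewrite -mulrA (mulrC q); apply: ler_pM; rewrite ?ler0n ?mu_ge0 ?card_le_n//.
exact: bernoulli_upper.
Qed.

Lemma Ex_next_le : EG (fun G => #|bfs_next G B L|%:R) <= a * #|L|%:R.
Proof. by rewrite Ex_next mean_next_le. Qed.

Lemma Ex_next_sqr : EG (fun G => #|bfs_next G B L|%:R ^+ 2)
  <= a * #|L|%:R + (a * #|L|%:R) ^+ 2.
Proof.
set m := #|~: B|%:R * mu #|L|.
have m0 : 0 <= m by rewrite mulr_ge0 ?ler0n ?mu_ge0.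
have ma := mean_next_le; rewrite -/m in ma.
rewrite (eq_Ex _ (g := fun G => (#|bfs_next G B L|%:R - m) ^+ 2 +
   (2 * m * #|bfs_next G B L|%:R - m ^+ 2))); last by move=> G; ring.
rewrite ExD ExB ExZ Ex_cst Ex_next -/m.
have := Var_next; rewrite -/m; nra.
Qed.

(** The first term is the fluctuation around the mean. The other two are its bias: the vertices of
    [B] are lost, and [bernoulli_lower] has a quadratic error. *)
Lemma Ex_next_dev (c : R) : 0 < c ->
  EG (fun G => `|#|bfs_next G B L|%:R - a * #|L|%:R|) <=
  (c + a * #|L|%:R / c) / 2 + (q * (#|B|%:R * #|L|%:R) + n * (q * #|L|%:R) ^+ 2).
Proof.
move=> c0; have [q0 q1] := qq.
set m := #|~: B|%:R * mu #|L|.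
apply: (@le_trans _ _ (EG (fun G => `|#|bfs_next G B L|%:R - m| +
    (q * (#|B|%:R * #|L|%:R) + n * (q * #|L|%:R) ^+ 2)))).
  apply: le_Ex; first exact: edge_prob01.
  move=> G; rewrite -[X in `|X|](subrKA m); apply: le_trans (ler_normD _ _) _.
  rewrite lerD2l distrC ger0_norm ?subr_ge0 ?mean_next_le//.
  have nE : n = #|B|%:R + #|~: B|%:R by rewrite -natrD cardsC.
  have := bernoulli_lower #|L|; have := mu_ge0 #|L|; rewrite /m nE.
  have B0 : 0 <= #|B|%:R :> R by rewrite ler0n.
  have C0 : 0 <= #|~: B|%:R :> R by rewrite ler0n.
  move: (#|B|%:R : R) (#|~: B|%:R : R) (mu #|L|) (#|L|%:R : R) B0 C0.
  move=> x y z l x0 y0 z0 lz.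
  have : y * (l * q - (l * q) ^+ 2) <= y * z by rewrite ler_wpM2l.
  have : 0 <= x * (q * l) ^+ 2 by rewrite mulr_ge0 ?sqr_ge0.
  rewrite !expr2; nra.
rewrite ExD Ex_cst lerD2r.
apply: le_trans (Ex_normr_le edge_prob01 _ c0) _.
rewrite ler_pM2r ?invr_gt0// lerD2l ler_pM2r ?invr_gt0//.
exact: le_trans Var_next mean_next_le.
Qed.

End fixed_layer.

(** * Moments of the layer sizes *)

Section layer_moments.
Variable r : V.
Local Notation S k G := (#|bfs_layer r G k|%:R : R).
Local Notation BB k G := (#|bfs_ball r G k|%:R : R).
Hypothesis a4 : 4 <= a.

Let a0 : 0 < a. Proof. by apply: lt_le_trans a4; rewrite ltr0n. Qed.

Lemma card_next_dep (F : nat -> R) B L :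
  depends_on (off_edges B L) (fun G => F #|bfs_next G B L|).
Proof. by move=> G G' /next_off_dep ->. Qed.

Lemma Ex_layer_le k : EG (fun G => S k G) <= a ^+ k.
Proof.
elim: k => [|k IH].
  rewrite (eq_Ex _ (g := fun=> 1)) ?Ex_cst ?expr0//.
  by move=> G; rewrite /bfs_layer /= cards1.
rewrite (eq_Ex _ (g := fun G => #|bfs_next G (bfs_ball r G k) (bfs_layer r G k)|%:R))//.
rewrite (bfs_exposure r k (@card_next_dep (fun j => j%:R))).
apply: (@le_trans _ _ (EG (fun G => a * S k G))).
  apply: le_Ex; first exact: edge_prob01.
  by move=> G; apply: Ex_next_le; exact: layer_sub_ball.
by rewrite ExZ exprS ler_pM2l.
Qed.

Lemma card_ball_le k G : BB k.+1 G <= BB k G + S k.+1 G.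
Proof. by rewrite ballS -natrD ler_nat cardsU leq_subr. Qed.

Lemma Ex_ball_le k : EG (fun G => BB k G) <= 2 * a ^+ k.
Proof.
elim: k => [|k IH].
  rewrite (eq_Ex _ (g := fun=> 1)) ?Ex_cst ?expr0 ?mulr1 ?ler1n//.
  by move=> G; rewrite /bfs_ball /= cards1.
apply: (@le_trans _ _ (EG (fun G => BB k G + S k.+1 G))).
  by apply: le_Ex; [exact: edge_prob01|exact: card_ball_le].
rewrite ExD; apply: le_trans (lerD IH (Ex_layer_le k.+1)) _.
rewrite exprS; have : 0 < a ^+ k by rewrite exprn_gt0.
move: (a ^+ k) (a4); move: a => b y b4 y0; nra.
Qed.

(** The subtracted [a ^+ k] closes the induction: multiplied by [a ^+ 2], it absorbs the new
    variance term [a * a ^+ k]. *)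
Lemma Ex_layer_sqr k : EG (fun G => S k G ^+ 2) <= 2 * (a ^+ k) ^+ 2 - a ^+ k.
Proof.
elim: k => [|k IH].
  rewrite (eq_Ex _ (g := fun=> 1)) ?Ex_cst ?expr0.
    by rewrite expr1n; lra.
  by move=> G; rewrite /bfs_layer /= cards1 expr1n.
rewrite (eq_Ex _ (g := fun G => #|bfs_next G (bfs_ball r G k) (bfs_layer r G k)|%:R ^+ 2))//.
rewrite (bfs_exposure r k (@card_next_dep (fun j => j%:R ^+ 2))).
apply: (@le_trans _ _ (EG (fun G => a * S k G + a ^+ 2 * S k G ^+ 2))).
  apply: le_Ex; first exact: edge_prob01.
  move=> G; rewrite -exprMn; apply: Ex_next_sqr; exact: layer_sub_ball.
rewrite ExD !ExZ (exprS _ k); have := Ex_layer_le k; move: IH.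
move: (EG _) (EG _) => y x.
have : 0 < a ^+ k by rewrite exprn_gt0.
move: (a ^+ k) (a4) (a0); move: a => b z b4 b0 z0 xk yk.
have : b * y <= b * z by rewrite ler_pM2l.
have : b ^+ 2 * x <= b ^+ 2 * (2 * z ^+ 2 - z) by rewrite ler_pM2l ?exprn_gt0.
have : 0 <= (b - 4) * (b * z) by rewrite mulr_ge0 ?subr_ge0// mulr_ge0 ?ltW.
have : 0 <= b * z by rewrite mulr_ge0 ?ltW.
nra.
Qed.

Lemma Ex_ball_layer k :
  EG (fun G => BB k G * S k G) <= 4 * (a ^+ k) ^+ 2.
Proof.
elim: k => [|k IH].
  rewrite (eq_Ex _ (g := fun=> 1)) ?Ex_cst ?expr0.
    by rewrite expr1n; lra.
  by move=> G; rewrite /bfs_layer /bfs_ball /= cards1 mulr1.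
apply: (@le_trans _ _ (EG (fun G => BB k G * S k.+1 G + S k.+1 G ^+ 2))).
  apply: le_Ex; first exact: edge_prob01.
  by move=> G; rewrite expr2 -mulrDl ler_wpM2r ?ler0n ?card_ball_le.
rewrite ExD; move: (EG (fun G => S k.+1 G ^+ 2)) (Ex_layer_sqr k.+1) => y yk.
rewrite (eq_Ex _ (g := fun G => (fun B L G => #|B|%:R * #|bfs_next G B L|%:R)
   (bfs_ball r G k) (bfs_layer r G k) G))//.
rewrite (@bfs_exposure r k (fun B L G => #|B|%:R * #|bfs_next G B L|%:R)); last first.
  by move=> B L G G' /next_off_dep ->.
have : EG (fun G => EG (fun G' =>
    BB k G * #|bfs_next G' (bfs_ball r G k) (bfs_layer r G k)|%:R)) <= a * (4 * (a ^+ k) ^+ 2).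
  apply: (@le_trans _ _ (EG (fun G => a * (BB k G * S k G)))).
    apply: le_Ex; first exact: edge_prob01.
    move=> G; rewrite ExZ mulrCA ler_wpM2l ?ler0n//; apply: Ex_next_le.
    exact: layer_sub_ball.
  by rewrite ExZ ler_pM2l.
move: (EG _) yk => x; rewrite (exprS _ k).
have : 0 < a ^+ k by rewrite exprn_gt0.
move: (a ^+ k) (a4) (a0); move: a => b z b4 b0 z0 yz xz.
have : 0 <= (b - 4) * (b * z ^+ 2).
  by rewrite mulr_ge0 ?subr_ge0// mulr_ge0 ?sqr_ge0 ?ltW.
have : 0 <= b * z by rewrite mulr_ge0 ?ltW.
nra.
Qed.

Local Notation s := (Num.sqrt a).
Let s2 : 2 <= s.
Proof.
have -> : (2 : R) = Num.sqrt (2 ^+ 2) by rewrite sqrtr_sqr ger0_norm.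
by apply: ler_wsqrtr; apply: le_trans a4; rewrite expr2; lra.
Qed.

(** Both terms are telescoping sums. Passing from level [k] to [k.+1] costs a relative fluctuation
    of at most [s ^- k.+1] and a relative bias of order [a ^+ k.+1 / n]; the factors [1 - s ^- k]
    and [a ^+ k - 1] are the geometric sums of these costs. *)
Lemma Ex_layer_dev k : EG (fun G => `|S k G / a ^+ k - 1|) <=
  2 / s * (1 - s ^- k) + 12 * (a ^+ k - 1) / n.
Proof.
have s0 : 0 < s by apply: lt_le_trans s2.
have qn0 : q != 0 by apply: contraTneq (a0) => ->; rewrite mulr0 ltxx.
have sa : s ^+ 2 = a by rewrite sqr_sqrtr// ltW.
have n0 : 0 < n.
  by rewrite ltr0n; apply/card_gt0P; exists r.
elim: k => [|k IH].
  rewrite (eq_Ex _ (g := fun=> 0)) ?Ex_cst ?expr0 ?invr1 ?subrr ?mulr0 ?mul0r ?addr0//.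
  by move=> G; rewrite /bfs_layer /= cards1 mulr1 subrr normr0.
have ak : 0 < a ^+ k by rewrite exprn_gt0.
have ak1 : 0 < a ^+ k.+1 by rewrite exprn_gt0.
apply: (@le_trans _ _ (EG (fun G => `|S k G / a ^+ k - 1| +
    (a ^+ k.+1)^-1 * `|S k.+1 G - a * S k G|))).
  apply: le_Ex; first exact: edge_prob01.
  move=> G; rewrite -[X in _ + X * _]gtr0_norm ?invr_gt0// -normrM.
  apply: le_trans (ler_normD _ _); rewrite le_eqVlt; apply/orP; left.
  apply/eqP; congr `|_|; rewrite exprS; field.
  by rewrite (gt_eqF ak) (gt_eqF n0) qn0.
rewrite ExD ExZ.
rewrite [X in _ + _ * X](@bfs_exposure r k
  (fun B L G => `|#|bfs_next G B L|%:R - a * #|L|%:R|)); last first.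
  by move=> B L G G' /next_off_dep ->.
(* The layer [k.+1] has mean at most [a ^+ k.+1 = c * c], so [c] is the scale of its standard
   deviation and balances the two halves of [Ex_next_dev]. *)
set c := s ^+ k.+1.
have c0 : 0 < c by rewrite exprn_gt0.
have cc : c * c = a ^+ k.+1 by rewrite /c -exprD addnn -mul2n exprM sa.
set X := EG (fun G => EG _).
have Xle : X <= c + q * (4 * (a ^+ k) ^+ 2) + n * q ^+ 2 * (2 * (a ^+ k) ^+ 2).
  apply: (@le_trans _ _ (EG (fun G => c / 2 + a / c / 2 * S k G +
      (q * (BB k G * S k G) + n * q ^+ 2 * S k G ^+ 2)))).
    apply: le_Ex; first exact: edge_prob01.
    move=> G; have := Ex_next_dev (layer_sub_ball r G k) c0.
    move/le_trans; apply; rewrite le_eqVlt; apply/orP; left; apply/eqP.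
    by field; rewrite gt_eqF.
  rewrite !ExD !ExZ Ex_cst.
  have e1 : a / c / 2 * EG (fun G => S k G) <= c / 2.
    apply: (@le_trans _ _ (a / c / 2 * a ^+ k)).
      by rewrite ler_wpM2l ?Ex_layer_le// !divr_ge0// ltW.
    have -> : a / c / 2 * a ^+ k = a ^+ k.+1 / c / 2.
      by rewrite exprS; field; rewrite gt_eqF.
    by rewrite -cc mulfK// gt_eqF.
  have e2 : q * EG (fun G => BB k G * S k G) <= q * (4 * (a ^+ k) ^+ 2).
    by rewrite ler_wpM2l ?Ex_ball_layer//; case/andP: q01.
  have e3 : n * q ^+ 2 * EG (fun G => S k G ^+ 2) <=
      n * q ^+ 2 * (2 * (a ^+ k) ^+ 2).
    rewrite ler_wpM2l//; first by rewrite mulr_ge0 ?sqr_ge0 ?ler0n.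
    by apply: le_trans (Ex_layer_sqr k) _; rewrite lerBlDr lerDl ltW.
  lra.
have -> : 2 / s * (1 - s ^- k.+1) + 12 * (a ^+ k.+1 - 1) / n =
    (2 / s * (1 - s ^- k) + 12 * (a ^+ k - 1) / n) +
    (2 / s * (s ^- k - s ^- k.+1) + 12 * (a ^+ k.+1 - a ^+ k) / n) by ring.
apply: lerD => //.
rewrite ler_pdivrMl//; apply: le_trans Xle _; rewrite -addrA mulrDr.
apply: lerD.
  have sk : 0 < s ^+ k by rewrite exprn_gt0.
  have -> : a ^+ k.+1 * (2 / s * (s ^- k - s ^- k.+1)) = c * (2 * (s - 1) / s).
    by rewrite -cc /c (exprS s k); field; rewrite (gt_eqF s0) (gt_eqF sk).
  rewrite -{1}[c]mulr1 ler_pM2l//.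
  rewrite ler_pdivlMr// mul1r -subr_ge0.
  by rewrite (_ : 2 * (s - 1) - s = s - 2) ?subr_ge0//; ring.
have -> : q * (4 * (a ^+ k) ^+ 2) + n * q ^+ 2 * (2 * (a ^+ k) ^+ 2) =
    a ^+ k * (a * (4 * a ^+ k + 2 * (a * a ^+ k)) / n).
  by field; rewrite gt_eqF.
rewrite exprS.
have -> : a * a ^+ k * (12 * (a * a ^+ k - a ^+ k) / n) =
    a ^+ k * (a * (12 * (a * a ^+ k - a ^+ k)) / n) by ring.
rewrite ler_pM2l// ler_pM2r ?invr_gt0// ler_pM2l//.
move: (a ^+ k) ak => z z0.
have : 0 <= (a - 4) * z by rewrite mulr_ge0 ?subr_ge0// ltW.
move: a => b bz; lra.
Qed.

Lemma Ex_layer_dev_le k : EG (fun G => `|S k G - a ^+ k|) <=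
  a ^+ k * (2 / s + 12 * a ^+ k / n).
Proof.
have s0 : 0 < s by apply: lt_le_trans s2.
have ak : 0 < a ^+ k by rewrite exprn_gt0.
have n0 : 0 < n by rewrite ltr0n; apply/card_gt0P; exists r.
rewrite (eq_Ex _ (g := fun G => a ^+ k * `|S k G / a ^+ k - 1|)).
  rewrite ExZ ler_pM2l//; apply: le_trans (Ex_layer_dev k) _.
  apply: lerD.
    by rewrite -[leRHS]mulr1 ler_pM2l ?divr_gt0// lerBlDr lerDl.
  by rewrite ler_pM2r ?invr_gt0// ler_pM2l// lerBlDr lerDl.
move=> G; rewrite -[X in _ = X * _]gtr0_norm// -normrM; congr `|_|.
by field; rewrite gt_eqF.
Qed.

End layer_moments.
End erdos_renyi_measure.

(** * Rooted spanning trees *)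

Section bigmin_nat.
Local Open Scope nat_scope.

Lemma bigminn_le (I : eqType) (s : seq I) (P : pred I) (F : I -> nat) x0 i :
  i \in s -> P i -> \big[minn/x0]_(j <- s | P j) F j <= F i.
Proof.
elim: s => // j s IH; rewrite inE big_cons => /predU1P[<- ->|/IH{}IH Pi].
  exact: geq_minl.
case: (P j); last exact: IH.
exact: leq_trans (geq_minr _ _) (IH Pi).
Qed.

Lemma bigminn_attained (I : Type) (s : seq I) (P : pred I) (F : I -> nat) x0 :
  \big[minn/x0]_(j <- s | P j) F j = x0 \/
  exists2 i, P i & F i = \big[minn/x0]_(j <- s | P j) F j.
Proof.
elim: s => [|j s IH]; first by rewrite big_nil; left.
rewrite big_cons; case: ifP => // Pj.
rewrite minnE; case: (leqP (F j) (\big[minn/x0]_(j <- s | P j) F j)) => h.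
  right; exists j => //; lia.
by rewrite subKn; [|exact: ltnW].
Qed.

End bigmin_nat.

Section distance.
Variable V : finType.
Implicit Types (T : {set {set V}}) (x y u v : V).
Local Open Scope nat_scope.

Lemma adj_sym T : symmetric (adj T).
Proof. by move=> x y; rewrite /adj setUC. Qed.

Lemma connect_adj_sym T : connect_sym (adj T).
Proof. exact: sym_connect_sym (adj_sym T). Qed.

Lemma gdist_path T x p : path (adj T) x p -> gdist T x (last x p) <= size p.
Proof.
move=> xp; have [pV|Vp] := ltnP (size p) #|V|.
  apply: (@bigminn_le _ _ _ (fun k : 'I_#|V| => k : nat) _ (Ordinal pV)).
    by rewrite mem_index_enum.
  by apply/existsP; exists (in_tuple p); rewrite xp eqxx.
apply: leq_trans Vp; rewrite /gdist.
elim/big_rec: _ => // k m _ mV.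
exact: leq_trans (geq_minr _ _) mV.
Qed.

Lemma gdistP T x y : connect (adj T) x y ->
  exists p, [/\ path (adj T) x p, last x p = y & size p = gdist T x y].
Proof.
move=> /connectP[p0 xp0]; case/shortenP: xp0 => p xp up _ yE.
have := gdist_path xp; rewrite -yE => dp.
have pV : size p < #|V|.
  by have /card_uniqP := up => /= <-; exact: max_card.
case: (bigminn_attained (index_enum 'I_#|V|)
  (fun k : 'I_#|V| => [exists p : k.-tuple V, path (adj T) x p && (last x p == y)])
  (fun k => k : nat) #|V|) => [dV|[k /existsP[t /andP[xt /eqP ty]] kE]].
  by move: dp; rewrite /gdist dV leqNgt pV.
by exists t; split; rewrite // size_tuple.
Qed.

Lemma gdist_refl T x : gdist T x x = 0.
Proof. by apply/eqP; rewrite -leqn0; exact: (@gdist_path T x [::]). Qed.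

Lemma gdist_adj T r u v : connect (adj T) r u -> adj T u v ->
  gdist T r v <= (gdist T r u).+1.
Proof.
move=> /gdistP[p [rp <- <-]] uv.
have := @gdist_path T r (rcons p v); rewrite last_rcons size_rcons.
by apply; rewrite rcons_path rp.
Qed.

Lemma gdist_parent T r v : connect (adj T) r v -> v != r ->
  exists u, [/\ connect (adj T) r u, adj T u v & gdist T r v = (gdist T r u).+1].
Proof.
move=> /gdistP[p]; case: (lastP p) => [|p' w] [].
  by move=> _ <-; rewrite eqxx.
rewrite rcons_path last_rcons size_rcons => /andP[rp' uw] wv; rewrite wv in uw *.
move=> sE _; exists (last r p').
have cu : connect (adj T) r (last r p') by apply/connectP; exists p'.
split => //; apply/eqP; rewrite eqn_leq gdist_adj//= -sE ltnS.
exact: gdist_path.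
Qed.

Lemma gdist_sub T T' r v : T \subset T' -> connect (adj T) r v ->
  gdist T' r v <= gdist T r v.
Proof.
move=> TT' /gdistP[p [rp <- <-]]; apply: gdist_path.
by apply: sub_path rp => x y; exact: (subsetP TT').
Qed.

End distance.

Section spanning_trees.
Variables (V : finType) (r : V) (G : {set {set V}}).
Hypothesis GE : G \subset all_edges V.
Implicit Types (T : {set {set V}}) (u v w : V) (f : {ffun V -> V}).

Local Notation C := (component G r).
Local Notation C' := (component G r :\ r).
Local Notation dG := (gdist G r).

Lemma root_component : r \in C.
Proof. by rewrite inE connect0. Qed.

Lemma component_adj u v : v \in C -> adj G u v -> u \in C.
Proof.
rewrite !inE => rv uv; apply: connect_trans rv _.
by rewrite connect1// adj_sym.
Qed.

Section one_tree.
Variable T : {set {set V}}.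
Hypothesis sT : spanning_tree G r T.

Lemma tree_sub : T \subset G.
Proof.
by case: sT => TC _ _; apply/subsetP => e /(subsetP TC); rewrite inE => /andP[].
Qed.

Lemma tree_connect v : v \in C -> connect (adj T) r v.
Proof. by case: sT => _ cT _ vC; apply: cT => //; exact: root_component. Qed.

Lemma tree_adj u v : adj T u v -> (u \in C) /\ (v \in C).
Proof.
case: sT => TC _ _ /(subsetP TC); rewrite inE => /andP[_].
by rewrite subUset !sub1set => /andP[].
Qed.

(** The value [v] outside [C'] makes the parent function a total encoding of the tree, which
    [par_inj] needs. *)
Definition par v : V :=
  if v \in C' then odflt v [pick u | (u, v) \in directed_edges r T] else v.

Lemma parP v : v \in C' ->
  adj T (par v) v /\ gdist T r v = (gdist T r (par v)).+1.
Proof.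
move=> vC; rewrite /par vC; case: pickP => [u|noex] /=.
  by rewrite inE /= => /andP[uv /eqP].
move: vC; rewrite 2!inE => /andP[vr vC].
have [u [_ uv duv]] := gdist_parent (tree_connect vC) vr.
by have := noex u; rewrite inE /= uv duv eqxx.
Qed.

Let T0 := [set [set par v; v] | v in C'].

Let T0_sub : T0 \subset T.
Proof. by apply/subsetP => e /imsetP[v /parP[] pv _ ->]. Qed.

Let T0_connect v : v \in C -> connect (adj T0) r v.
Proof.
elim: {v}(gdist T r v) {-2}v (erefl (gdist T r v)) => [|k IH] v vk vC;
  have [->|vr] := eqVneq v r; rewrite ?connect0//.
  have [|_] := @parP v; first by rewrite 2!inE vr.
  by rewrite vk.
have vC' : v \in C' by rewrite 2!inE vr.
have [pv dv] := parP vC'.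
apply: connect_trans (connect1 (_ : adj T0 (par v) v)); last first.
  by apply/imsetP; exists v.
apply: IH; first by move: dv; rewrite vk => -[].
by have [] := tree_adj pv.
Qed.

(* An edge outside the parent edges would close a cycle. *)
Lemma tree_parE : T = T0.
Proof.
apply/eqP; rewrite eqEsubset T0_sub andbT; apply/subsetP => e eT.
have /cards2P[x [y [xy eE]]] : #|e| == 2%N.
  by have := subsetP GE e (subsetP tree_sub e eT); rewrite inE.
rewrite {}eE in eT *; apply: contraT => xyT0.
have [xC yC] := tree_adj eT.
have : connect (adj T0) x y.
  apply: connect_trans (T0_connect yC).
  by rewrite connect_adj_sym T0_connect.
case/connectP => p0 xp0; case/shortenP: xp0 => p xp up _ yE.
case: sT => _ _ /(_ (x :: p)); case: p xp up yE => [|z p] xp up yE.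
  by rewrite yE eqxx in xy.
case: p xp up yE => [|w p] xp up yE.
  by move: xp; rewrite /= andbT /adj -[z]yE (negbTE xyT0).
move=> /(_ isT up); rewrite /= rcons_path; move: xp => /= /and3P[xz zw wp].
have sub u v : adj T0 u v -> adj T u v by exact: (subsetP T0_sub).
rewrite (sub _ _ xz) (sub _ _ zw) (sub_path sub wp) /=.
by rewrite -[last w p]yE adj_sym /adj eT.
Qed.

Lemma directed_edgesE u v :
  ((u, v) \in directed_edges r T) = (v \in C') && (u == par v).
Proof.
apply/idP/andP => [|[vC /eqP ->]]; last first.
  by have [pv dv] := parP vC; rewrite inE /= pv dv eqxx.
rewrite inE /= => /andP[uv /eqP duv]; have [uC vC] := tree_adj uv.
have vC' : v \in C'.
  by rewrite 2!inE vC andbT; apply: contra_eqN duv => /eqP ->; rewrite gdist_refl.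
split => //; have : [set u; v] \in T0 by rewrite -tree_parE.
case/imsetP => w wC' uvw; have [pw dw] := parP wC'.
have [vw|vw] := eqVneq v w; first by rewrite vw in uvw *; apply/eqP/(set2_injl uvw).
have : v \in [set par w; w] by rewrite -uvw !inE eqxx orbT.
rewrite !inE (negbTE vw) orbF => /eqP vpw.
have : w \in [set u; v] by rewrite uvw !inE eqxx orbT.
rewrite !inE [w == v]eq_sym (negbTE vw) orbF => /eqP wu.
by exfalso; move: dw; rewrite -vpw wu duv; lia.
Qed.

Lemma card_tree : #|T| = #|C'|.
Proof.
rewrite tree_parE card_in_imset// => v w vC wC vw.
have [vw'|vw'] := eqVneq v w => //.
have : v \in [set par w; w] by rewrite -vw !inE eqxx orbT.
rewrite !inE (negbTE vw') orbF => /eqP vpw.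
have : w \in [set par v; v] by rewrite vw !inE eqxx orbT.
rewrite !inE [w == v]eq_sym (negbTE vw') orbF => /eqP wpv.
have [_ dv] := parP vC; have [_ dw] := parP wC.
by exfalso; move: dv dw; rewrite -vpw -wpv; lia.
Qed.

(** The graph distance of the parent is at most its tree distance, which is one less than that of
    [v]; adjacency gives the converse inequality. *)
Lemma par_dG v : v \in C' -> gdist T r v = dG v ->
  adj G (par v) v /\ (dG (par v)).+1 = dG v.
Proof.
move=> vC dE; have [pv dv] := parP vC.
have aG : adj G (par v) v by exact: (subsetP tree_sub).
have [pC _] := tree_adj pv; split => //.
apply/eqP; rewrite eqn_leq; apply/andP; split.
  by rewrite -dE dv ltnS; apply: gdist_sub tree_sub _; exact: tree_connect.
by apply: gdist_adj aG; move: pC; rewrite inE.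
Qed.

End one_tree.

Lemma card_common T T' : spanning_tree G r T -> spanning_tree G r T' ->
  #|directed_edges r T :&: directed_edges r T'| =
  #|[set v in C' | par T v == par T' v]|.
Proof.
move=> sT sT'.
have inj : injective (fun v => (par T v, v)) by move=> v w [].
rewrite -(card_imset _ inj); apply: eq_card => -[u v]; rewrite inE.
rewrite !directed_edgesE//; apply/andP/imsetP.
  by move=> [/andP[vC /eqP ->] /andP[_ pp]]; exists v; rewrite // inE vC.
by move=> [w]; rewrite inE => /andP[wC pp] [-> ->]; rewrite wC eqxx.
Qed.

Lemma par_inj T T' : spanning_tree G r T -> spanning_tree G r T' ->
  (forall v, par T v = par T' v) -> T = T'.
Proof.
move=> sT sT' pp; rewrite (tree_parE sT) (tree_parE sT').
by apply: eq_in_imset => v _; rewrite pp.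
Qed.

Section tree_of_choice.
Variables (h : V -> nat) (P : V -> {set V}).
Hypothesis h0 : h r = 0%N.
Hypothesis hP : forall v u, v \in C' -> u \in P v -> adj G u v /\ (h u).+1 = h v.

Definition choice_tree f : {set {set V}} := [set [set f v; v] | v in C'].

Definition good_choice f := forall v, v \in C' -> f v \in P v.

Lemma choice_adj f u v : adj (choice_tree f) u v ->
  (v \in C' /\ u = f v) \/ (u \in C' /\ v = f u).
Proof.
case/imsetP => w wC uvw.
have : w \in [set u; v] by rewrite uvw !inE eqxx orbT.
rewrite in_set2 => /orP[] /eqP wE; rewrite {}wE in wC uvw.
  by right; split => //; apply: (@set2_injl _ u); rewrite setUC.
by left; split => //; exact: set2_injl uvw.
Qed.

Section good.
Variable f : {ffun V -> V}.
Hypothesis gf : good_choice f.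
Local Notation Tf := (choice_tree f).

Lemma choice_level u v : adj Tf u v -> (h v <= (h u).+1)%N.
Proof.
case/choice_adj => -[wC ->]; have [_ <-] := hP wC (gf wC) => //.
by rewrite -addn2 leq_addr.
Qed.

Lemma choice_connect v : v \in C ->
  connect (adj Tf) r v /\ (gdist Tf r v <= h v)%N.
Proof.
elim: {v}(h v) {-2}v (erefl (h v)) => [|k IH] v vk vC;
  have [->|vr] := eqVneq v r; rewrite ?connect0 ?gdist_refl//.
  have vC' : v \in C' by rewrite 2!inE vr.
  by have [_] := hP vC' (gf vC'); rewrite vk.
have vC' : v \in C' by rewrite 2!inE vr.
have [fv hv] := hP vC' (gf vC').
have fk : h (f v) = k by move: hv; rewrite vk => -[].
have [cf df] := IH _ fk (component_adj vC fv).
have av : adj Tf (f v) v by apply/imsetP; exists v.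
split; first exact: connect_trans cf (connect1 av).
by apply: leq_trans (gdist_adj cf av) _; rewrite -hv ltnS.
Qed.

(** An edge changes the level by at most one, so no path reaches [v] in fewer than [h v] steps. Thus
    all trees built from [P] have the same distances, hence the same Gibbs weight. *)
Lemma choice_gdist v : v \in C -> gdist Tf r v = h v.
Proof.
move=> vC; have [cv dv] := choice_connect vC.
apply/eqP; rewrite eqn_leq dv /=.
have [p [rp <- <-]] := gdistP cv.
suff H x q : path (adj Tf) x q -> (h (last x q) <= h x + size q)%N.
  by have := H r p rp; rewrite h0 add0n.
elim: q x => [|y q IH] x /=; first by rewrite addn0.
move=> /andP[xy yq]; apply: leq_trans (IH _ yq) _.
by rewrite addnS -addSn leq_add2r choice_level.
Qed.

(* A vertex of maximal level on a cycle would have two parents. *)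
Lemma choice_spanning : spanning_tree G r Tf.
Proof.
split.
- apply/subsetP => e /imsetP[v vC ->].
  have [fv _] := hP vC (gf vC).
  move: vC; rewrite 2!inE => /andP[_ vC]; rewrite inE.
  by rewrite [_ \in G]fv subUset !sub1set vC (component_adj vC fv).
- move=> x y xC yC; apply: (@connect_trans _ _ r).
    by rewrite connect_adj_sym; have [] := choice_connect xC.
  by have [] := choice_connect yC.
move=> c c2 uc; apply/negP => cc.
have [w0 w0c] : exists w, w \in c by case: c c2 {uc cc} => // w c; exists w; rewrite inE eqxx.
have [v vc vmax] : exists2 v, v \in c & forall u, u \in c -> (h u <= h v)%N.
  have := @arg_maxnP _ w0 (mem c) h w0c => -[v vc vm].
  by exists v.
have [i s sE] := rot_to vc.
have up u : u \in c -> adj Tf u v -> u = f v.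
  move=> uc' /choice_adj[[]//|[uC vE]]; have [_] := hP uC (gf uC).
  by rewrite -vE => hu; have := vmax u uc'; rewrite -hu ltnn.
have cv : cycle (adj Tf) (v :: s) by rewrite -sE rot_cycle.
have us : uniq (v :: s) by rewrite -sE rot_uniq.
have s1 : (1 < size s)%N by have := size_rot i c; rewrite sE /= => e; rewrite -ltnS e.
have sc u : u \in s -> u \in c by move=> us'; rewrite -(mem_rot i) sE inE us' orbT.
case: s {sE} cv us s1 sc => [//|x s] /=; case/lastP: s => [//|s y].
rewrite rcons_path last_rcons => /and3P[vx _ yv] /and3P[_ xs _] _ sc.
have xf : x = f v by apply: up; rewrite 1?adj_sym//; apply: sc; rewrite inE eqxx.
have yf : y = f v by apply: up => //; apply: sc; rewrite inE mem_rcons inE eqxx orbT.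
by move: xs; rewrite mem_rcons inE xf yf eqxx.
Qed.

End good.

(** An edge used with opposite orientations by [f] and [f'] would both raise and lower the level
    [h]. *)
Lemma choice_tree_inj f f' : good_choice f -> good_choice f' ->
  choice_tree f = choice_tree f' -> {in C', f =1 f'}.
Proof.
move=> gf gf' ff' v vC.
have : [set f v; v] \in choice_tree f by apply/imsetP; exists v.
rewrite ff' => /choice_adj[[_ ->]//|[wC vE]].
have [_] := hP wC (gf' _ wC); rewrite -vE.
have [_ <-] := hP vC (gf _ vC).
by move=> /eqP; rewrite eqn_leq ltnNge ltnW.
Qed.

End tree_of_choice.

(** * Bounds on the Gibbs weights *)

Section gibbs_bounds.
Variables (R : realType) (b : R).
Hypothesis b0 : 0 <= b.
Local Notation eb := (expR (- b)).

Definition gpar v : {set V} := [set u | adj G u v & (dG u).+1 == dG v].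
Definition deg v : nat := #|[set u | adj G u v]|.
Definition nd v : nat := #|gpar v|.

Lemma gpar_sub v : gpar v \subset [set u | adj G u v].
Proof. by apply/subsetP => u; rewrite !inE => /andP[]. Qed.

Lemma nd_le_deg v : (nd v <= deg v)%N.
Proof. exact: subset_leq_card (gpar_sub v). Qed.

Lemma nd_gt0 v : v \in C' -> (0 < nd v)%N.
Proof.
rewrite 2!inE => /andP[vr vC]; rewrite inE in vC.
have [u [_ uv du]] := gdist_parent vC vr.
by apply/card_gt0P; exists u; rewrite inE uv du eqxx.
Qed.

Lemma deg_gt0 v : v \in C' -> (0 < deg v)%N.
Proof. by move=> /nd_gt0/leq_trans; apply; exact: nd_le_deg. Qed.

(** This is [(sum_u w u)^2 + (z - 1) * sum_u (w u)^2], where [w u] is [eb] for each neighbour [u] of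
    [v], plus 1 if [u] is a breadth-first parent. It is the sum over all pairs of parents of [v] in
    the two replicas, a coincidence being weighted by [z]. *)
Definition Uterm (z : R) v : R :=
  ((nd v)%:R + (deg v)%:R * eb) ^+ 2 +
  (z - 1) * ((nd v)%:R + 2 * (nd v)%:R * eb + (deg v)%:R * eb ^+ 2).

Let E0 : R := \sum_(v in C) (dG v)%:R.

(** A state of [v] consists of its parent and a flag telling whether its tree distance exceeds its
    graph distance. The actual excess is not recorded: being at least 1, it costs at least a factor
    [eb]. A flagged vertex may have any neighbour as parent. *)
Let W v (x : V * bool) : R :=
  if v \in C' then if x.2 then (adj G x.1 v)%:R * eb else (x.1 \in gpar v)%:R
  else (x == (v, false))%:R.

Let W_ge0 v x : 0 <= W v x.
Proof.
rewrite /W; case: ifP => _; last by rewrite ler0n.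
by case: ifP => _; rewrite ?mulr_ge0 ?ler0n ?expR_ge0.
Qed.

Let state T v : V * bool := (par T v, (v \in C') && (gdist T r v != dG v)).

Let gibbs_weight_le T : spanning_tree G r T ->
  gibbs_weight b G r T <= expR (- b * E0) * \prod_v W v (state T v).
Proof.
move=> sT; rewrite /gibbs_weight asboolT//.
have bigC (F : V -> nat) : F r = 0%N ->
    expR (- b * \sum_(v in C) (F v)%:R) = \prod_(v in C') expR (- b * (F v)%:R).
  move=> Fr; rewrite mulr_sumr expR_sum (big_setD1 r) ?root_component//=.
  by rewrite Fr mulr0 expR0 mul1r.
rewrite (bigC _ (gdist_refl _ _)) /E0 (bigC _ (gdist_refl _ _)).
have -> : \prod_v W v (state T v) = \prod_(v in C') W v (state T v).
  rewrite [RHS]big_mkcond; apply: eq_bigr => v _; case: ifPn => // vC.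
  by rewrite /W /state (negbTE vC) /par (negbTE vC) eqxx.
rewrite -big_split; apply: ler_prod => v vC; rewrite expR_ge0 /=.
rewrite /W /state vC /=.
have vT : connect (adj T) r v.
  by apply: tree_connect sT _ _; move: vC; rewrite 2!inE => /andP[].
have dd := gdist_sub (tree_sub sT) vT.
case: eqVneq => /= [dE|dN].
  have [pa pd] := par_dG sT vC dE.
  by rewrite dE inE pa pd eqxx mulr1.
have [pv _] := parP sT vC.
have -> : adj G (par T v) v by exact: (subsetP (tree_sub sT)).
rewrite mul1r -expRD ler_expR -[X in _ <= _ - X]mulr1 !mulNr -opprD lerN2 -mulrDr.
by rewrite ler_wpM2l// natr1 ler_nat ltn_neqAle eq_sym dN.
Qed.

Lemma sum_inj_le (I J : finType) (A : pred I) (f : I -> J) (F : J -> R) :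
  {in A &, injective f} -> (forall j, 0 <= F j) ->
  \sum_(i in A) F (f i) <= \sum_j F j.
Proof.
move=> fi F0.
rewrite -(big_imset (h := f) (A := A) F)//=.
by rewrite [leRHS](bigID (mem (f @: A)))/= lerDl sumr_ge0.
Qed.

Definition common T T' : nat :=
  #|directed_edges r T :&: directed_edges r T'|.

Let Wsum (z : R) v : 0 <= z -> v \in C' ->
  \sum_(x : (V * bool) * (V * bool)) W v x.1 * W v x.2 *
     (if (v \in C') && (x.1.1 == x.2.1) then z else 1) = Uterm z v.
Proof.
move=> z0 vC.
pose w u : R := (u \in gpar v)%:R + (adj G u v)%:R * eb.
have Wb (F : V -> R) :
    \sum_(x : V * bool) W v x * F x.1 = \sum_u w u * F u.
  rewrite -(pair_bigA _ (fun u (i : bool) => W v (u, i) * F u)) /=.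
  apply: eq_bigr => u _; rewrite big_bool /= /W vC /= -mulrDl addrC //.
transitivity (\sum_u \sum_u' w u * w u' * (if u == u' then z else 1)).
  rewrite -(pair_bigA _ (fun x x' : V * bool => W v x * W v x' *
     (if (v \in C') && (x.1 == x'.1) then z else 1))) /=.
  transitivity (\sum_(x : V * bool) W v x *
      \sum_u' w u' * (if x.1 == u' then z else 1)).
    apply: eq_bigr => x _; rewrite -(Wb (fun u' => if x.1 == u' then z else 1)).
    by rewrite mulr_sumr; apply: eq_bigr => x' _; rewrite vC mulrA.
  rewrite (Wb (fun u => \sum_u' w u' * (if u == u' then z else 1))).
  apply: eq_bigr => u _; rewrite mulr_sumr; apply: eq_bigr => u' _.
  by rewrite mulrA.
transitivity ((\sum_u w u) ^+ 2 + (z - 1) * \sum_u w u ^+ 2).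
  rewrite expr2 mulr_suml mulr_sumr -big_split /=; apply: eq_bigr => u _.
  rewrite (bigD1 u)//= eqxx [\sum_u0 w u0](bigD1 u)//=.
  rewrite (eq_bigr (fun u' => w u * w u')) => [|u' /negbTE uu']; last first.
    by rewrite eq_sym uu' mulr1.
  by rewrite -mulr_sumr; ring.
have cnt (A : {set V}) : \sum_u (u \in A)%:R = #|A|%:R :> R.
  rewrite -sum1_card natr_sum [RHS]big_mkcond /=.
  by apply: eq_bigr => u _; case: (u \in A).
have w1 : \sum_u w u = (nd v)%:R + (deg v)%:R * eb.
  rewrite /w big_split /= cnt -mulr_suml; congr (_ + _ * _); rewrite /deg -cnt.
  by apply: eq_bigr => u _; rewrite inE.
have w2 : \sum_u w u ^+ 2 =
    (nd v)%:R + 2 * (nd v)%:R * eb + (deg v)%:R * eb ^+ 2.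
  rewrite /nd /deg -!cnt mulr_sumr !mulr_suml -!big_split /=.
  apply: eq_bigr => u _; rewrite /w [in RHS]inE.
  have := subsetP (gpar_sub v) u; rewrite inE.
  case: (u \in gpar v) => [/(_ isT) ->|_] /=; first by ring.
  by case: (adj G u v) => /=; ring.
by rewrite w1 w2.
Qed.

Lemma Uterm_ge0 (z : R) v : 0 <= z -> v \in C' -> 0 <= Uterm z v.
Proof.
move=> z0 vC; rewrite -Wsum//; apply: sumr_ge0 => x _.
by rewrite !mulr_ge0//; case: ifP.
Qed.

(** Pairs of spanning trees embed into the functions from vertices to pairs of states. Forgetting
    that the states come from trees only enlarges the sum, and the sum over all functions factorizes
    over the vertices. *)
Lemma gibbs_pair_upper (z : R) : 0 <= z ->
  \sum_T \sum_T' gibbs_weight b G r T * gibbs_weight b G r T' * z ^+ common T T'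
  <= expR (- b * E0) ^+ 2 * \prod_(v in C') Uterm z v.
Proof.
move=> z0.
pose F (s : {ffun V -> (V * bool) * (V * bool)}) : R :=
  \prod_v (W v (s v).1 * W v (s v).2 *
     (if (v \in C') && ((s v).1.1 == (s v).2.1) then z else 1)).
have F0 s : 0 <= F s.
  apply: prodr_ge0 => v _; rewrite !mulr_ge0//.
  by case: ifP.
have -> : \prod_(v in C') Uterm z v = \sum_s F s.
  rewrite /F -(bigA_distr_bigA (fun v x => W v x.1 * W v x.2 *
     (if (v \in C') && (x.1.1 == x.2.1) then z else 1))) /=.
  rewrite big_mkcond /=; apply: eq_bigr => v _.
  case: (boolP (v \in C')) => vC; first by rewrite -Wsum// vC.
  rewrite (bigD1 ((v, false), (v, false)))//= big1 ?addr0; last first.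
    move=> [x x'] xx'; rewrite /W (negbTE vC) /=.
    move: xx'; rewrite xpair_eqE negb_and => /orP[] /negbTE ->;
    by rewrite ?mul0r ?mulr0 ?mul0r.
  by rewrite /W (negbTE vC) eqxx /= !mulr1.
pose A (TT : {set {set V}} * {set {set V}}) :=
  `[< spanning_tree G r TT.1 >] && `[< spanning_tree G r TT.2 >].
pose st (TT : {set {set V}} * {set {set V}}) :
    {ffun V -> (V * bool) * (V * bool)} := [ffun v => (state TT.1 v, state TT.2 v)].
have st_inj : {in A &, injective st}.
  move=> [T1 T2] [T1' T2'] /andP[/asboolP s1 /asboolP s2].
  move=> /andP[/asboolP s1' /asboolP s2'] /ffunP sE.
  congr pair; apply: par_inj => // v; have := sE v; rewrite !ffunE /state /=;
  by case.
apply: (@le_trans _ _ (\sum_(TT in A)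
    expR (- b * E0) ^+ 2 * F (st TT))); last first.
  rewrite -mulr_sumr ler_wpM2l ?exprn_ge0 ?expR_ge0//.
  exact: sum_inj_le.
rewrite pair_bigA /= [leRHS]big_mkcond /=; apply: ler_sum => -[T T'] _ /=.
rewrite unfold_in /A /=; case: asboolP => sT /=; last first.
  by rewrite {1}/gibbs_weight asboolF// !mul0r.
case: asboolP => sT' /=; last first.
  by rewrite {2}/gibbs_weight asboolF// mulr0 mul0r.
have -> : z ^+ common T T' =
    \prod_v (if (v \in C') && (par T v == par T' v) then z else 1).
  rewrite /common card_common// -prodr_const big_mkcond /=.
  by apply: eq_bigr => v _; rewrite inE.
have -> : F (st (T, T')) = (\prod_v W v (state T v)) * (\prod_v W v (state T' v)) *
    \prod_v (if (v \in C') && (par T v == par T' v) then z else 1).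
  by rewrite -!big_split /=; apply: eq_bigr => v _; rewrite ffunE.
rewrite mulrA; apply: ler_wpM2r.
  by apply: prodr_ge0 => v _; case: ifP.
have gw0 S : 0 <= gibbs_weight b G r S.
  by rewrite /gibbs_weight; case: asboolP; rewrite ?expR_ge0.
by rewrite expr2 mulrACA; apply: ler_pM => //; exact: gibbs_weight_le.
Qed.

(** Independent choices of parents from the sets [P v] give distinct spanning trees of equal weight,
    and the product counts them. *)
Lemma gibbs_lower (h : V -> nat) (P : V -> {set V}) : h r = 0%N ->
  (forall v u, v \in C' -> u \in P v -> adj G u v /\ (h u).+1 = h v) ->
  expR (- b * \sum_(v in C) (h v)%:R) * \prod_(v in C') #|P v|%:R <=
  \sum_T gibbs_weight b G r T.
Proof.
move=> h0 hP.
pose P' v := if v \in C' then P v else [set v].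
have -> : \prod_(v in C') #|P v|%:R =
    \sum_(f : {ffun V -> V}) \prod_v (f v \in P' v)%:R :> R.
  rewrite -(bigA_distr_bigA (fun v u => (u \in P' v)%:R)) big_mkcond /=.
  apply: eq_bigr => v _; rewrite /P'; case: ifP => _.
    rewrite -sum1_card natr_sum big_mkcond /=.
    by apply: eq_bigr => u _; case: (u \in P v).
  rewrite (bigD1 v)//= inE eqxx big1 ?addr0// => u uv.
  by rewrite inE (negbTE uv).
pose A := [pred f : {ffun V -> V} | [forall v, f v \in P' v]].
have AG f : f \in A -> good_choice P f.
  by move=> /forallP fP v vC; have := fP v; rewrite /P' vC.
rewrite mulr_sumr; apply: (@le_trans _ _ (\sum_(f in A)
    gibbs_weight b G r (choice_tree f))); last first.
  apply: (@sum_inj_le _ _ A choice_tree (gibbs_weight b G r)).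
    move=> f f' fA f'A ff'; apply/ffunP => v.
    have [vC|vC] := boolP (v \in C').
      by apply: (choice_tree_inj hP (AG _ fA) (AG _ f'A) ff').
    move: fA f'A; rewrite !inE => /forallP/(_ v) + /forallP/(_ v).
    by rewrite /P' (negbTE vC) !inE => /eqP -> /eqP ->.
  by move=> S; rewrite /gibbs_weight; case: asboolP; rewrite ?expR_ge0.
rewrite [leRHS]big_mkcond /=; apply: ler_sum => f _.
case: ifPn => [fA|].
  rewrite /gibbs_weight asboolT; last exact: (choice_spanning hP (AG _ fA)).
  rewrite [X in _ <= expR (_ * X)](eq_bigr (fun v => (h v)%:R)); last first.
    by move=> v vC; rewrite (choice_gdist h0 hP (AG _ fA) vC).
  rewrite [X in _ * X]big1 ?mulr1// => v _; move: fA; rewrite inE => /forallP -> //.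
rewrite inE negb_forall => /existsP[v fv].
by rewrite [X in _ * X](bigD1 v)//= (negbTE fv) mul0r mulr0.
Qed.

Lemma gibbs_ge0 T : 0 <= gibbs b G r T.
Proof.
have gw0 S : 0 <= gibbs_weight b G r S.
  by rewrite /gibbs_weight; case: asboolP; rewrite ?expR_ge0.
by rewrite /gibbs divr_ge0// sumr_ge0.
Qed.

Lemma sum_gibbs_le1 : \sum_T gibbs b G r T <= 1.
Proof.
rewrite /gibbs -mulr_suml.
by case: (eqVneq (\sum_T gibbs_weight b G r T) 0) => [->|n0];
  rewrite ?mul0r ?ler01 ?divff.
Qed.

Lemma gibbs_pair_le1 (E : {set {set V}} -> {set {set V}} -> bool) :
  \sum_T \sum_(T' | E T T') gibbs b G r T * gibbs b G r T' <= 1.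
Proof.
apply: (@le_trans _ _ (\sum_T gibbs b G r T)); last exact: sum_gibbs_le1.
apply: ler_sum => T _; rewrite -mulr_sumr ler_piMr ?gibbs_ge0//.
apply: le_trans sum_gibbs_le1; rewrite [leRHS](bigID (E T)) /= lerDl.
by apply: sumr_ge0 => S _; exact: gibbs_ge0.
Qed.

Lemma overlapE T T' : spanning_tree G r T -> spanning_tree G r T' ->
  overlap R r T T' = (common T T')%:R / #|C'|%:R.
Proof.
move=> sT sT'; rewrite /overlap (card_tree sT) (card_tree sT') -expr2.
by rewrite sqrtr_sqr ger0_norm.
Qed.

(** The exponential Markov inequality with [z = expR t], where negative [t] serves lower tails. The
    comparison data [h] and [P] stay free, and both bounds being products over the vertices, their
    quotient can be estimated vertex by vertex. *)
Lemma gibbs_chernoff (t s : R) (h : V -> nat) (P : V -> {set V})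
    (E : {set {set V}} -> {set {set V}} -> bool) : h r = 0%N ->
  (forall v u, v \in C' -> u \in P v -> adj G u v /\ (h u).+1 = h v) ->
  (forall v, v \in C' -> (0 < #|P v|)%N) ->
  (forall T T', spanning_tree G r T -> spanning_tree G r T' -> E T T' ->
     s <= t * (common T T')%:R) ->
  \sum_T \sum_(T' | E T T') gibbs b G r T * gibbs b G r T' <=
  expR (- s) * \prod_(v in C') (Uterm (expR t) v *
    (expR (b * ((h v)%:R - (dG v)%:R)) / #|P v|%:R) ^+ 2).
Proof.
move=> h0 hP P0 Es.
set Z := \sum_T gibbs_weight b G r T.
pose ell : R := expR (- b * \sum_(v in C) (h v)%:R) * \prod_(v in C') #|P v|%:R.
have ell0 : 0 < ell.
  by rewrite mulr_gt0 ?expR_gt0// prodr_gt0// => v vC; rewrite ltr0n P0.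
have Zell : ell <= Z by exact: gibbs_lower.
have Z0 : 0 < Z by exact: lt_le_trans Zell.
have gw0 S : 0 <= gibbs_weight b G r S.
  by rewrite /gibbs_weight; case: asboolP; rewrite ?expR_ge0.
apply: (@le_trans _ _ (expR (- s) * (\sum_T \sum_T' gibbs_weight b G r T *
    gibbs_weight b G r T' * expR t ^+ common T T') / Z ^+ 2)).
  rewrite !mulr_sumr mulr_suml; apply: ler_sum => T _.
  rewrite !mulr_sumr mulr_suml big_mkcond /=; apply: ler_sum => T' _.
  have rhs0 : 0 <= expR (- s) * (gibbs_weight b G r T * gibbs_weight b G r T' *
      expR t ^+ common T T') / Z ^+ 2.
    by rewrite !mulr_ge0 ?invr_ge0 ?exprn_ge0 ?expR_ge0 ?gw0 ?(ltW Z0).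
  case: ifP => // ETT'.
  have [sT|nT] := pselect (spanning_tree G r T); last first.
    by rewrite /gibbs {1}/gibbs_weight asboolF// !mul0r.
  have [sT'|nT'] := pselect (spanning_tree G r T'); last first.
    have -> : gibbs b G r T' = 0 by rewrite /gibbs /gibbs_weight asboolF// mul0r.
    by rewrite mulr0.
  rewrite /gibbs -/Z mulrACA -invfM -expr2 ler_pM2r ?invr_gt0 ?exprn_gt0//.
  rewrite mulrCA ler_peMr ?mulr_ge0// -expRM_natl -expRD.
  rewrite -[leLHS]expR0 ler_expR addrC subr_ge0 mulrC; exact: Es.
rewrite -mulrA ler_pM2l ?expR_gt0// ler_pdivrMr ?exprn_gt0//.
apply: le_trans (gibbs_pair_upper (expR_ge0 t)) _.
have U0 v : v \in C' -> 0 <= Uterm (expR t) v.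
  by apply: Uterm_ge0; exact: expR_ge0.
rewrite big_split /=.
set Q := \prod_(v in C') Uterm _ _.
have Q0 : 0 <= Q by apply: prodr_ge0.
rewrite mulrC -mulrA ler_wpM2l//.
rewrite prodrXl big_split /= -expR_sum -mulr_sumr sumrB.
rewrite -exprMn lerXn2r ?nnegrE ?expR_ge0//.
  rewrite !mulr_ge0 ?expR_ge0 ?(ltW Z0)//; apply: prodr_ge0 => v _.
  by rewrite invr_ge0 ler0n.
apply: le_trans (_ : _ <= expR (b * (\sum_(v in C') (h v)%:R -
   \sum_(v in C') (dG v)%:R)) * (\prod_(v in C') #|P v|%:R^-1) * ell) _; last first.
  rewrite ler_wpM2l// mulr_ge0 ?expR_ge0//.
  by apply: prodr_ge0 => v _; rewrite invr_ge0 ler0n.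
rewrite /ell mulrACA -expRD prodfV mulVf; last first.
  by apply/prodf_neq0 => v vC; rewrite pnatr_eq0 -lt0n P0.
rewrite mulr1 ler_expR /E0 !(big_setD1 r root_component) /= gdist_refl h0.
rewrite le_eqVlt; apply/orP; left; apply/eqP; ring.
Qed.

End gibbs_bounds.
End spanning_trees.

(** * Tail bounds for the overlap on a fixed graph *)

Section bfs_distance.
Variables (V : finType) (r : V) (G : {set {set V}}).
Local Notation C := (component G r).
Local Notation dG := (gdist G r).

Lemma nb_gt0P (A : {set V}) v : reflect (exists2 u, u \in A & adj G u v) (0 < nb G A v)%N.
Proof.
apply: (iffP card_gt0P) => [[u]|[u uA uv]].
  by rewrite inE => /andP[uA uv]; exists u.
by exists u; rewrite inE uA.
Qed.

Lemma bfs_gdist k :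
  (forall v, (v \in bfs_ball r G k) = (v \in C) && (dG v <= k)%N) /\
  (forall v, (v \in bfs_layer r G k) = (v \in C) && (dG v == k)).
Proof.
elim: k => [|k [IHb IHl]].
  suff H v : (v == r) = (v \in C) && (dG v == 0%N).
    by split=> v; rewrite /bfs_ball /bfs_layer /= inE H// leqn0.
  apply/eqP/andP => [->|[vC /eqP d0]]; first by rewrite gdist_refl root_component.
  rewrite inE in vC; have [p [_ lp sp]] := gdistP vC.
  by rewrite d0 in sp; rewrite -lp (size0nil sp).
have nextP v : (v \in bfs_next G (bfs_ball r G k) (bfs_layer r G k)) =
    (v \in C) && (dG v == k.+1).
  rewrite 2!inE; apply/andP/andP.
    move=> [vB /nb_gt0P[u]]; rewrite IHl => /andP[uC /eqP du] uv.
    have vC : v \in C by apply: (component_adj uC); rewrite adj_sym.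
    split => //; move: vB; rewrite IHb vC /= -ltnNge => kd.
    rewrite eqn_leq kd andbT -du; apply: gdist_adj uv.
    by rewrite inE in uC.
  move=> [vC /eqP dv]; rewrite IHb vC dv /= ltnn; split => //.
  have vr : v != r by apply: contra_eqN dv => /eqP ->; rewrite gdist_refl.
  have := vC; rewrite inE => cv; have [u [cu uv du]] := gdist_parent cv vr.
  apply/nb_gt0P; exists u => //; rewrite IHl inE cu /=.
  by move: du; rewrite dv => -[->].
split => v; last by rewrite layerS nextP.
rewrite ballS inE layerS nextP IHb -andb_orr; congr (_ && _).
by rewrite [RHS]leq_eqVlt orbC.
Qed.

Lemma in_ball k v : (v \in bfs_ball r G k) = (v \in C) && (dG v <= k)%N.
Proof. by have [] := bfs_gdist k. Qed.

Lemma in_layer k v : (v \in bfs_layer r G k) = (v \in C) && (dG v == k).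
Proof. by have [] := bfs_gdist k. Qed.

Lemma nd_layer k v : v \in bfs_layer r G k.+1 -> nd r G v = nb G (bfs_layer r G k) v.
Proof.
rewrite in_layer => /andP[vC /eqP dv]; apply: eq_card => u.
rewrite !inE in_layer dv eqSS [in RHS]andbC /adj.
case: (boolP ([set u; v] \in G)) => //= uv.
by rewrite (component_adj vC uv).
Qed.

Lemma nb_le_deg A v : (nb G A v <= deg G v)%N.
Proof. by apply/subset_leq_card/subsetP => u; rewrite !inE => /andP[]. Qed.

End bfs_distance.

(** * Comparison with breadth-first trees *)

Section bfs_comparison.
Variables (R : realType) (V : finType) (r : V) (G : {set {set V}}) (b : R).
Hypothesis GE : G \subset all_edges V.
Hypothesis b0 : 0 <= b.
Local Notation C' := (component G r :\ r).
Local Notation eb := (expR (- b)).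

(** The expected number of agreements if each vertex picks its parent uniformly among its
    breadth-first parents, independently in the two replicas. *)
Definition inv_parents : R := \sum_(v in C') (nd r G v)%:R^-1.
(** The total weight of attaching [v] with a flag, relative to the number of its breadth-first
    parents. *)
Definition excess v : R := (deg G v)%:R * eb / (nd r G v)%:R.

Lemma eb_le1 : eb <= 1.
Proof. by rewrite -expR0 ler_expR oppr_le0. Qed.

(** With [x = (z - 1) / nd] and [dl] the excess, the left side is at most [1 + x + 6 dl + 3 dl^2].
    Since [1 + x >= 1 / 3], the expansion of [(1 + x) (1 + 9 dl)^2] dominates it; this is where the
    9 and the lower bound on [z] come from. *)
Lemma Uterm_bfs (z : R) v : v \in C' -> 3^-1 <= z <= 3 ->
  Uterm r G b z v / (nd r G v)%:R ^+ 2 <=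
  expR ((z - 1) / (nd r G v)%:R) * (1 + 9 * excess v) ^+ 2.
Proof.
move=> vC /andP[z3 z3'].
have n1 : 1 <= (nd r G v)%:R :> R by rewrite ler1n nd_gt0.
have d1 : 1 <= (deg G v)%:R :> R by rewrite ler1n (deg_gt0 (r := r)).
have e0 := expR_gt0 (- b); have e1 := eb_le1.
rewrite /Uterm /excess; move: (nd r G v)%:R (deg G v)%:R eb n1 d1 e0 e1 => n d e.
move=> n1 d1 e0 e1.
have n0 : 0 < n by apply: lt_le_trans n1.
set dl := d * e / n; pose x := (z - 1) / n.
have dl0 : 0 <= dl by rewrite !mulr_ge0 ?invr_ge0// ltW// (lt_le_trans _ d1).
have en : e / n <= dl by rewrite ler_pM2r ?invr_gt0// ler_peMl// ltW.
have en0 : 0 <= e / n by rewrite divr_ge0 ?ltW.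
have x1 : 3^-1 <= 1 + x.
  have : - (2 / 3) <= x.
    rewrite ler_pdivlMr// mulNr; nra.
  lra.
have -> : ((n + d * e) ^+ 2 + (z - 1) * (n + 2 * n * e + d * e ^+ 2)) / n ^+ 2 =
    (1 + dl) ^+ 2 + x + (z - 1) * (2 * (e / n) + dl * (e / n)).
  by rewrite /dl /x; field; exact: lt0r_neq0.
apply: (@le_trans _ _ ((1 + x) * (1 + 9 * dl) ^+ 2)); last first.
  by rewrite ler_wpM2r ?sqr_ge0// expR_ge1Dx.
have : (z - 1) * (2 * (e / n) + dl * (e / n)) <= 2 * (2 * dl + dl ^+ 2).
  apply: (@le_trans _ _ (2 * (2 * (e / n) + dl * (e / n)))).
    apply: ler_wpM2r; first by apply: addr_ge0; apply: mulr_ge0.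
    by rewrite lerBlDr (le_trans z3')// -natr1.
  rewrite ler_pM2l//; apply: lerD; first by rewrite ler_pM2l.
  by rewrite expr2 ler_wpM2l.
have : 0 <= (1 + x - 3^-1) * (18 * dl + 81 * dl ^+ 2).
  by rewrite mulr_ge0 ?subr_ge0// addr_ge0// mulr_ge0 ?sqr_ge0.
have := sqr_ge0 dl; nra.
Qed.

Lemma expR_quad (t : R) : -2^-1 <= t <= 2^-1 -> expR t - 1 <= t + 2 * t ^+ 2.
Proof.
move=> /andP[t1 t2].
have t0 : 0 < 1 - t by lra.
have : expR t <= (1 - t)^-1.
  rewrite -[expR t]invrK lef_pV2 ?posrE ?invr_gt0 ?expR_gt0//.
  by rewrite -expRN; apply: expR_ge1Dx.
move/le_trans => H; rewrite lerBlDr; apply: H.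
rewrite -[leLHS]mul1r ler_pdivrMr//.
have : 0 <= t ^+ 2 * (1 - 2 * t) by rewrite mulr_ge0 ?sqr_ge0//; lra.
rewrite (_ : t ^+ 2 * (1 - 2 * t) = (t + 2 * t ^+ 2 + 1) * (1 - t) - 1); last by ring.
lra.
Qed.

Lemma expR_half_bounds (t : R) : -2^-1 <= t <= 2^-1 -> 3^-1 <= expR t <= 3.
Proof.
move=> t2; apply/andP; split.
  have := expR_ge1Dx t; move: t2 => /andP[]; lra.
have := expR_quad t2; move: t2 => /andP[t1 t2].
have : t ^+ 2 <= 2^-1 * 2^-1.
  rewrite -[t ^+ 2]real_normK ?num_real// -expr2 lerXn2r ?nnegrE//.
  by rewrite ler_norml t1.
lra.
Qed.

Lemma inv_parents_le : inv_parents <= #|C'|%:R.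
Proof.
rewrite -sum1_card natr_sum; apply: ler_sum => v vC.
by rewrite invf_le1 ?ler1n ?ltr0n nd_gt0.
Qed.

Lemma chernoff_bfs (t s : R) (E : {set {set V}} -> {set {set V}} -> bool) :
  -2^-1 <= t <= 2^-1 ->
  (forall T T', spanning_tree G r T -> spanning_tree G r T' -> E T T' ->
     s <= t * (common r T T')%:R) ->
  \sum_T \sum_(T' | E T T') gibbs b G r T * gibbs b G r T' <=
  expR (- s + (t + 2 * t ^+ 2) * inv_parents +
        2 * \sum_(v in C') ln (1 + 9 * excess v)).
Proof.
move=> t2 Es.
have z3 := expR_half_bounds t2.
have := @gibbs_chernoff V r G GE R b b0 t s (gdist G r) (gpar r G) E
  (gdist_refl _ _) _ _ Es.
move=> /(_ _ _)/le_trans; apply.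
- by move=> v u _; rewrite inE => /andP[uv /eqP].
- by move=> v vC; exact: nd_gt0.
have x0 v : v \in C' -> 0 < 1 + 9 * excess v.
  by move=> vC; rewrite ltr_wpDr// mulr_ge0// /excess !mulr_ge0 ?invr_ge0 ?expR_ge0.
apply: (@le_trans _ _ (expR (- s) * \prod_(v in C')
    (expR ((expR t - 1) / (nd r G v)%:R) * (1 + 9 * excess v) ^+ 2))).
  rewrite ler_pM2l ?expR_gt0//; apply: ler_prod => v vC.
  rewrite subrr mulr0 expR0 mul1r exprVn -/(nd r G v).
  rewrite (Uterm_bfs vC z3) andbT.
  by rewrite divr_ge0 ?exprn_ge0// Uterm_ge0 ?expR_ge0.
rewrite -addrA expRD ler_pM2l ?expR_gt0// big_split /= -expR_sum expRD.
apply: ler_pM; rewrite ?expR_ge0 ?prodr_ge0 ?ler_expR//.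
- by move=> v _; rewrite sqr_ge0.
- rewrite -mulr_sumr -/inv_parents ler_wpM2r ?expR_quad//.
  by apply: sumr_ge0 => v _; rewrite invr_ge0.
rewrite prodrXl expRM_natl expR_sum.
rewrite [X in _ <= X ^+ 2](eq_bigr (fun v => 1 + 9 * excess v))// => v vC.
by rewrite lnK ?posrE ?x0.
Qed.

Lemma overlap_tail_bfs (c eps tau : R) : 0 < tau <= 2^-1 ->
  \sum_T \sum_(T' | eps < `|overlap R r T T' - c|) gibbs b G r T * gibbs b G r T'
  <= 2 * expR (- (tau * eps * #|C'|%:R) +
       tau * `|inv_parents - c * #|C'|%:R| + 2 * tau ^+ 2 * #|C'|%:R +
        2 * \sum_(v in C') ln (1 + 9 * excess v)).
Proof.
move=> /andP[t0 t2].
set N := #|C'|%:R; set H := 2 * \sum_(v in C') ln _.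
pose E1 T T' := (c + eps) * N <= (common r T T')%:R :> R.
pose E2 T T' := (common r T T')%:R <= (c - eps) * N :> R.
have M0 : 0 <= inv_parents by apply: sumr_ge0 => v _; rewrite invr_ge0.
have MN : inv_parents <= N by exact: inv_parents_le.
have M2 : 2 * tau ^+ 2 * inv_parents <= 2 * tau ^+ 2 * N.
  by rewrite ler_wpM2l// mulr_ge0// sqr_ge0.
have h1 : \sum_T \sum_(T' | E1 T T') gibbs b G r T * gibbs b G r T' <=
    expR (- (tau * eps * N) + tau * `|inv_parents - c * N| + 2 * tau ^+ 2 * N + H).
  apply: le_trans (@chernoff_bfs tau (tau * ((c + eps) * N)) E1 _ _) _.
  - by rewrite t2 andbT; lra.
  - by move=> T T' _ _ h; rewrite ler_pM2l.
  rewrite ler_expR lerD2r.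
  have : tau * (inv_parents - c * N) <= tau * `|inv_parents - c * N|.
    by rewrite ler_pM2l// ler_norm.
  lra.
have h2 : \sum_T \sum_(T' | E2 T T') gibbs b G r T * gibbs b G r T' <=
    expR (- (tau * eps * N) + tau * `|inv_parents - c * N| + 2 * tau ^+ 2 * N + H).
  apply: le_trans (@chernoff_bfs (- tau) (- tau * ((c - eps) * N)) E2 _ _) _.
  - by apply/andP; split; lra.
  - by move=> T T' _ _ h; rewrite !mulNr lerN2 ler_pM2l.
  rewrite ler_expR lerD2r sqrrN.
  have : tau * (- (inv_parents - c * N)) <= tau * `|inv_parents - c * N|.
    by rewrite ler_pM2l// -normrN ler_norm.
  lra.
apply: le_trans (_ : _ <=
  \sum_T \sum_(T' | E1 T T') gibbs b G r T * gibbs b G r T' +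
  \sum_T \sum_(T' | E2 T T') gibbs b G r T * gibbs b G r T') _; last first.
  by rewrite mulr_natl mulr2n; exact: lerD.
rewrite -big_split /=; apply: ler_sum => T _.
rewrite [leLHS]big_mkcond [X in _ <= X + _]big_mkcond [X in _ <= _ + X]big_mkcond.
rewrite -big_split /=; apply: ler_sum => T' _.
have g0 := gibbs_ge0 r G b.
have gg0 : 0 <= gibbs b G r T * gibbs b G r T' by rewrite mulr_ge0.
have [sT|nT] := pselect (spanning_tree G r T); last first.
  have -> : gibbs b G r T = 0 by rewrite /gibbs /gibbs_weight asboolF// mul0r.
  by rewrite mul0r !if_same addr0.
have [sT'|nT'] := pselect (spanning_tree G r T'); last first.
  have -> : gibbs b G r T' = 0 by rewrite /gibbs /gibbs_weight asboolF// mul0r.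
  by rewrite mulr0 !if_same addr0.
case: ifP => [|_]; last by rewrite addr_ge0//; case: ifP.
rewrite (overlapE GE R sT sT') -/N => eo.
have : E1 T T' || E2 T T'.
  rewrite /E1 /E2; have [N0|N0] := eqVneq N 0.
    by rewrite N0 !mulr0 !ler0n.
  have {N0}N0 : 0 < N by rewrite lt0r N0 ler0n.
  move: eo; rewrite ltr_normr => /orP[] eo; apply/orP; [left|right].
    rewrite -ler_pdivlMr//; lra.
  rewrite -ler_pdivrMr//; lra.
case/orP => ->; first by rewrite lerDl; case: ifP.
by rewrite lerDr; case: ifP.
Qed.

End bfs_comparison.

Lemma ler_sqr2 (R : realDomainType) (x y : R) : 0 <= x -> x <= y -> x ^+ 2 <= y ^+ 2.
Proof. by move=> x0 xy; rewrite !expr2 ler_pM. Qed.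

(** * Comparison with displaced trees *)

Section displaced_comparison.
Variables (R : realType) (V : finType) (r : V) (G : {set {set V}}) (b : R).
Hypothesis GE : G \subset all_edges V.
Hypothesis b0 : 0 <= b.
Local Notation C := (component G r).
Local Notation C' := (component G r :\ r).
Local Notation dG := (gdist G r).
Local Notation eb := (expR (- b)).
Variables (k : nat) (X : {set V}) (y a Q t : R).
Hypothesis XL : X \subset bfs_layer r G k.+1.
Hypothesis y0 : 0 < y.
Hypothesis a1 : 1 <= a.
Hypothesis aQ : a <= Q * y.
Hypothesis Q1 : 1 <= Q.
Hypothesis t0 : 0 <= t.
Hypothesis za : expR t <= a.
Hypothesis zbX : expR t * expR b <= a \/ X = bfs_layer r G k.+1.

Definition regular : {set V} :=
  [set v | [&& v \notin bfs_ball r G k, v \notin X & y <= (nb G X v)%:R]].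

Let Y := regular.
Let pi v : V := odflt v [pick u in gpar r G v].

Let pi_gpar v : v \in C' -> pi v \in gpar r G v.
Proof.
move=> vC; rewrite /pi; case: pickP => [u|noex] //=.
by have /card_gt0P[u] := nd_gt0 vC; rewrite noex.
Qed.

Let nonY := C' :&: ~: Y.

(* The comparison trees attach most vertices to X: a regular vertex of the layer
   k.+1 moves down by one level when it has few parents there, unless it must
   stay to serve as the parent of an irregular vertex. *)

Let dsp : {set V} := [set v in Y | [&& v \in bfs_layer r G k.+1,
  (nd r G v)%:R < (deg G v)%:R * eb & v \notin pi @: nonY]].

Let h v := (dG v + (v \in dsp))%N.

Let nbX v : {set V} := [set u in X | adj G u v].

(** A regular vertex outside the layer [k.+1] lies in the layer [k.+2], so attaching it to [X]
    respects its distance. The last case forgoes all freedom of choice; it occurs only for the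
    vertices of [Exc], which pay the factor [K]. *)
Let P v : {set V} :=
  if v \in dsp then nbX v
  else if (v \in Y) && (v \notin bfs_layer r G k.+1) then nbX v
  else if (v \in Y) && ((deg G v)%:R * eb <= (nd r G v)%:R) then gpar r G v
  else [set pi v].

Let X_C u : u \in X -> u \in C /\ dG u = k.+1.
Proof. by move=> /(subsetP XL); rewrite in_layer => /andP[uC /eqP]. Qed.

Let YP v : v \in Y -> [/\ v \in C', v \notin X, (v \in bfs_layer r G k.+1) ||
  (v \in bfs_layer r G k.+2) & y <= (nb G X v)%:R].
Proof.
rewrite inE => /and3P[vB vX yv].
have /nb_gt0P[u uX uv] : (0 < nb G X v)%N by rewrite -(ltr_nat R) (lt_le_trans y0).
have [uC du] := X_C uX.
have vC : v \in C by apply: (component_adj uC); rewrite adj_sym.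
have vr : v != r.
  by apply: contraNneq vB => ->; rewrite in_ball gdist_refl root_component.
split => //; first by rewrite 2!inE vr.
move: vB; rewrite in_ball !in_layer vC /= -ltnNge => kd.
have : (dG v <= k.+2)%N by rewrite -du; apply: gdist_adj uv; rewrite inE in uC.
rewrite leq_eqVlt => /orP[->|]; rewrite ?orbT// ltnS => dk.
by rewrite eqn_leq dk kd.
Qed.

Let dsp_notX u : u \in X -> u \notin dsp.
Proof. by move=> uX; rewrite !inE uX !andbF. Qed.

Let hX v u : u \in nbX v -> adj G u v /\ h u = k.+1.
Proof.
rewrite inE => /andP[uX uv]; split => //.
by rewrite /h (negbTE (dsp_notX uX)) addn0; have [] := X_C uX.
Qed.

Let dsp_layer v : v \in dsp -> dG v = k.+1.
Proof. by rewrite inE => /and3P[_]; rewrite in_layer => /andP[_ /eqP]. Qed.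

Let hgpar v u : u \in gpar r G v -> u \notin dsp -> v \notin dsp ->
  adj G u v /\ (h u).+1 = h v.
Proof.
rewrite inE => /andP[uv /eqP du] ud vd; split => //.
by rewrite /h (negbTE ud) (negbTE vd) !addn0.
Qed.

Let hP v u : v \in C' -> u \in P v -> adj G u v /\ (h u).+1 = h v.
Proof.
move=> vC; rewrite /P; case: ifPn => [vd|vd].
  move=> /hX[uv ->]; split => //.
  by rewrite /h vd (dsp_layer vd) addn1.
case: ifPn => [/andP[vY vL]|vYL].
  move=> /hX[uv ->]; split => //; rewrite /h (negbTE vd) addn0.
  by have [_ _ + _] := YP vY; rewrite (negbTE vL) /= in_layer => /andP[_ /eqP ->].
case: ifPn => [/andP[vY _] ug|vYd].
  apply: hgpar => //; rewrite vY /= negbK in vYL.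
  apply/negP => ud; have := dsp_layer ud.
  move: ug; rewrite inE => /andP[_ /eqP]; move: vYL; rewrite in_layer.
  by move=> /andP[_ /eqP ->] -[->] /n_Sn.
rewrite inE => /eqP ->; apply: hgpar => //; first exact: pi_gpar.
have [vY|vY] := boolP (v \in Y); last first.
  rewrite inE negb_and; apply/orP; right; rewrite !negb_and negbK.
  by apply/orP; right; apply/orP; right; apply/imsetP; exists v; rewrite // !inE in vC vY *; rewrite vC vY.
apply/negP => pd; have := dsp_layer pd.
rewrite vY /= negbK in vYL; have := pi_gpar vC; rewrite inE => /andP[_ /eqP].
by move: vYL; rewrite in_layer => /andP[_ /eqP ->] -[->] /n_Sn.
Qed.

Let h0 : h r = 0%N.
Proof.
rewrite /h gdist_refl; case: (boolP (r \in dsp)) => // /dsp_layer.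
by rewrite gdist_refl.
Qed.

Let nbXE v : #|nbX v| = nb G X v.
Proof. by apply: eq_card => u; rewrite !inE. Qed.

Let P0 v : v \in C' -> (0 < #|P v|)%N.
Proof.
move=> vC; rewrite /P; case: ifPn => [|_].
  rewrite inE => /andP[vY _]; have [_ _ _ yv] := YP vY.
  by rewrite nbXE -(ltr_nat R) (lt_le_trans y0).
case: ifPn => [/andP[vY _]|_].
  have [_ _ _ yv] := YP vY.
  by rewrite nbXE -(ltr_nat R) (lt_le_trans y0).
by case: ifP => _; rewrite ?cards1// -/(nd r G v) nd_gt0.
Qed.

Let Exc := nonY :|: pi @: nonY.
Let K : R := 8 * expR t * a ^+ 2.

Let z1 : 1 <= expR t. Proof. by rewrite -expR0 ler_expR. Qed.

Let K1 : 1 <= K.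
Proof. by rewrite /K; have := a1; have := z1; rewrite expr2; nra. Qed.

Let U_le v : v \in C' -> Uterm r G b (expR t) v <=
  ((nd r G v)%:R + (deg G v)%:R * eb) ^+ 2 +
  expR t * (3 * (nd r G v)%:R + (deg G v)%:R * eb).
Proof.
move=> vC; rewrite /Uterm lerD2l.
have e1 := eb_le1 b0; have e0 := expR_gt0 (- b).
have n0 : 0 <= (nd r G v)%:R :> R by [].
have d0 : 0 <= (deg G v)%:R :> R by [].
apply: ler_pM.
- by rewrite subr_ge0 z1.
- by rewrite !addr_ge0// !mulr_ge0// ?sqr_ge0// ltW.
- by rewrite gerBl.
move: eb e1 e0 (nd r G v)%:R (deg G v)%:R n0 d0 => e e1 e0 n d n0 d0.
have : n * e <= n * 1 by rewrite ler_wpM2l.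
have : d * e * e <= d * e * 1 by rewrite ler_wpM2l// mulr_ge0// ltW.
rewrite expr2; lra.
Qed.

(* The bound [deg <= a * expR (deg / a)] avoids any control of the maximal
   degree. *)
Let ratio_le v : v \in C' ->
  Uterm r G b (expR t) v * (expR (b * ((h v)%:R - (dG v)%:R)) / #|P v|%:R) ^+ 2
  <= 8 * Q ^+ 2 * (if v \in Exc then K else 1) * expR (2 * ((deg G v)%:R / a)).
Proof.
move=> vC; set rho := expR ((deg G v)%:R / a).
have -> : expR (2 * ((deg G v)%:R / a)) = rho ^+ 2 by rewrite expRM_natl.
have a0 : 0 < a by apply: lt_le_trans a1.
have Q0 : 0 < Q by apply: lt_le_trans Q1.
have d1 : 1 <= (deg G v)%:R :> R by rewrite ler1n (deg_gt0 (r := r)).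
have n1 : 1 <= (nd r G v)%:R :> R by rewrite ler1n nd_gt0.
have nd_d : (nd r G v)%:R <= (deg G v)%:R :> R by rewrite ler_nat nd_le_deg.
have rho1 : 1 <= rho by rewrite -expR0 ler_expR divr_ge0// ltW.
have drho : (deg G v)%:R <= a * rho.
  rewrite -ler_pdivrMl// mulrC; apply: le_trans (expR_ge1Dx _).
  by rewrite lerDr.
have e1 := eb_le1 b0; have e0 := expR_gt0 (- b).
have eB : eb * expR b = 1 by rewrite -expRD addNr expR0.
have B0 := expR_gt0 b.
have UB := U_le vC.
have tail2 (s : R) : 1 <= s -> 8 * Q ^+ 2 * rho ^+ 2 <= 8 * Q ^+ 2 * s * rho ^+ 2.
  move=> s1; rewrite ler_wpM2r ?sqr_ge0// ler_peMr// mulr_ge0// sqr_ge0//.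
have ifK : 1 <= (if v \in Exc then K else 1) by case: ifP.
(* Covers both ways of attaching to [X]; [w] is [expR t], multiplied by [expR b] for a displaced
   vertex. *)
have degX (w : R) : 0 < w <= a -> y <= (nb G X v)%:R ->
    (4 * (deg G v)%:R ^+ 2 + 4 * w * (deg G v)%:R) / (nb G X v)%:R ^+ 2 <=
    8 * Q ^+ 2 * rho ^+ 2.
  move=> /andP[w0 wa] yv.
  have v0 : 0 < (nb G X v)%:R :> R by exact: lt_le_trans yv.
  rewrite ler_pdivrMr ?exprn_gt0//.
  have h1 : a * rho <= Q * (nb G X v)%:R * rho.
    rewrite ler_pM2r ?expR_gt0//; apply: le_trans aQ _.
    by rewrite ler_pM2l.
  have h2 : (deg G v)%:R ^+ 2 <= (a * rho) ^+ 2 by exact: ler_sqr2.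
  have h3 : w * (deg G v)%:R <= (a * rho) ^+ 2.
    rewrite expr2; apply: ler_pM => //; first exact: ltW.
    by apply: le_trans wa _; rewrite ler_peMr// ltW.
  have h4 : (a * rho) ^+ 2 <= (Q * (nb G X v)%:R * rho) ^+ 2.
    by apply: ler_sqr2 => //; rewrite mulr_ge0// ?expR_ge0// ltW.
  have -> : 8 * Q ^+ 2 * rho ^+ 2 * (nb G X v)%:R ^+ 2 =
     8 * (Q * (nb G X v)%:R * rho) ^+ 2 by ring.
  lra.
have sq0 (x : R) : 0 <= x -> 0 <= x ^+ 2 by move=> _; exact: sqr_ge0.
rewrite /P /h; case: ifPn => [vd|vd].
  have vd' := vd; move: vd; rewrite inE => /and4P[vY vL ndt _].
  have [_ vX _ yv] := YP vY.
  (* A regular vertex of the layer [k.+1] lies outside [X], so [X] is not the whole layer and the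
     first alternative of [zbX] must hold. *)
  have zb : expR t * expR b <= a by case: zbX => // XE; rewrite XE vL in vX.
  apply: le_trans (tail2 _ ifK).
  rewrite nbXE natrD addrC addKr mulr1.
  apply: le_trans (degX (expR t * expR b) _ yv); last by rewrite zb mulr_gt0 ?expR_gt0.
  rewrite exprMn exprVn [leLHS]mulrA ler_wpM2r ?invr_ge0 ?sqr_ge0//.
  (* As [nd < deg * eb], the upper bound is a quadratic polynomial in [deg * eb]; the price
     [expR b ^+ 2] of the displacement then cancels against [eb]. *)
  apply: (@le_trans _ _ ((4 * ((deg G v)%:R * eb) ^+ 2 +
      4 * expR t * ((deg G v)%:R * eb)) * expR b ^+ 2)).
    rewrite ler_wpM2r ?sqr_ge0//; apply: le_trans UB _.
    move: ndt n1 (expR_gt0 t) => /ltW; move: (nd r G v)%:R (_ * eb) (expR t).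
    move=> n s z ns n1 z0.
    have : (n + s) ^+ 2 <= (2 * s) ^+ 2 by apply: ler_sqr2; lra.
    have : z * (3 * n + s) <= z * (4 * s) by rewrite ler_pM2l//; lra.
    rewrite (_ : (2 * s) ^+ 2 = 4 * s ^+ 2); last by ring.
    lra.
  rewrite le_eqVlt; apply/orP; left; apply/eqP.
  move: (deg G v)%:R (expR t) eb (expR b) eB => d z e B eB.
  transitivity (4 * d ^+ 2 * (e * B) ^+ 2 + 4 * (z * B) * d * (e * B)).
    by ring.
  by rewrite eB; ring.
rewrite addn0 subrr mulr0 expR0.
have UB2 : Uterm r G b (expR t) v <=
    4 * (deg G v)%:R ^+ 2 + 4 * expR t * (deg G v)%:R.
  apply: le_trans UB _.
  have : (deg G v)%:R * eb <= (deg G v)%:R by rewrite ler_piMr.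
  have : 0 <= (deg G v)%:R * eb by rewrite mulr_ge0// ltW.
  move: n1 nd_d (expR_gt0 t); move: (nd r G v)%:R (deg G v)%:R (_ * eb) (expR t).
  move=> n d s z n1 nd_d z0 s0 sd.
  have : (n + s) ^+ 2 <= (2 * d) ^+ 2 by apply: ler_sqr2; lra.
  have : z * (3 * n + s) <= z * (4 * d) by rewrite ler_pM2l//; lra.
  rewrite (_ : (2 * d) ^+ 2 = 4 * d ^+ 2); last by ring.
  lra.
case: ifPn => [/andP[vY vL]|vYL].
  have [_ vX _ yv] := YP vY.
  apply: le_trans (tail2 _ ifK).
  apply: le_trans (degX (expR t) _ yv); last by rewrite za expR_gt0.
  by rewrite nbXE mul1r exprVn ler_wpM2r ?invr_ge0 ?sqr_ge0.
case: ifPn => [/andP[vY tn]|vYt].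
  have [_ vX _ yv] := YP vY.
  rewrite vY /= negbK in vYL.
  have zb : expR t * expR b <= a by case: zbX => // XE; rewrite XE vYL in vX.
  apply: le_trans (tail2 _ ifK); rewrite mul1r exprVn -/(nd r G v).
  have n0 : 0 < (nd r G v)%:R :> R by apply: lt_le_trans n1.
  rewrite ler_pdivrMr ?exprn_gt0//.
  (* Having many parents means [y * eb <= nd], and [zb] with [a <= Q * y] converts this into a bound
     on [expR t]. The part of [Uterm] linear in [expR t] is thereby absorbed into the square of
     [nd]. *)
  have zn : expR t <= Q * (nd r G v)%:R.
    have ye : y * eb <= (nd r G v)%:R.
      apply: le_trans tn; rewrite ler_pM2r//; apply: le_trans yv _.
      by rewrite ler_nat nb_le_deg.
    have : Q * (y * eb) <= Q * (nd r G v)%:R by rewrite ler_pM2l.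
    apply: le_trans; rewrite mulrA.
    apply: (@le_trans _ _ (a * eb)); last by rewrite ler_pM2r.
    by rewrite -[leLHS]mulr1 -eB [eb * _]mulrC mulrA ler_pM2r.
  apply: le_trans UB _.
  have QQ : 1 <= Q ^+ 2 * rho ^+ 2.
    by rewrite -[leLHS]mulr1 ler_pM// exprn_ege1.
  have QQ' : Q <= Q ^+ 2 * rho ^+ 2.
    rewrite -[leLHS]mulr1; apply: ler_pM => //; [exact: ltW| |exact: exprn_ege1].
    by rewrite expr2 ler_peMr// ltW.
  have s0 : 0 <= (deg G v)%:R * eb by rewrite mulr_ge0// ltW.
  move: tn zn n0 (expR_gt0 t) s0; move: (nd r G v)%:R (_ * eb) => n s.
  move: (expR t) => z tn zn n0 z0 s0.
  have : (n + s) ^+ 2 <= (2 * n) ^+ 2 by apply: ler_sqr2; lra.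
  have : z * (3 * n + s) <= Q * n * (4 * n).
    by apply: ler_pM => //; [exact: ltW|lra|lra].
  have : 4 * (n ^+ 2) * 1 <= 4 * n ^+ 2 * (Q ^+ 2 * rho ^+ 2).
    by rewrite ler_wpM2l// mulr_ge0// sqr_ge0.
  have : 4 * (n ^+ 2) * Q <= 4 * n ^+ 2 * (Q ^+ 2 * rho ^+ 2).
    by rewrite ler_wpM2l// mulr_ge0// sqr_ge0.
  rewrite (_ : (2 * n) ^+ 2 = 4 * n ^+ 2); last by ring.
  rewrite (_ : Q * n * (4 * n) = 4 * n ^+ 2 * Q); last by ring.
  rewrite (_ : 8 * Q ^+ 2 * rho ^+ 2 * n ^+ 2 =
    4 * n ^+ 2 * (Q ^+ 2 * rho ^+ 2) + 4 * n ^+ 2 * (Q ^+ 2 * rho ^+ 2)); last by ring.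
  lra.
have -> : v \in Exc.
  rewrite inE; apply: contraT; rewrite negb_or => /andP[vn vp].
  have vY : v \in Y by move: vn; rewrite !inE in vC *; rewrite vC /= negbK.
  move: vYL vYt vd; rewrite vY /= negbK -ltNge => vL nt.
  by rewrite inE vY vL nt vp.
rewrite cards1 divr1 expr1n mulr1; apply: le_trans UB2 _.
apply: (@le_trans _ _ (8 * expR t * (deg G v)%:R ^+ 2)).
  move: d1 z1; move: (deg G v)%:R (expR t) => d z d1 z1'.
  have : 0 <= (z - 1) * d ^+ 2 by rewrite mulr_ge0 ?sqr_ge0 ?subr_ge0.
  have : 0 <= z * (d * (d - 1)) by rewrite !mulr_ge0 ?subr_ge0//; lra.
  rewrite expr2; lra.
have : (deg G v)%:R ^+ 2 <= (a * rho) ^+ 2 by exact: ler_sqr2.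
move=> dd; apply: (@le_trans _ _ (8 * expR t * (a * rho) ^+ 2)).
  by rewrite ler_pM2l// mulr_gt0 ?expR_gt0.
have -> : 8 * Q ^+ 2 * K * rho ^+ 2 =
    (8 * expR t * (a * rho) ^+ 2) * (8 * Q ^+ 2) by rewrite /K; ring.
rewrite ler_peMr//; first by rewrite mulr_ge0 ?sqr_ge0// mulr_ge0 ?expR_ge0.
by rewrite -[leLHS]mulr1 ler_pM// ?exprn_ege1// ler1n.
Qed.

(** Every vertex may lose [8 * Q ^+ 2]. The larger factor is confined to the irregular vertices and
    the parents chosen for them, at most [2 * #|~: regular|] vertices in all. *)
Lemma overlap_tail_displaced (eps : R) :
  \sum_T \sum_(T' | eps < `|overlap R r T T' - 0|)
     gibbs b G r T * gibbs b G r T'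
  <= expR (- (t * eps * #|C'|%:R) + #|V|%:R * ln (8 * Q ^+ 2) +
       2 * #|~: regular|%:R * ln (8 * expR t * a ^+ 2) +
       2 * ((\sum_v (deg G v)%:R) / a)).
Proof.
pose N : R := #|C'|%:R.
have a0 : 0 < a by apply: lt_le_trans a1.
have Q2 : 1 <= 8 * Q ^+ 2.
  by rewrite -[leLHS]mulr1 ler_pM// ?exprn_ege1// ler1n.
apply: le_trans (@gibbs_chernoff V r G GE R b b0 t (t * (eps * N)) h P _ h0 hP P0 _) _.
  move=> T T' sT sT'; rewrite (overlapE GE R sT sT') subr0 ger0_norm ?divr_ge0//.
  move=> eo; rewrite ler_wpM2l//; have [N0|N0] := eqVneq N 0; first by rewrite N0 mulr0.
  by rewrite -ler_pdivlMr ?lt0r ?N0 ?ler0n// ltW.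
rewrite -!addrA expRD mulrA ler_pM2l ?expR_gt0//.
apply: le_trans (_ : _ <= \prod_(v in C') (8 * Q ^+ 2 *
   (if v \in Exc then K else 1) * expR (2 * ((deg G v)%:R / a)))) _.
  apply: ler_prod => v vC; rewrite ratio_le// andbT.
  by rewrite mulr_ge0 ?sqr_ge0// Uterm_ge0 ?expR_ge0.
rewrite 2!big_split /= -expR_sum addrA expRD.
apply: ler_pM; rewrite ?expR_ge0 ?ler_expR//.
- by rewrite mulr_ge0// prodr_ge0// => v _; [lra|case: ifP => _; have := K1; lra].
- rewrite expRD; apply: ler_pM; rewrite ?prodr_ge0//.
  + by move=> v _; lra.
  + by move=> v _; case: ifP => _; have := K1; lra.
  + rewrite prodr_const expRM_natl lnK ?posrE; last by lra.
    by rewrite ler_weXn2l// max_card.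
  rewrite -big_mkcondr /= prodr_const -natrM expRM_natl lnK ?posrE; last first.
    by have := K1; rewrite /K; lra.
  apply: (ler_weXn2l K1).
  apply: leq_trans (_ : #|Exc| <= _)%N.
    apply: subset_leq_card; apply/subsetP => v.
    by rewrite unfold_in => /andP[].
  rewrite /Exc; apply: leq_trans (leq_card_setU _ _) _.
  have nY : (#|nonY| <= #|~: regular|)%N by apply/subset_leq_card/subsetIr.
  rewrite mul2n -addnn; apply: leq_add => //.
  exact: leq_trans (leq_imset_card _ _) nY.
rewrite -mulr_sumr ler_pM2l// -mulr_suml ler_pM2r ?invr_gt0//.
by rewrite [leRHS](bigID (mem C'))/= lerDl sumr_ge0.
Qed.

Lemma regular_component : regular \subset C'.
Proof. by apply/subsetP => v /YP[]. Qed.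

End displaced_comparison.

(** * Typical graphs *)

Section parent_sums.
Variables (R : realType) (V : finType) (r : V) (G : {set {set V}}) (D : nat).
Local Notation C' := (component G r :\ r).

(** Since [0^-1 = 0], only the vertices of the layer [D.+1] contribute. *)
Definition near_sum : R :=
  \sum_(v in ~: bfs_ball r G D) (nb G (bfs_layer r G D) v)%:R^-1.

(** By [maxn 1], a vertex without neighbours in the layer [D.+1] is charged 1. This includes all
    vertices outside the component, so the same sum controls the size of the component. *)
Definition far_sum : R :=
  \sum_(v in ~: bfs_ball r G D.+1) (maxn 1 (nb G (bfs_layer r G D.+1) v))%:R^-1.

Lemma inv_maxn_ge0 j : 0 <= (maxn 1 j)%:R^-1 :> R.
Proof. by rewrite invr_ge0. Qed.

Lemma inv_maxn_le1 j : (maxn 1 j)%:R^-1 <= 1 :> R.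
Proof. by rewrite invf_le1 ?ler1n ?ltr0n leq_maxl. Qed.

Lemma inv_le1 j : j%:R^-1 <= 1 :> R.
Proof. by case: j => [|j]; rewrite ?invr0 ?ler01// invf_le1 ?ler1n ?ltr0n. Qed.

Lemma far_sum_ge0 : 0 <= far_sum.
Proof. by apply: sumr_ge0 => v _; exact: inv_maxn_ge0. Qed.

Lemma inv_parents_ge : near_sum <= inv_parents R r G.
Proof.
rewrite /near_sum /inv_parents [leLHS]big_mkcond [leRHS]big_mkcond /=.
apply: ler_sum => v _; rewrite inE.
have R0 : 0 <= (if v \in C' then (nd r G v)%:R^-1 else 0) :> R.
  by case: ifP; rewrite ?invr_ge0.
have [vB|vB] := boolP (v \in bfs_ball r G D) => //=.
have [nb0|nb0] := posnP (nb G (bfs_layer r G D) v); first by rewrite nb0 invr0.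
have vL : v \in bfs_layer r G D.+1 by rewrite layerS 2!inE vB nb0.
have vr : v != r.
  by apply: contraNneq vB => ->; rewrite in_ball gdist_refl root_component.
have := vL; rewrite in_layer => /andP[vC _].
by rewrite 2!inE vr vC /= (nd_layer vL).
Qed.

Lemma inv_parents_le_sums :
  inv_parents R r G <= near_sum + #|bfs_ball r G D|%:R + far_sum.
Proof.
rewrite -sum1_card natr_sum /near_sum /far_sum /inv_parents.
rewrite [leLHS]big_mkcond [X in X + _ + _]big_mkcond [X in _ + X + _]big_mkcond.
rewrite [X in _ + _ + X]big_mkcond -!big_split /=; apply: ler_sum => v _.
have F0 := inv_maxn_ge0 (nb G (bfs_layer r G D.+1) v).
have N0 : 0 <= (nb G (bfs_layer r G D) v)%:R^-1 :> R by rewrite invr_ge0.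
case: ifPn => [vC|_]; last first.
  by rewrite !addr_ge0//; case: ifP.
have n1 := inv_le1 (nd r G v).
rewrite !in_setC ballS in_setU; have [vB|vB] /= := boolP (v \in bfs_ball r G D).
  by rewrite add0r addr0.
have [vL|vL] /= := boolP (v \in bfs_layer r G D.+1).
  by rewrite !addr0 (nd_layer vL).
rewrite addr0; apply: ler_wpDl => //.
have [nb0|nb0] := posnP (nb G (bfs_layer r G D.+1) v).
  by rewrite nb0 maxn0 invr1.
have vL2 : v \in bfs_layer r G D.+2.
  by rewrite layerS 2!inE ballS inE negb_or vB vL nb0.
by rewrite (nd_layer vL2) (maxn_idPr nb0).
Qed.

Lemma card_component_ge : #|V|%:R - #|C'|%:R <= 1 + far_sum.
Proof.
have -> : #|V|%:R = #|C'|%:R + #|~: C'|%:R :> R by rewrite -natrD cardsC.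
rewrite addrC addKr -sum1_card natr_sum (bigD1 r) /=; last by rewrite !inE eqxx.
rewrite lerD2l /far_sum [leLHS]big_mkcond [leRHS]big_mkcond /=.
apply: ler_sum => v _; have F0 := inv_maxn_ge0 (nb G (bfs_layer r G D.+1) v).
case: ifPn => [/andP[vC vr]|_]; last by case: ifP.
have vC' : v \notin component G r by move: vC; rewrite !inE vr.
rewrite inE in_ball (negbTE vC') /=.
have [->|/nb_gt0P[u]] := posnP (nb G (bfs_layer r G D.+1) v).
  by rewrite maxn0 invr1.
rewrite in_layer => /andP[uC _] uv; case/negP: vC'.
by apply: (component_adj uC); rewrite adj_sym.
Qed.

End parent_sums.

(** * First-moment estimates around the last layers *)

Section typical_graph.
Variables (R : realType) (V : finType) (r : V) (q : R).
Hypothesis q01 : 0 <= q <= 1.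
Local Notation EG := (Ex (@edge_prob R V q)).
Local Notation PG := (Pr (@edge_prob R V q)).
Local Notation n := (#|V|%:R : R).
Local Notation a := (n * q).
Variables (D : nat) (w : R).
Hypothesis a4 : 4 <= a.
Hypothesis w1 : 1 <= w.
Hypothesis hD : n / w <= a ^+ D.+1.
Local Notation S k G := (#|bfs_layer r G k|%:R : R).
Local Notation BB k G := (#|bfs_ball r G k|%:R : R).
Local Notation e01 := (@edge_prob01 R V q q01).

Let n0 : 0 < n. Proof. by rewrite ltr0n; apply/card_gt0P; exists r. Qed.
Let a0 : 0 < a. Proof. exact: lt_le_trans a4. Qed.
Let q0 : 0 < q. Proof. by rewrite -(pmulr_rgt0 _ n0). Qed.
Let aD0 : 0 < a ^+ D. Proof. by rewrite exprn_gt0. Qed.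
Let w0 : 0 < w. Proof. exact: lt_le_trans w1. Qed.

Definition dev_err : R := 2 / Num.sqrt a + 12 * a ^+ D / n.

Definition layer_err : R :=
  2 * dev_err + 4 * a ^+ D / n + 16 * w / Num.sqrt n.

Lemma Ex_layer_rel : EG (fun G => `|S D G - a ^+ D| / a ^+ D) <= dev_err.
Proof.
rewrite ExZr ler_pdivrMr// [leRHS]mulrC; exact: Ex_layer_dev_le.
Qed.

(** From [(1 - q)^s <= exp(- s q) <= 1 / (1 + s q)]; unlike [bernoulli_lower] it is useful when
    [s * q] is not small. *)
Lemma hit_prob_lower (s : nat) (u : R) : 0 <= u <= s%:R * q ->
  u / (1 + u) <= hit_prob q s.
Proof.
move=> /andP[u0 us]; rewrite /hit_prob.
have q1 : 0 <= 1 - q by rewrite subr_ge0; case/andP: q01.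
have -> : u / (1 + u) = 1 - (1 + u)^-1.
  by field; rewrite gt_eqF// ltr_pwDl.
rewrite lerD2l lerN2; apply: (@le_trans _ _ (expR (- q) ^+ s)).
  by rewrite lerXn2r ?nnegrE ?expR_ge0// expR_ge1Dx.
rewrite -expRM_natl mulrN expRN lef_pV2 ?posrE ?expR_gt0 ?ltr_pwDl//.
by apply: le_trans (expR_ge1Dx _); rewrite lerD2l.
Qed.

(** If the layer [D] has at least half its nominal size and the ball at most [n / 2] vertices, then
    each outer vertex is hit with probability at least [1 / (4 w)]. The next layer then has
    conditional mean at least [n / (8 w)], and failure is a deviation of [n / (16 w)] where the
    standard deviation is at most [sqrt n]. The three terms of [layer_err] are the corresponding
    Markov bounds. *)
Lemma layer_lower : PG (fun G => S D.+1 G < n / (16 * w)) <= layer_err.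
Proof.
pose dv (B L : {set V}) (G : {set {set V}}) : R :=
  `|#|bfs_next G B L|%:R - #|~: B|%:R * hit_prob q #|L| : R|.
have dvE : EG (fun G => dv (bfs_ball r G D) (bfs_layer r G D) G) <= Num.sqrt n.
  rewrite (@bfs_exposure R V q r D dv); last first.
    by move=> B L G G' /next_off_dep; rewrite /dv => ->.
  rewrite -[leRHS](Ex_cst (@edge_prob R V q)).
  apply: (le_Ex e01) => G; apply: le_trans (Ex_normr_sqrt e01 _) _.
  have vn := Var_next q (layer_sub_ball r G D).
  apply: ler_wsqrtr; apply: (le_trans vn).
  rewrite -[leRHS]mulr1; apply: ler_pM; rewrite ?mu_ge0 ?card_le_n//.
  by rewrite /hit_prob gerBl exprn_ge0// subr_ge0; case/andP: q01.
apply: (@le_trans _ _ (EG (fun G => 2 * (`|S D G - a ^+ D| / a ^+ D) +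
    2 / n * BB D G + 16 * w / n * dv (bfs_ball r G D) (bfs_layer r G D) G))).
  apply: (le_Ex e01) => G.
  have d0 : 0 <= `|S D G - a ^+ D| / a ^+ D by rewrite divr_ge0// ltW.
  have b0 : 0 <= 2 / n * BB D G by rewrite mulr_ge0// divr_ge0// ltW.
  have v0 : 0 <= 16 * w / n * dv (bfs_ball r G D) (bfs_layer r G D) G.
    apply: mulr_ge0; last exact: normr_ge0.
    by rewrite divr_ge0 ?mulr_ge0 ?(ltW w0).
  have key (d bb vv : R) : 0 <= d -> 0 <= bb -> 0 <= vv ->
      [|| 2^-1 <= d, 1 <= bb | 1 <= vv] -> 1 <= 2 * d + bb + vv.
    by move=> ? ? ? /or3P[]; lra.
  case: ltP => Sn; last by rewrite !addr_ge0// mulr_ge0.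
  rewrite [leLHS](_ : _ = 1)//; apply: key => //.
  have [d2|d2] //= := leP 2^-1 (`|S D G - a ^+ D| / a ^+ D).
  have [b2|b2] := leP (n / 2) (BB D G).
    apply/orP; left; rewrite [leLHS](_ : 1 = 2 / n * (n / 2)).
      by rewrite ler_pM2l// divr_gt0.
    by field; exact: lt0r_neq0.
  apply/orP; right.
  have SD : a ^+ D / 2 <= S D G.
    move: d2; rewrite ltr_pdivrMr// ltr_norml => /andP[+ _]; lra.
  have hp : (4 * w)^-1 <= hit_prob q #|bfs_layer r G D|.
    apply: le_trans (@hit_prob_lower _ (2 * w)^-1 _); last first.
      rewrite invr_ge0 mulr_ge0 ?(ltW w0)//=.
      apply: (@le_trans _ _ (a ^+ D / 2 * q)); last by rewrite ler_pM2r.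
      rewrite (_ : a ^+ D / 2 * q = a ^+ D.+1 / (2 * n)); last first.
        by rewrite exprS; field; exact: lt0r_neq0.
      rewrite ler_pdivlMr ?mulr_gt0//.
      by rewrite (_ : (2 * w)^-1 * (2 * n) = n / w)//; field; exact: lt0r_neq0.
    have -> : (2 * w)^-1 / (1 + (2 * w)^-1) = (2 * w + 1)^-1.
      field; rewrite !gt_eqF//; by [rewrite ltr_wpDl// mulr_ge0 ?ltW|].
    rewrite lef_pV2 ?posrE ?mulr_gt0//; first by have := w1; lra.
    by rewrite ltr_wpDl// mulr_ge0// ltW.
  have cB : n / 2 <= #|~: bfs_ball r G D|%:R.
    have : n = BB D G + #|~: bfs_ball r G D|%:R by rewrite -natrD cardsC.
    lra.
  have mB : n / (8 * w) <= #|~: bfs_ball r G D|%:R * hit_prob q #|bfs_layer r G D|.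
    rewrite (_ : n / (8 * w) = n / 2 * (4 * w)^-1); last by field; exact: lt0r_neq0.
    by apply: ler_pM; rewrite // ?invr_ge0 ?mulr_ge0 ?invr_ge0// ltW.
  have : n / (16 * w) <= dv (bfs_ball r G D) (bfs_layer r G D) G.
    rewrite /dv -layerS distrC; apply: le_trans (ler_norm _).
    have : n / (8 * w) = n / (16 * w) + n / (16 * w) by field; exact: lt0r_neq0.
    lra.
  move=> dvn; rewrite [leLHS](_ : 1 = 16 * w / n * (n / (16 * w))).
    by rewrite ler_pM2l// divr_gt0// mulr_gt0.
  by field; rewrite !gt_eqF.
rewrite !ExD !ExZ /layer_err; apply: lerD; first apply: lerD.
- by rewrite ler_pM2l// Ex_layer_rel.
- apply: (@le_trans _ _ (2 / n * (2 * a ^+ D))).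
    by rewrite ler_pM2l ?divr_gt0//; exact: Ex_ball_le.
  by rewrite le_eqVlt; apply/orP; left; apply/eqP; field; exact: lt0r_neq0.
apply: (@le_trans _ _ (16 * w / n * Num.sqrt n)).
  by rewrite ler_wpM2l// !mulr_ge0 ?invr_ge0 ?(ltW w0)// ltW.
have s0 : 0 < Num.sqrt n by rewrite sqrtr_gt0.
rewrite -[X in _ / X * _](sqr_sqrtr (ltW n0)) le_eqVlt; apply/orP; left; apply/eqP.
by field; exact: lt0r_neq0.
Qed.

(** Here [96 = 6 * 16]: a layer of size [n / (16 w)] gives an outer vertex [a / (16 w)] neighbours
    on average, to which [binexp_inv_le] applies. *)
Lemma Ex_far_sum : EG (fun G => far_sum R r G D) <=
  n * (96 * w / a + layer_err).
Proof.
rewrite (@bfs_exposure R V q r D.+1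
  (fun B L G => \sum_(v in ~: B) (maxn 1 (nb G L v))%:R^-1)); last first.
  move=> B L G G' GG'; apply: eq_bigr => v; rewrite inE => vB.
  by rewrite (nb_off_dep (A := L) (v := v) _ _ GG')// !inE (negbTE vB) andbF.
apply: (@le_trans _ _ (EG (fun G => n * (96 * w / a +
    (S D.+1 G < n / (16 * w))%R%:R)))); last first.
  by rewrite ExZ ExD Ex_cst ler_pM2l// lerD2l layer_lower.
apply: (le_Ex e01) => G.
rewrite (Ex_sum_nb q (fun j => (maxn 1 j)%:R^-1)); last first.
  by rewrite disjoint_sym disjoints_subset setCK layer_sub_ball.
have b0 : 0 <= binexp q #|bfs_layer r G D.+1| (fun j => (maxn 1 j)%:R^-1).
  by rewrite -[leLHS](binexp_cst q #|bfs_layer r G D.+1|); apply: le_binexp.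
apply: ler_pM; rewrite ?card_le_n//.
case: ltP => Sn.
  apply: ler_wpDl; first by rewrite !mulr_ge0 ?invr_ge0 ?(ltW w0)// ltW.
  rewrite -[leRHS](binexp_cst q #|bfs_layer r G D.+1|); apply: le_binexp => // j.
  exact: inv_maxn_le1.
rewrite addr0.
have S0 : 0 < S D.+1 G by apply: lt_le_trans Sn; rewrite divr_gt0// mulr_gt0.
apply: le_trans (binexp_inv_le q01 _) _; first by rewrite mulr_gt0.
rewrite ler_pdivrMr ?mulr_gt0//.
rewrite [leLHS](_ : 6 = 96 * w / a * (n / (16 * w) * q)); last first.
  by field; rewrite !gt_eqF.
by rewrite ler_pM2l ?ler_pM2r// divr_gt0// mulr_gt0.
Qed.

Let phi (s : nat) : R := binexp q s (fun j => j%:R^-1).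

Let phi01 s : 0 <= phi s <= 1.
Proof.
apply/andP; split.
  by rewrite -[leLHS](binexp_cst q s); apply: le_binexp => // j.
rewrite -[leRHS](binexp_cst q s); apply: le_binexp => // j.
exact: inv_le1.
Qed.

Let near_dep (B L : {set V}) : depends_on (off_edges B L)
  (fun G => \sum_(v in ~: B) (nb G L v)%:R^-1 : R).
Proof.
move=> G G' GG'; apply: eq_bigr => v; rewrite inE => vB.
by rewrite (nb_off_dep (A := L) (v := v) _ _ GG')// !inE (negbTE vB) andbF.
Qed.

Lemma Ex_near_dev : EG (fun G => `|near_sum R r G D -
    n * binexp q #|bfs_layer r G D| (fun j => j%:R^-1)|) <=
  Num.sqrt n + 2 * a ^+ D.
Proof.
pose dv (B L : {set V}) G : R := `|\sum_(v in ~: B) (nb G L v)%:R^-1 - #|~: B|%:R * phi #|L| |.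
apply: (@le_trans _ _ (EG (fun G => dv (bfs_ball r G D) (bfs_layer r G D) G +
   BB D G))).
  apply: (le_Ex e01) => G; rewrite /dv -/(phi _) -/(near_sum R r G D).
  have -> : n = BB D G + #|~: bfs_ball r G D|%:R by rewrite -natrD cardsC.
  have /andP[p0 p1] := phi01 #|bfs_layer r G D|.
  set p := phi _ in p0 p1 *; set x := near_sum _ _ _ _.
  have -> : x - (BB D G + #|~: bfs_ball r G D|%:R) * p =
    (x - #|~: bfs_ball r G D|%:R * p) - BB D G * p by ring.
  apply: le_trans (ler_normB _ _) _; rewrite lerD2l ger0_norm ?mulr_ge0//.
  by rewrite ler_piMr.
rewrite ExD; apply: lerD; last exact: Ex_ball_le.
rewrite (@bfs_exposure R V q r D dv); last first.
  by move=> B L G G' /near_dep; rewrite /dv => ->.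
rewrite -[leRHS](Ex_cst (@edge_prob R V q)).
apply: (le_Ex e01) => G; apply: le_trans (Ex_normr_sqrt e01 _) _.
have dis : [disjoint ~: bfs_ball r G D & bfs_layer r G D].
  by rewrite disjoint_sym disjoints_subset setCK layer_sub_ball.
apply: ler_wsqrtr; apply: le_trans (Var_sum_nb q (fun j => j%:R^-1) dis) _.
rewrite -[leRHS]mulr1; apply: ler_pM; rewrite ?card_le_n//.
  by rewrite -[leLHS](binexp_cst q #|bfs_layer r G D|); apply: le_binexp => // j;
    exact: sqr_ge0.
rewrite -[leRHS](binexp_cst q #|bfs_layer r G D|); apply: le_binexp => // j.
by rewrite exprn_ile1 ?invr_ge0 ?inv_le1.
Qed.

(** Replaces the random size of the layer [D] by a deterministic [m], as needed for the Poisson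
    limit. *)
Lemma Ex_near_lipschitz (m : nat) :
  EG (fun G => `|binexp q #|bfs_layer r G D| (fun j => j%:R^-1) -
                 binexp q m (fun j => j%:R^-1)|) <=
  q * (a ^+ D * dev_err + `|a ^+ D - m%:R|).
Proof.
have g1 j : `|j.+1%:R^-1 - j%:R^-1| <= 1 :> R.
  have := inv_le1 R j; have := inv_le1 R j.+1.
  have : 0 <= j%:R^-1 :> R by rewrite invr_ge0.
  have : 0 <= j.+1%:R^-1 :> R by rewrite invr_ge0.
  move: (j.+1%:R^-1) (j%:R^-1) => x y x0 y0 x1 y1.
  by rewrite ler_norml; apply/andP; split; lra.
have lip s s' : `|phi s - phi s'| <= q * `|s%:R - s'%:R|.
  wlog ss' : s s' / (s' <= s)%N => [H|].
    case: (leqP s' s) => [|/ltnW] /H//.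
    by rewrite distrC [X in _ <= _ * X]distrC.
  have := binexp_lipschitz s' (s - s') q01 g1; rewrite subnKC// -/(phi s) -/(phi s').
  have -> : `|s%:R - s'%:R| = s%:R - s'%:R :> R.
    by rewrite ger0_norm// subr_ge0 ler_nat.
  by rewrite natrB// [q * _]mulrC.
apply: (@le_trans _ _ (EG (fun G => q * (`|S D G - a ^+ D| + `|a ^+ D - m%:R|)))).
  apply: (le_Ex e01) => G; apply: le_trans (lip _ _) _.
  rewrite ler_pM2l// -[X in `|X|](subrKA (a ^+ D)); exact: ler_normD.
rewrite ExZ ExD Ex_cst ler_pM2l// lerD2r.
exact: Ex_layer_dev_le.
Qed.

(** Meant for [a ^+ D.+1 / n] tending to infinity, when an outer vertex has many neighbours already
    in the layer [D]. A layer below half its nominal size is paid for by [2 * dev_err]. *)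
Lemma Ex_near_small : EG (fun G => near_sum R r G D) <=
  n * (12 * n / a ^+ D.+1 + 2 * dev_err).
Proof.
rewrite (@bfs_exposure R V q r D
  (fun B L G => \sum_(v in ~: B) (nb G L v)%:R^-1)); last exact: near_dep.
apply: (@le_trans _ _ (EG (fun G => n * (12 * n / a ^+ D.+1 +
    2 * (`|S D G - a ^+ D| / a ^+ D))))); last first.
  by rewrite ExZ ExD Ex_cst ExZ ler_pM2l// lerD2l ler_pM2l// Ex_layer_rel.
apply: (le_Ex e01) => G.
have dis : [disjoint ~: bfs_ball r G D & bfs_layer r G D].
  by rewrite disjoint_sym disjoints_subset setCK layer_sub_ball.
rewrite (Ex_sum_nb q (fun j => j%:R^-1) dis) -/(phi _).
have /andP[p0 p1] := phi01 #|bfs_layer r G D|.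
have aD1 : 0 < a ^+ D.+1 by rewrite exprn_gt0.
apply: ler_pM; rewrite ?card_le_n//.
have d0 : 0 <= `|S D G - a ^+ D| / a ^+ D by rewrite divr_ge0// ltW.
have t0 : 0 <= 12 * n / a ^+ D.+1 by rewrite !mulr_ge0 ?invr_ge0 ?(ltW aD1)// ltW.
have [d2|d2] := leP 2^-1 (`|S D G - a ^+ D| / a ^+ D); first by lra.
have SD : a ^+ D / 2 <= S D G.
  move: d2; rewrite ltr_pdivrMr// ltr_norml => /andP[+ _]; lra.
have S0 : 0 < S D G by apply: lt_le_trans SD; rewrite divr_gt0.
apply: ler_wpDr; first by rewrite mulr_ge0.
apply: (@le_trans _ _ (6 / (S D G * q))).
  apply: le_trans (binexp_inv_le q01 _); last by rewrite mulr_gt0.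
  apply: le_binexp => // j; case: j => [|j]; first by rewrite invr0.
  by rewrite (maxn_idPr _).
rewrite ler_pdivrMr ?mulr_gt0//.
rewrite [leLHS](_ : 6 = 12 * n / a ^+ D.+1 * (a ^+ D / 2 * q)); last first.
  by rewrite exprS; field; rewrite !gt_eqF// exprn_gt0.
by rewrite ler_pM2l ?ler_pM2r// !mulr_gt0 ?invr_gt0.
Qed.

Lemma Ex_sum_deg : EG (fun G => \sum_v (deg G v)%:R) <= n * a.
Proof.
rewrite Ex_sum; apply: (@le_trans _ _ (\sum_(v : V) a)); last first.
  by rewrite sumr_const -[leLHS]mulr_natl.
apply: ler_sum => v _.
rewrite (eq_Ex _ (g := fun G => \sum_(u : V) ([set u; v] \in G)%:R)); last first.
  move=> G; rewrite /deg -sum1_card natr_sum big_mkcond /=; apply: eq_bigr => u _.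
  by rewrite inE /adj; case: (_ \in G).
rewrite Ex_sum (_ : a = \sum_(u : V) q); last by rewrite sumr_const -[RHS]mulr_natl.
apply: ler_sum => u _.
by rewrite Ex_mem /edge_prob; case: ifP => // _; exact: ltW.
Qed.

(** A function of the layer alone, so that selecting reveals no further edge. *)
Definition selection (x0 : nat) (L : {set V}) : {set V} := [set v in take x0 (enum L)].

Lemma selection_sub x0 L : selection x0 L \subset L.
Proof. by apply/subsetP => v; rewrite inE => /mem_take; rewrite mem_enum. Qed.

Lemma card_selection x0 L : #|selection x0 L| = minn x0 #|L|.
Proof.
rewrite /selection cardsE (card_uniqP _) ?take_uniq ?enum_uniq//.
by rewrite size_take_min -cardE.
Qed.

Definition poorly_attached G (X : {set V}) : nat :=
  #|[set v in ~: (bfs_ball r G D :|: X) | (nb G X v)%:R < #|X|%:R * q / 2]|.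

Lemma Ex_poorly_attached (x0 : nat) (xi : R) : 0 < xi ->
  xi <= x0%:R -> xi <= n / (16 * w) ->
  EG (fun G => (poorly_attached G (selection x0 (bfs_layer r G D.+1)))%:R) <=
  n * (4 / (xi * q) + layer_err).
Proof.
move=> xi0 xix xin.
(* Unselected vertices of the last layer are included: the edges inside that layer are still
   unrevealed. *)
pose W (B L : {set V}) : {set V} := ~: (B :\: L) :\: selection x0 L.
pose f (L : {set V}) (j : nat) : R := (j%:R < #|selection x0 L|%:R * q / 2)%R%:R.
pose Psi (B L : {set V}) G : R := \sum_(v in W B L) f L (nb G (selection x0 L) v).
rewrite (eq_Ex _ (g := fun G => Psi (bfs_ball r G D.+1) (bfs_layer r G D.+1) G));
  last first.
  move=> G; rewrite /poorly_attached /Psi -sum1_card natr_sum.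
  rewrite big_mkcond [RHS]big_mkcond /=; apply: eq_bigr => v _.
  rewrite /W ballD_layer !inE negb_or andbC; case: (_ \in bfs_ball _ _ _) => //=.
    by rewrite !andbF.
  by rewrite !andbT /f andbC; case: (v \in take _ _) => //=; case: (_ < _).
rewrite (@bfs_exposure R V q r D.+1 Psi); last first.
  move=> B L G G' GG'; apply: eq_bigr => v; rewrite !inE => /andP[_ vB].
  rewrite (nb_off_dep (A := selection x0 L) (v := v) _ _ GG')//.
    exact: selection_sub.
  by rewrite !inE.
apply: (@le_trans _ _ (EG (fun G => n * (4 / (xi * q) +
    (S D.+1 G < n / (16 * w))%R%:R)))); last first.
  by rewrite ExZ ExD Ex_cst ler_pM2l// lerD2l layer_lower.
apply: (le_Ex e01) => G; rewrite /Psi; set X := selection _ _.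
rewrite (Ex_sum_nb q (f (bfs_layer r G D.+1)) (A := X)); last first.
  rewrite disjoints_subset; apply/subsetP => v.
  by rewrite /W => /setDP[_]; rewrite in_setC.
have f0 j : 0 <= f (bfs_layer r G D.+1) j by rewrite /f; case: (_ < _).
have f1 j : f (bfs_layer r G D.+1) j <= 1 by rewrite /f; case: (_ < _).
apply: ler_pM; rewrite ?card_le_n//.
  by rewrite -[leLHS](binexp_cst q #|X|); apply: le_binexp.
case: ltP => Sn.
  apply: ler_wpDl; first by rewrite !mulr_ge0 ?invr_ge0 ?mulr_ge0// ltW.
  by rewrite -[leRHS](binexp_cst q #|X|); apply: le_binexp.
rewrite addr0.
have X0 : xi <= #|X|%:R.
  by rewrite card_selection /minn; case: ifP => // _; exact: le_trans Sn.
have Xp : 0 < #|X|%:R :> R by apply: lt_le_trans X0.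
apply: le_trans (binexp_lower_tail q01 _) _; first by rewrite mulr_gt0.
rewrite ler_pM2l// lef_pV2 ?posrE ?mulr_gt0//.
by rewrite ler_pM2r.
Qed.

End typical_graph.

(** * Tail bounds for the overlap on a random graph *)

(* [1 + 9 x y <= (1 + 3 (x + y) / 2) ^ 2]. *)
Lemma ln1D_amgm (R : realType) (x y : R) : 0 <= x -> 0 <= y ->
  ln (1 + 9 * (x * y)) <= 3 * (x + y).
Proof.
move=> x0 y0; have xy0 : 0 <= x * y by rewrite mulr_ge0.
rewrite -ler_expR lnK ?posrE ?ltr_pwDl ?mulr_ge0//.
have -> : 3 * (x + y) = 2 * (3 / 2 * (x + y)) by field.
rewrite expRM_natl; apply: (@le_trans _ _ ((1 + 3 / 2 * (x + y)) ^+ 2)).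
  have := sqr_ge0 (x - y).
  rewrite (_ : (1 + 3 / 2 * (x + y)) ^+ 2 = 1 + 3 * (x + y) + 9 * (x * y) +
    9 / 4 * (x - y) ^+ 2); last by field.
  lra.
apply: ler_sqr2; last exact: expR_ge1Dx.
by rewrite addr_ge0// mulr_ge0 ?addr_ge0// divr_ge0.
Qed.

Section excess_bounds.
Variables (R : realType) (V : finType) (r : V) (G : {set {set V}}) (b : R).
Local Notation C' := (component G r :\ r).
Local Notation eb := (expR (- b)).

Let excess_ge0 v : 0 <= excess r G b v.
Proof. by rewrite !mulr_ge0 ?invr_ge0 ?expR_ge0. Qed.

Lemma sum_ln_excess_le : 2 * \sum_(v in C') ln (1 + 9 * excess r G b v) <=
  18 * eb * \sum_v (deg G v)%:R.
Proof.
rewrite (_ : 18 * eb * _ = 2 * \sum_v (9 * eb * (deg G v)%:R)); last first.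
  by rewrite -mulr_sumr; ring.
rewrite ler_pM2l// [leRHS](bigID (mem C'))/= -[leLHS]addr0; apply: lerD.
  apply: ler_sum => v vC; apply: (@le_trans _ _ (9 * excess r G b v)).
    by apply: le_ln1Dx; apply: (@lt_le_trans _ _ 0) => //; rewrite mulr_ge0.
  rewrite -mulrA ler_pM2l// mulrC /excess ler_pdivrMr ?ltr0n ?nd_gt0//.
  by rewrite ler_peMr ?mulr_ge0 ?expR_ge0// ler1n nd_gt0.
by apply: sumr_ge0 => v _; rewrite !mulr_ge0 ?expR_ge0.
Qed.

(** For [beta = 1] the mean of [eb * deg] is bounded but need not tend to 0. Splitting the logarithm
    leaves a degree term that is small for large [K], and a multiple of [inv_parents], which is
    small when most vertices have many parents. *)
Lemma sum_ln_excess_amgm (K : R) : 0 < K ->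
  2 * \sum_(v in C') ln (1 + 9 * excess r G b v) <=
  6 * (eb / K * \sum_v (deg G v)%:R + K * inv_parents R r G).
Proof.
move=> K0.
rewrite (_ : 6 * _ = 2 * (\sum_v (3 * (eb / K) * (deg G v)%:R) +
    \sum_(v in C') 3 * (K * (nd r G v)%:R^-1))); last first.
  by rewrite -!mulr_sumr -/(inv_parents R r G); ring.
rewrite ler_pM2l//.
apply: (@le_trans _ _ (\sum_(v in C') (3 * (eb / K) * (deg G v)%:R) +
    \sum_(v in C') 3 * (K * (nd r G v)%:R^-1))).
  rewrite -big_split /=; apply: ler_sum => v vC.
  have n0 : 0 < (nd r G v)%:R :> R by rewrite ltr0n nd_gt0.
  have := @ln1D_amgm R (eb / K * (deg G v)%:R) (K * (nd r G v)%:R^-1).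
  rewrite (_ : eb / K * (deg G v)%:R * (K * (nd r G v)%:R^-1) = excess r G b v).
    move=> /(_ _ _)/le_trans; apply.
    - by rewrite mulr_ge0// divr_ge0 ?expR_ge0// ltW.
    - by rewrite mulr_ge0 ?invr_ge0// ltW.
    by rewrite mulrDr !mulrA.
  by rewrite /excess; field; rewrite !gt_eqF.
rewrite lerD2r [leRHS](bigID (mem C'))/= lerDl; apply: sumr_ge0 => v _.
by rewrite !mulr_ge0 ?invr_ge0 ?expR_ge0// ltW.
Qed.

End excess_bounds.

Section random_graph.
Variables (R : realType) (V : finType) (r : V) (q b : R).
Hypothesis q01 : 0 <= q <= 1.
Hypothesis b0 : 0 <= b.
Local Notation EG := (Ex (@edge_prob R V q)).
Local Notation PG := (Pr (@edge_prob R V q)).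
Local Notation n := (#|V|%:R : R).
Local Notation a := (n * q).
Local Notation e01 := (@edge_prob01 R V q q01).
Local Notation sdeg G := (\sum_(v : V) (deg G v)%:R : R).

Let n0 : 0 < n. Proof. by rewrite ltr0n; apply/card_gt0P; exists r. Qed.

Lemma replica_prob_le
    (E : {set {set V}} -> {set {set V}} -> {set {set V}} -> bool)
    (good : {set {set V}} -> bool) (kap : R) : 0 <= kap ->
  (forall G : {set {set V}}, G \subset all_edges V -> good G ->
    \sum_T \sum_(T' | E G T T') gibbs b G r T * gibbs b G r T' <= kap) ->
  replica_prob q b r E <= PG (fun G => ~~ good G) + kap.
Proof.
move=> k0 H; rewrite -[X in _ <= _ + X](Ex_cst (@edge_prob R V q)) -ExD.
apply: ler_sum => G _; rewrite erdos_renyiE.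
have [GE|GE] := boolP (G \subset all_edges V); last first.
  by rewrite -erdos_renyiE /erdos_renyi (negbTE GE) !mul0r.
apply: ler_wpM2l; first exact: (bweight_ge0 e01).
have [gG|gG] /= := boolP (good G); first by rewrite add0r H.
by apply: le_trans (gibbs_pair_le1 r G b _) _; rewrite lerDl.
Qed.

Lemma le_replica_prob
    (E E' : {set {set V}} -> {set {set V}} -> {set {set V}} -> bool) :
  (forall G T T', E G T T' -> E' G T T') ->
  replica_prob q b r E <= replica_prob q b r E'.
Proof.
move=> EE'; apply: ler_sum => G _; rewrite erdos_renyiE.
apply: ler_wpM2l; first exact: (bweight_ge0 e01).
apply: ler_sum => T _; rewrite big_mkcond [leRHS]big_mkcond.
apply: ler_sum => T' _ /=.
have g0 : 0 <= gibbs b G r T * gibbs b G r T' by rewrite mulr_ge0 ?gibbs_ge0.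
case: ifP => [/EE' -> //|_]; by case: ifP.
Qed.

Section bfs_regime.
Variables (D : nat) (c eps : R) (H : {set {set V}} -> R).
Hypothesis c01 : 0 <= c <= 1.
Hypothesis eps01 : 0 < eps <= 1.
Hypothesis H_ge : forall G : {set {set V}}, G \subset all_edges V ->
  2 * \sum_(v in component G r :\ r) ln (1 + 9 * excess r G b v) <= H G.
Hypothesis H_ge0 : forall G, 0 <= H G.

Lemma replica_bfs :
  replica_prob q b r (fun _ T T' => eps < `|overlap R r T T' - c|) <=
  (EG (fun G => `|inv_parents R r G - c * n|) + 1 +
   EG (fun G => far_sum R r G D) + EG H) / (eps ^+ 2 / 64 * n) +
  2 * expR (- (eps ^+ 2 / 32 * n)).
Proof.
move: eps01 c01 => /andP[e0 e1] /andP[c0 c1].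
pose Z G := `|inv_parents R r G - c * n| + (1 + far_sum R r G D) + H G.
have Z0 G : 0 <= Z G.
  by rewrite !addr_ge0// far_sum_ge0.
have k0 : 0 < eps ^+ 2 / 64 by rewrite divr_gt0// exprn_gt0.
have kn0 : 0 < eps ^+ 2 / 64 * n by rewrite mulr_gt0.
apply: le_trans (@replica_prob_le _ (fun G => Z G < eps ^+ 2 / 64 * n)
   (2 * expR (- (eps ^+ 2 / 32 * n))) _ _) _.
- by rewrite mulr_ge0 ?expR_ge0.
- move=> G GE Zn.
  set N : R := #|component G r :\ r|%:R.
  have NB : n - N <= 1 + far_sum R r G D by exact: card_component_ge.
  have F0 : 0 <= 1 + far_sum R r G D by rewrite addr_ge0// far_sum_ge0.
  have H0 := H_ge0 G; have HG := H_ge GE.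
  have Nn : N <= n by rewrite ler_nat max_card.
  have M0 := normr_ge0 (inv_parents R r G - c * n).
  have ee : eps ^+ 2 <= eps by rewrite expr2 ler_piMr// ltW.
  have kn2 : eps ^+ 2 / 64 * n <= n / 2.
    rewrite [leRHS]mulrC ler_pM2r//; lra.
  have N2 : n / 2 <= N by rewrite /Z in Zn; lra.
  have Z2N : Z G <= eps ^+ 2 / 32 * N.
    apply: (@le_trans _ _ (eps ^+ 2 / 64 * n)); first exact: ltW.
    rewrite (_ : eps ^+ 2 / 32 * N = eps ^+ 2 / 64 * (2 * N)); last by field.
    by rewrite ler_pM2l//; lra.
  (* The choice [tau = eps / 4] minimizes [2 * tau ^+ 2 - tau * eps], with value [- eps ^+ 2 / 8].
     The errors collected in [Z] use up less than half of this gain. *)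
  apply: le_trans (@overlap_tail_bfs R V r G b GE b0 c eps (eps / 4) _) _.
    by apply/andP; split; lra.
  rewrite ler_pM2l// ler_expR -/N.
  have MN : `|inv_parents R r G - c * N| <=
      `|inv_parents R r G - c * n| + (1 + far_sum R r G D).
    rewrite -[X in `|X|](subrKA (c * n)); apply: le_trans (ler_normD _ _) _.
    rewrite lerD2l -mulrBr ger0_norm; last by rewrite mulr_ge0// subr_ge0.
    by apply: le_trans NB; rewrite ler_piMl// subr_ge0.
  have MN' : eps / 4 * `|inv_parents R r G - c * N| <= eps / 4 * (eps / 32 * N).
    rewrite ler_pM2l ?divr_gt0//; apply: le_trans MN _.
    apply: (@le_trans _ _ (eps ^+ 2 / 32 * N)); first by rewrite /Z in Z2N; lra.
    by rewrite !ler_wpM2r// ler0n.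
  have HN : 2 * \sum_(v in component G r :\ r) ln (1 + 9 * excess r G b v) <=
      eps ^+ 2 / 32 * N by rewrite /Z in Z2N; lra.
  have eN : eps ^+ 2 / 32 * n <= eps ^+ 2 / 16 * N.
    rewrite (_ : eps ^+ 2 / 16 * N = eps ^+ 2 / 32 * (2 * N)); last by field.
    by rewrite ler_pM2l ?divr_gt0 ?exprn_gt0//; lra.
  apply: (@le_trans _ _ (- (eps ^+ 2 / 16 * N))); last by rewrite lerN2.
  rewrite (_ : eps / 4 * (eps / 32 * N) = eps ^+ 2 / 128 * N) in MN'; last by field.
  have e1' : eps / 4 * eps * N = 16 * (eps ^+ 2 / 64 * N) by field.
  have e2' : 2 * (eps / 4) ^+ 2 * N = 8 * (eps ^+ 2 / 64 * N) by field.
  have e3' : eps ^+ 2 / 128 * N = 2^-1 * (eps ^+ 2 / 64 * N) by field.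
  have e4' : eps ^+ 2 / 32 * N = 2 * (eps ^+ 2 / 64 * N) by field.
  have e5' : eps ^+ 2 / 16 * N = 4 * (eps ^+ 2 / 64 * N) by field.
  rewrite e1' e2' e5'; rewrite e3' in MN'; rewrite e4' in HN.
  have x0 : 0 <= eps ^+ 2 / 64 * N by rewrite mulr_ge0 ?ler0n// ltW.
  by move: (_ / 64 * N) x0 MN' HN; move=> x *; lra.
rewrite lerD2r; apply: le_trans (_ : _ <= PG (fun G => eps ^+ 2 / 64 * n <= Z G)) _.
  by apply: (le_Pr e01) => G; rewrite -leNgt.
apply: le_trans (markov_Ex e01 kn0 Z0) _.
by rewrite ler_pM2r ?invr_gt0// /Z !ExD Ex_cst !addrA.
Qed.

End bfs_regime.

Section parent_expectation.
Variables (D : nat) (w : R).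
Hypothesis a4 : 4 <= a.
Hypothesis w1 : 1 <= w.
Hypothesis hD : n / w <= a ^+ D.+1.

(** A chain of replacements: [inv_parents] by [near_sum], that by its conditional mean, the layer
    size by [m], and the binomial value by [c]. The ball and [far_sum] bound the first error. *)
Lemma Ex_inv_parents_dev (c : R) (m : nat) :
  EG (fun G => `|inv_parents R r G - c * n|) <=
  n * ((Num.sqrt n)^-1 + 4 * a ^+ D / n +
    q * (a ^+ D * dev_err V q D + `|a ^+ D - m%:R|) +
    `|binexp q m (fun j => j%:R^-1) - c| + (96 * w / a + layer_err V q D w)).
Proof.
pose phi G : R := binexp q #|bfs_layer r G D| (fun j => j%:R^-1).
apply: (@le_trans _ _ (EG (fun G => `|near_sum R r G D - n * phi G| +
    (n * `|phi G - binexp q m (fun j => j%:R^-1)| +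
     (n * `|binexp q m (fun j => j%:R^-1) - c| +
      (#|bfs_ball r G D|%:R + far_sum R r G D)))))).
  apply: (le_Ex e01) => G.
  have h1 := inv_parents_ge R r G D; have h2 := inv_parents_le_sums R r G D.
  set M := inv_parents R r G in h1 h2 *; set A := near_sum R r G D in h1 h2 *.
  set p := phi G; set p' := binexp q m _; set F := _ + far_sum R r G D.
  have -> : M - c * n = (A - n * p) + (n * (p - p') + (n * (p' - c) + (M - A))).
    by ring.
  apply: le_trans (ler_normD _ _) _; rewrite lerD2l.
  apply: le_trans (ler_normD _ _) _.
  rewrite normrM (ger0_norm (ltW n0)) lerD2l.
  apply: le_trans (ler_normD _ _) _.
  rewrite normrM (ger0_norm (ltW n0)) lerD2l.
  by rewrite ger0_norm ?subr_ge0// lerBlDl addrA.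
rewrite !ExD !ExZ Ex_cst.
have := Ex_near_dev r q01 D a4.
have : n * EG (fun G => `|phi G - binexp q m (fun j => j%:R^-1)|) <=
    n * (q * (a ^+ D * dev_err V q D + `|a ^+ D - m%:R|)).
  by rewrite ler_pM2l//; exact: Ex_near_lipschitz.
have := Ex_ball_le q01 r a4 D; have := Ex_far_sum r q01 a4 w1 hD.
rewrite -/(phi _).
have -> : n * ((Num.sqrt n)^-1 + 4 * a ^+ D / n +
    q * (a ^+ D * dev_err V q D + `|a ^+ D - m%:R|) +
    `|binexp q m (fun j => j%:R^-1) - c| + (96 * w / a + layer_err V q D w)) =
  Num.sqrt n + 4 * a ^+ D +
    n * (q * (a ^+ D * dev_err V q D + `|a ^+ D - m%:R|)) +
    n * `|binexp q m (fun j => j%:R^-1) - c| +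
    n * (96 * w / a + layer_err V q D w).
  have sn : n * (Num.sqrt n)^-1 = Num.sqrt n.
    rewrite -{1}(sqr_sqrtr (ltW n0)) expr2 mulfK//.
    by apply: lt0r_neq0; rewrite sqrtr_gt0.
  have an : n * (4 * a ^+ D / n) = 4 * a ^+ D by field; exact: lt0r_neq0.
  set X1 := q * _; set X3 := 96 * w / a + _.
  by rewrite !mulrDr sn an.
move: (EG _) (EG _) (EG _) (EG _) => x1 x2 x3 x4; lra.
Qed.

Lemma Ex_inv_parents_small :
  EG (fun G => inv_parents R r G) <=
  n * (12 * n / a ^+ D.+1 + 2 * dev_err V q D + 2 * a ^+ D / n +
    (96 * w / a + layer_err V q D w)).
Proof.
apply: (@le_trans _ _ (EG (fun G =>
    near_sum R r G D + #|bfs_ball r G D|%:R + far_sum R r G D))).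
  by apply: (le_Ex e01) => G; exact: inv_parents_le_sums.
rewrite !ExD.
have := Ex_near_small r q01 D a4; have := Ex_ball_le q01 r a4 D.
have := Ex_far_sum r q01 a4 w1 hD.
have -> : n * (12 * n / a ^+ D.+1 + 2 * dev_err V q D + 2 * a ^+ D / n +
    (96 * w / a + layer_err V q D w)) =
  n * (12 * n / a ^+ D.+1 + 2 * dev_err V q D) + 2 * a ^+ D +
  n * (96 * w / a + layer_err V q D w).
  rewrite [in RHS](_ : 2 * a ^+ D = n * (2 * a ^+ D / n)); last first.
    by field; exact: lt0r_neq0.
  by rewrite -!mulrDr.
move: (EG _) (EG _) (EG _) => x1 x2 x3; lra.
Qed.

End parent_expectation.

Section displaced_regime.
Variables (D x0 : nat) (w eps t xi eta K : R).
Hypothesis a4 : 4 <= a.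
Hypothesis w1 : 1 <= w.
Hypothesis hD : n / w <= a ^+ D.+1.
Hypothesis eps0 : 0 < eps.
Hypothesis t0 : 0 <= t.
Hypothesis za : expR t <= a.
Hypothesis xi0 : 0 < xi.
Hypothesis xix : xi <= x0%:R.
Hypothesis xin : xi <= n / (16 * w).
Hypothesis eta0 : 0 < eta.
Hypothesis eta4 : eta <= 4^-1.
Hypothesis x0eta : x0%:R <= eta * n.
Hypothesis K0 : 0 < K.

(* The probability that the layer at distance D.+1 is too large to be contained
   in the selected set, unless displacing a vertex is cheap. *)
Definition overflow : R :=
  if expR t * expR b <= a then 0
  else PG (fun G => x0 < #|bfs_layer r G D.+1|)%N.

Lemma replica_displaced :
  replica_prob q b r (fun _ T T' => eps < `|overlap R r T T' - 0|) <=
  (2 * a ^+ D / n + 4 / (xi * q) + layer_err V q D w) / eta +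
  layer_err V q D w + overflow + K^-1 +
  expR (n * (- (t * eps / 2) + ln (8 * (2 * n / xi) ^+ 2) +
    4 * eta * ln (8 * expR t * a ^+ 2) + 2 * K)).
Proof.
have a0 : 0 < a by exact: lt_le_trans a4.
have q0 : 0 < q by rewrite -(pmulr_rgt0 _ n0).
have w0 : 0 < w by exact: lt_le_trans w1.
pose X G := selection x0 (bfs_layer r G D.+1).
pose B1 G : R := #|bfs_ball r G D|%:R + (poorly_attached r q D G (X G))%:R.
pose g1 G := B1 G < eta * n.
pose g2 G := n / (16 * w) <= #|bfs_layer r G D.+1|%:R :> R.
pose g3 G := (expR t * expR b <= a) || (#|bfs_layer r G D.+1| <= x0)%N.
pose g4 G := sdeg G < K * (n * a).
apply: le_trans (@replica_prob_le _ (fun G => [&& g1 G, g2 G, g3 G & g4 G])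
  (expR (n * (- (t * eps / 2) + ln (8 * (2 * n / xi) ^+ 2) +
    4 * eta * ln (8 * expR t * a ^+ 2) + 2 * K))) _ _) _.
- exact: expR_ge0.
- move=> G GE /and4P[gg1 gg2 gg3 gg4].
  have XL : X G \subset bfs_layer r G D.+1 by exact: selection_sub.
  have Xxi : xi <= #|X G|%:R.
    by rewrite card_selection /minn; case: ifP => // _; exact: le_trans gg2.
  have X0 : 0 < #|X G|%:R :> R by exact: lt_le_trans Xxi.
  (* Half the mean number of neighbours in [X]. As [#|X| >= xi], the constant [Q] below ensures
     [a <= Q * y]. *)
  pose y : R := #|X G|%:R * q / 2.
  have y0 : 0 < y by rewrite !mulr_gt0 ?invr_gt0.
  pose Q := 2 * n / xi.
  have aQ : a <= Q * y.
    rewrite (_ : Q * y = a * (#|X G|%:R / xi)); last first.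
      by rewrite /Q /y; field; rewrite gt_eqF.
    by rewrite ler_peMr ?(ltW a0)// ler_pdivlMr// mul1r.
  have Q1 : 1 <= Q.
    rewrite ler_pdivlMr// mul1r; apply: le_trans xin _.
    rewrite ler_pdivrMr ?mulr_gt0// -mulrA -[leLHS]mul1r.
    have : 0 <= n * (w - 1) by rewrite mulr_ge0 ?subr_ge0// ltW.
    have := n0; nra.
  have a1 : 1 <= a by apply: le_trans a4; rewrite ler1n.
  have zbX : expR t * expR b <= a \/ X G = bfs_layer r G D.+1.
    case/orP: gg3 => [?|Lx]; [by left|right; apply/eqP].
    by rewrite eqEcard selection_sub card_selection leq_min leqnn andbT.
  have HT := @overlap_tail_displaced R V r G b GE b0 D (X G) y a Q t XL y0 a1 aQ Q1
    t0 za zbX eps.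
  apply: le_trans HT _; rewrite ler_expR.
  set N : R := #|component G r :\ r|%:R.
  set Y := regular r G D (X G) y.
  (* An irregular vertex is in the ball, in [X] or poorly attached. The event [g1] bounds the first
     and third kinds together by [eta * n], and [x0] bounds the second. *)
  have nonY : #|~: Y|%:R <= 2 * eta * n.
    have : (#|~: Y| <= #|bfs_ball r G D| + #|X G| +
        poorly_attached r q D G (X G))%N.
      pose Z := [set v in ~: (bfs_ball r G D :|: X G) | (nb G (X G) v)%:R < y].
      apply: leq_trans (_ : #|bfs_ball r G D :|: X G :|: Z| <= _)%N.
        apply: subset_leq_card; apply/subsetP => v; rewrite !in_setU !inE.
        case: (v \in bfs_ball r G D) => //=; case: (v \in take _ _) => //=.
        by rewrite -ltNge.
      apply: leq_trans (leq_card_setU _ _) _; apply: leq_add => //.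
      exact: leq_card_setU.
    rewrite -(ler_nat R) !natrD.
    have : #|X G|%:R <= eta * n.
      by apply: le_trans x0eta; rewrite ler_nat card_selection geq_minl.
    by move: gg1; rewrite /g1 /B1; lra.
  have YN : #|Y|%:R <= N.
    rewrite ler_nat; apply: subset_leq_card.
    exact: regular_component XL y0.
  have nY : n = #|Y|%:R + #|~: Y|%:R by rewrite -natrD cardsC.
  have N2 : n / 2 <= N.
    have : 2 * eta * n <= n / 2.
      rewrite (_ : n / 2 = 2 * 4^-1 * n); last by field.
      by rewrite ler_pM2r// ler_pM2l.
    lra.
  have L0 : 0 <= ln (8 * expR t * a ^+ 2).
    apply: ln_ge0; have : 1 <= expR t by rewrite -expR0 ler_expR.
    have : 1 <= a ^+ 2 by rewrite exprn_ege1.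
    move: (expR t) (a ^+ 2) => u v u1 v1; nra.
  have t1 : - (t * eps * N) <= - (t * eps / 2) * n.
    rewrite mulNr lerN2.
    have -> : t * eps / 2 * n = t * eps * (n / 2) by field.
    by rewrite ler_wpM2l// mulr_ge0// ltW.
  have t2 : 2 * #|~: Y|%:R * ln (8 * expR t * a ^+ 2) <=
      4 * eta * ln (8 * expR t * a ^+ 2) * n.
    have -> : 4 * eta * ln (8 * expR t * a ^+ 2) * n =
      2 * (2 * eta * n) * ln (8 * expR t * a ^+ 2) by ring.
    by rewrite ler_wpM2r// ler_pM2l.
  have t3 : 2 * (sdeg G / a) <= 2 * K * n.
    rewrite -mulrA ler_pM2l// ler_pdivrMr// -mulrA ltW//.
  rewrite -/Q.
  have -> : n * (- (t * eps / 2) + ln (8 * Q ^+ 2) +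
      4 * eta * ln (8 * expR t * a ^+ 2) + 2 * K) =
    - (t * eps / 2) * n + n * ln (8 * Q ^+ 2) +
      4 * eta * ln (8 * expR t * a ^+ 2) * n + 2 * K * n by ring.
  by apply: lerD => //; apply: lerD => //; rewrite lerD2r.
rewrite lerD2r.
have en0 : 0 < eta * n by rewrite mulr_gt0.
have p1 : PG (fun G => ~~ g1 G) <=
    (2 * a ^+ D / n + 4 / (xi * q) + layer_err V q D w) / eta.
  apply: le_trans (_ : _ <= PG (fun G => eta * n <= B1 G)) _.
    by apply: (le_Pr e01) => G; rewrite -leNgt.
  apply: le_trans (markov_Ex e01 en0 _) _; first by move=> G; rewrite addr_ge0.
  rewrite ExD ler_pdivrMr//.
  have := Ex_ball_le q01 r a4 D; have := Ex_poorly_attached r q01 a4 w1 hD xi0 xix xin.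
  rewrite -/(X _).
  rewrite (_ : _ / eta * (eta * n) = 2 * a ^+ D +
    n * (4 / (xi * q) + layer_err V q D w)); first by lra.
  by field; rewrite !gt_eqF// ?mulr_gt0.
have p2 : PG (fun G => ~~ g2 G) <= layer_err V q D w.
  apply: le_trans (layer_lower r q01 a4 w1 hD).
  by apply: (le_Pr e01) => G; rewrite /g2 -ltNge.
have p3 : PG (fun G => ~~ g3 G) <= overflow.
  rewrite /overflow /g3; case: ifP => _ /=.
    by rewrite -[leRHS](Ex_cst (@edge_prob R V q)).
  by apply: (le_Pr e01) => G; rewrite -ltnNge.
have p4 : PG (fun G => ~~ g4 G) <= K^-1.
  have Kna : 0 < K * (n * a) by rewrite !mulr_gt0.
  apply: le_trans (_ : _ <= PG (fun G => K * (n * a) <= sdeg G)) _.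
    by apply: (le_Pr e01) => G; rewrite -leNgt.
  apply: le_trans (markov_Ex e01 Kna _) _; first by move=> G; rewrite sumr_ge0.
  rewrite ler_pdivrMr// [leRHS]mulrA mulVf ?mul1r ?gt_eqF//.
  exact: Ex_sum_deg.
apply: le_trans (_ : _ <= PG (fun G => ~~ g1 G || (~~ g2 G || (~~ g3 G || ~~ g4 G)))) _.
  by apply: (le_Pr e01) => G; rewrite !negb_and.
have := Pr_or e01 (fun G => ~~ g1 G) (fun G => ~~ g2 G || (~~ g3 G || ~~ g4 G)).
have := Pr_or e01 (fun G => ~~ g2 G) (fun G => ~~ g3 G || ~~ g4 G).
have := Pr_or e01 (fun G => ~~ g3 G) (fun G => ~~ g4 G).
by move: p1 p2 p3 p4; lra.
Qed.

End displaced_regime.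
End random_graph.

(** * The Poisson limit *)

Section finite_limits.
Local Open Scope classical_set_scope.
Variables (R : realType) (F : nat -> nat -> R) (l : nat -> R).
Hypothesis Fl : forall j, F j x @[x --> \oo] --> l j.

Lemma cvg_sum_ord n : \sum_(j < n) F j x @[x --> \oo] --> \sum_(j < n) l j.
Proof.
elim: n => [|n IH].
  by rewrite big_ord0; under eq_fun do rewrite big_ord0; exact: cvg_cst.
rewrite big_ord_recr; under eq_fun do rewrite big_ord_recr /=.
exact: cvgD.
Qed.

Lemma cvg_prod_ord n : \prod_(j < n) F j x @[x --> \oo] --> \prod_(j < n) l j.
Proof.
elim: n => [|n IH].
  by rewrite big_ord0; under eq_fun do rewrite big_ord0; exact: cvg_cst.
rewrite big_ord_recr; under eq_fun do rewrite big_ord_recr /=.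
exact: cvgM.
Qed.

End finite_limits.

Section poisson_inverse.
Variables (R : realType) (lambda : R).
Hypothesis lambda01 : 0 < lambda < 1.
Local Notation mu := (ln lambda^-1).
Local Notation P := (poisson_prob mu 0).
Local Open Scope classical_set_scope.

Let mu0 : 0 < mu.
Proof. by case/andP: lambda01 => l0 l1; rewrite ln_gt0// invf_gt1. Qed.

Lemma poisson_set1 (j : nat) : P [set j] = (poisson_pmf mu j)%:E.
Proof. by rewrite /poisson_prob mu0 esum_set1// lee_fin poisson_pmf_ge0. Qed.

Lemma poisson_gt0 : fine (P [set k : nat | (0 < k)%N]) = 1 - lambda.
Proof.
have -> : [set k : nat | (0 < k)%N] = ~` [set 0%N].
  by apply/seteqP; split=> k /=; rewrite lt0n => /eqP.
rewrite probability_setC// [X in (1 - X)%E](poisson_set1 0) -EFinB /=.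
congr (_ - _).
rewrite /poisson_pmf mu0 expr0 fact0 invr1 !mul1r.
case/andP: lambda01 => l0 _.
by rewrite lnV ?posrE// opprK lnK.
Qed.

Let ginv (k : nat) : R := k%:R^-1.

Let measurable_natset (A : set nat) : measurable A. Proof. by []. Qed.

Let integrable_inv (A : set nat) : P.-integrable A (EFin \o ginv).
Proof.
apply: (@le_integrable _ _ _ _ _ _ _ (EFin \o cst 1)) => //.
- by move=> k _ /=; rewrite lee_fin normr1 ger0_norm ?invr_ge0 ?inv_le1.
- exact: finite_measure_integrable_cst.
Qed.

Lemma poisson_tail_split (J : nat) :
  \int[P]_(k in [set k : nat | (0 < k)%N]) ginv k =
  \sum_(j < J.+1) poisson_pmf mu j * j%:R^-1 +
  \int[P]_(k in [set k : nat | (J < k)%N]) ginv k.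
Proof.
elim: J => [|J IH].
  by rewrite big_ord_recl big_ord0 /= invr0 mulr0 !add0r.
rewrite IH [in RHS]big_ord_recr /= -addrA; congr (_ + _).
have -> : [set k : nat | (J < k)%N] = [set J.+1] `|` [set k : nat | (J.+1 < k)%N].
  apply/seteqP; split=> k /=; first by rewrite leq_eqVlt => /orP[/eqP <-|]; [left|right].
  by case=> [->//|]; exact: ltnW.
rewrite Rintegral_setU//; last first.
  by apply/disj_setPS => k [/= ->]; rewrite ltnn.
congr (_ + _).
rewrite (@eq_Rintegral _ _ _ _ _ (cst (ginv J.+1))); last first.
  by move=> k /set_mem /= ->.
by rewrite Rintegral_cst// [X in fine X](poisson_set1 J.+1) /= mulrC.
Qed.

(** The factor [1 - lambda] cancels the probability of the conditioning event. What remains is the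
    expectation of [1 / X] over [X > 0], and the values beyond [J] contribute at most [1 / J.+1]. *)
Lemma f_overlap_approx (J : nat) :
  `|f_overlap lambda - \sum_(j < J.+1) poisson_pmf mu j * j%:R^-1| <= J.+1%:R^-1.
Proof.
rewrite /f_overlap /cond_expectation poisson_gt0 mulrC divfK; last first.
  by case/andP: lambda01 => _ l1; rewrite subr_eq0 gt_eqF.
rewrite (poisson_tail_split J) addrC addKr ger0_norm; last first.
  by apply: Rintegral_ge0 => k _; rewrite invr_ge0.
apply: (@le_trans _ _ (\int[P]_(k in [set k : nat | (J < k)%N]) (cst J.+1%:R^-1) k)).
  apply: le_Rintegral => //; first exact: finite_measure_integrable_cst.
  by move=> k /= Jk; rewrite lef_pV2 ?posrE ?ltr0n ?ler_nat// (leq_trans _ Jk).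
rewrite Rintegral_cst// ler_piMr// ?invr_ge0//.
have := @probability_le1 _ _ _ P [set k : nat | (J < k)%N] (measurable_natset _).
by move=> h; rewrite -lee_fin fineK ?fin_num_measure.
Qed.

(** The truncation error is uniform in [q] and [m], which reduces the Poisson limit to finitely many
    terms. *)
Lemma binexp_approx (q : R) (m J : nat) : 0 <= q <= 1 -> (J <= m)%N ->
  `|binexp q m ginv -
    \sum_(j < J.+1) 'C(m, j)%:R * q ^+ j * (1 - q) ^+ (m - j) * j%:R^-1|
  <= J.+1%:R^-1.
Proof.
move=> q01 Jm; have /andP[q0 q1] := q01.
pose t (j : nat) : R := 'C(m, j)%:R * q ^+ j * (1 - q) ^+ (m - j).
have t0 j : 0 <= t j by rewrite !mulr_ge0 ?exprn_ge0// subr_ge0.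
have st : \sum_(j < m.+1) t j = 1.
  rewrite -(binexp_cst q m 1) binexp_formula; apply: eq_bigr => j _.
  by rewrite mulr1.
rewrite binexp_formula -[X in _ - X]/(\sum_(j < J.+1) t j * ginv j).
rewrite -(big_mkord xpredT (fun j => t j * ginv j)).
rewrite (@big_cat_nat _ _ _ J.+1)//= (big_mkord xpredT (fun i => t i * ginv i)).
rewrite addrAC subrr add0r ger0_norm; last first.
  by apply: sumr_ge0 => j _; rewrite mulr_ge0// invr_ge0.
apply: (@le_trans _ _ (\sum_(J.+1 <= j < m.+1) t j * J.+1%:R^-1)).
  rewrite big_nat_cond [leRHS]big_nat_cond; apply: ler_sum => j /andP[/andP[Jj _] _].
  rewrite ler_wpM2l// lef_pV2 ?posrE ?ltr0n ?ler_nat//.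
  exact: leq_trans Jj.
rewrite -mulr_suml ler_piMl// ?invr_ge0// -st -(big_mkord xpredT t).
by rewrite [leRHS](@big_cat_nat _ _ _ J.+1)//= lerDr sumr_ge0.
Qed.

Lemma bin_ffactR (m j : nat) :
  'C(m, j)%:R = (\prod_(i < j) (m - i)%:R) / j`!%:R :> R.
Proof.
have f0 : j`!%:R != 0 :> R by rewrite pnatr_eq0 -lt0n fact_gt0.
apply: (mulIf f0); rewrite divfK// -natrM bin_ffact ffact_prod natr_prod.
by [].
Qed.

Lemma cvg_binexp_term (q : nat -> R) (m : nat -> nat) (j : nat) :
  q x @[x --> \oo] --> (0 : R) ->
  (m x)%:R * q x @[x --> \oo] --> mu ->
  (\forall x \near \oo, 0 < q x) ->
  'C(m x, j)%:R * q x ^+ j * (1 - q x) ^+ (m x - j) @[x --> \oo]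
    --> poisson_pmf mu j.
Proof.
move=> q0 mq qpos.
(* The truncated subtraction is eventually a true one, because [i * q] tends to 0 while [m * q]
   tends to a positive limit. *)
have mi i : (m x - i)%:R * q x @[x --> \oo] --> mu.
  have : (m x)%:R * q x - i%:R * q x @[x --> \oo] --> mu - i%:R * 0.
    by apply: cvgB => //; apply: cvgM => //; exact: cvg_cst.
  rewrite mulr0 subr0; apply: cvg_trans; apply: near_eq_cvg.
  have : \forall x \near \oo, i%:R * q x < (m x)%:R * q x.
    have mu2 : mu / 2 < mu by rewrite ltr_pdivrMr// ltr_pMr// ltr1n.
    have h1 : \forall x \near \oo, mu / 2 < (m x)%:R * q x.
      by apply: (cvgr_gt mu).
    have h2 : \forall x \near \oo, i%:R * q x < mu / 2.
      apply: (cvgr_lt 0); last by rewrite divr_gt0.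
      rewrite -(mulr0 (i%:R : R)); apply: cvgM => //; exact: cvg_cst.
    by near=> x; apply: (@lt_trans _ _ (mu / 2)); near: x.
  move=> h; near=> x.
  have qx : 0 < q x by near: x.
  have : i%:R * q x < (m x)%:R * q x by near: x.
  rewrite ltr_pM2r// ltr_nat => im.
  by rewrite natrB ?mulrBl// ltnW.
(* The logarithm of [(1 - q) ^+ m], written so that the second factor is squeezed to -1. *)
have lnq : ((m x)%:R * q x) * (ln (1 - q x) / q x) @[x --> \oo] --> mu * (-1 : R).
  apply: cvgM => //.
  apply: (@squeeze_cvgr _ _ _ _ (fun x => - (1 - q x)^-1) (fun=> -1 : R)).
  - near=> x.
    have qx : 0 < q x by near: x.
    have q1 : q x < 1 by near: x; apply: (cvgr_lt 0).
    have p1 : 0 < 1 - q x by rewrite subr_gt0.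
    apply/andP; split.
      rewrite ler_pdivlMr// mulNr lerNl -lnV ?posrE//.
      rewrite [X in ln X](_ : _ = 1 + (1 - q x)^-1 * q x).
        apply: le_ln1Dx; apply: (@lt_le_trans _ _ 0) => //.
        by rewrite mulr_ge0 ?invr_ge0 ?ltW.
      by field; exact: lt0r_neq0.
    rewrite ler_pdivrMr// mulN1r -ler_expR lnK ?posrE//.
    exact: expR_ge1Dx.
  - rewrite -[X in _ --> X](_ : - (1 - 0)^-1 = _); last by rewrite subr0 invr1.
    apply: cvgN; apply: cvgV; first by rewrite subr0 oner_neq0.
    by apply: cvgB => //; exact: cvg_cst.
  - exact: cvg_cst.
rewrite mulrN1 in lnq.
have pw : (1 - q x) ^+ (m x) @[x --> \oo] --> expR (- mu).
  have := cvg_comp _ _ lnq (@continuous_expR R (- mu)).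
  apply: cvg_trans; apply: near_eq_cvg; near=> x.
  have qx : 0 < q x by near: x.
  have q1 : q x < 1 by near: x; apply: (cvgr_lt 0).
  rewrite /= -mulrA [q x * _]mulrC divfK ?gt_eqF// expRM_natl lnK// posrE subr_gt0//.
have near_jm : \forall x \near \oo, (j <= m x)%N.
  have mu2 : mu / 2 < mu by rewrite ltr_pdivrMr// ltr_pMr// ltr1n.
  have h1 : \forall x \near \oo, mu / 2 < (m x)%:R * q x.
    by apply: (cvgr_gt mu).
  have h2 : \forall x \near \oo, j%:R * q x < mu / 2.
    apply: (cvgr_lt 0); last by rewrite divr_gt0.
    rewrite -(mulr0 (j%:R : R)); apply: cvgM => //; exact: cvg_cst.
  apply: filterS3 h1 h2 qpos => x h1 h2 qx.
  by rewrite -(ler_nat R) -(ler_pM2r qx) ltW// (lt_trans h2).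
have pj : (1 - q x) ^+ j @[x --> \oo] --> (1 : R).
  have q1 (i : nat) : 1 - q x @[x --> \oo] --> (1 : R).
    by rewrite -[X in _ --> X](subr0 1); apply: cvgB => //; exact: cvg_cst.
  have := @cvg_prod_ord R (fun _ x => 1 - q x) (fun=> 1) q1 j.
  rewrite prodr_const card_ord expr1n.
  by under eq_fun do rewrite prodr_const card_ord.
have pr : \prod_(i < j) ((m x - i)%:R * q x) @[x --> \oo] --> mu ^+ j.
  rewrite -[X in mu ^+ X](card_ord j) -prodr_const.
  exact: (cvg_prod_ord (F := fun i x => (m x - i)%:R * q x) (l := fun=> mu)).
have : (\prod_(i < j) ((m x - i)%:R * q x)) / j`!%:R *
    ((1 - q x) ^+ m x / (1 - q x) ^+ j) @[x --> \oo] -->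
    mu ^+ j / j`!%:R * (expR (- mu) / 1).
  apply: cvgM; first by apply: cvgM => //; exact: cvg_cst.
  by apply: cvgM => //; apply: cvgV; rewrite ?oner_neq0.
rewrite divr1 /poisson_pmf mu0; apply: cvg_trans; apply: near_eq_cvg.
near=> x.
have q1 : q x < 1 by near: x; apply: (cvgr_lt 0).
have jm : (j <= m x)%N by near: x.
rewrite bin_ffactR big_split /= prodr_const card_ord.
have -> : (1 - q x) ^+ m x = (1 - q x) ^+ (m x - j) * (1 - q x) ^+ j.
  by rewrite -exprD subnK.
rewrite mulfK ?expf_neq0 ?subr_eq0 ?gt_eqF//.
by rewrite [_ * q x ^+ j / _]mulrAC.
Unshelve. all: by end_near. Qed.

Lemma cvg_binexp_inv (q : nat -> R) (m : nat -> nat) :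
  q x @[x --> \oo] --> (0 : R) ->
  (m x)%:R * q x @[x --> \oo] --> mu ->
  (\forall x \near \oo, 0 < q x) ->
  binexp (q x) (m x) (fun j => j%:R^-1) @[x --> \oo] --> f_overlap lambda.
Proof.
move=> q0 mq qpos; apply/cvgrPdist_le => e e0.
have [J Je] : exists J : nat, J.+1%:R^-1 <= e / 4.
  have [N _ HN] := nbhs_infty_ger (4 / e).
  exists N; rewrite -[leRHS]invf_div lef_pV2 ?posrE ?divr_gt0 ?ltr0n//.
  by apply: (HN N.+1) => /=.
have sc : \sum_(j < J.+1) 'C(m x, j)%:R * q x ^+ j * (1 - q x) ^+ (m x - j) *
    j%:R^-1 @[x --> \oo] --> \sum_(j < J.+1) poisson_pmf mu j * j%:R^-1.
  apply: (cvg_sum_ord (l := fun j => poisson_pmf mu j * j%:R^-1)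
    (F := fun j x => 'C(m x, j)%:R * q x ^+ j * (1 - q x) ^+ (m x - j) * j%:R^-1)).
  by move=> j; apply: cvgM; [exact: cvg_binexp_term|exact: cvg_cst].
have mu2 : mu / 2 < mu by rewrite ltr_pdivrMr// ltr_pMr// ltr1n.
have h2 : \forall x \near \oo, J%:R * q x < mu / 2.
  apply: (cvgr_lt 0); last by rewrite divr_gt0.
  rewrite -(mulr0 (J%:R : R)); apply: cvgM => //; exact: cvg_cst.
near=> x.
have qx : 0 < q x by near: x.
have q1 : q x <= 1 by near: x; apply: (cvgr_le 0).
have Jm : (J <= m x)%N.
  have : J%:R * q x < (m x)%:R * q x.
    apply: (@lt_trans _ _ (mu / 2)); first by near: x.
    by near: x; apply: (cvgr_gt mu).
  by rewrite ltr_pM2r// ltr_nat; exact: ltnW.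
have A1 := f_overlap_approx J.
have A2 := @binexp_approx (q x) (m x) J _ Jm.
have {}A2 := A2 (introT andP (conj (ltW qx) q1)).
have A3 : `|\sum_(j < J.+1) poisson_pmf mu j * j%:R^-1 -
   \sum_(j < J.+1) 'C(m x, j)%:R * q x ^+ j * (1 - q x) ^+ (m x - j) * j%:R^-1|
   <= e / 2.
  near: x; move/cvgrPdist_le: sc; apply; by rewrite divr_gt0.
move: A1 A2 A3; set s1 := \sum_(j < _) _; set s2 := \sum_(j < _) _.
rewrite -/ginv; move: (f_overlap lambda) (binexp _ _ _) => f bb A1 A2 A3.
have -> : f - bb = (f - s1) + (s1 - s2) - (bb - s2) by ring.
apply: le_trans (ler_normB _ _) _; apply: le_trans (lerD (ler_normD _ _) (lexx _)) _.
apply: le_trans (lerD (lerD A1 A3) A2) _.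
apply: le_trans (lerD (lerD Je (lexx _)) Je) _.
by rewrite (_ : e / 4 + e / 2 + e / 4 = e)//; field.
Unshelve. all: by end_near. Qed.

End poisson_inverse.

(** * Asymptotics *)

Section vanishing_sequences.
Variable R : realType.
Implicit Types u v : nat -> R.
Local Open Scope classical_set_scope.

Lemma expR_ge_id (x : R) : x <= expR x.
Proof. by apply: le_trans (expR_ge1Dx x); rewrite lerDr. Qed.

(** One-sided on purpose: error terms then need only upper bounds, and nonnegativity is used once,
    in [vanishing_cvg0]. *)
Definition vanishing u := forall e, 0 < e -> \forall n \near \oo, u n <= e.

Lemma vanishing_le u v : (\forall n \near \oo, u n <= v n) ->
  vanishing v -> vanishing u.
Proof.
move=> uv v0 e /v0; apply: filterS2 uv => n; exact: le_trans.
Qed.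

Lemma vanishingD u v : vanishing u -> vanishing v ->
  vanishing (fun n => u n + v n).
Proof.
move=> u0 v0 e e0; have e2 : 0 < e / 2 by rewrite divr_gt0.
apply: filterS2 (u0 _ e2) (v0 _ e2) => n un vn.
by rewrite (splitr e); exact: lerD.
Qed.

Lemma vanishingZ (c : R) u : 0 <= c -> vanishing u ->
  vanishing (fun n => c * u n).
Proof.
move=> c0 u0 e e0; have [c00|cn0] := eqVneq c 0.
  by apply: nearW => n; rewrite c00 mul0r ltW.
have {cn0}c0 : 0 < c by rewrite lt0r cn0.
apply: filterS (u0 (e / c) (divr_gt0 e0 c0)) => n.
by rewrite ler_pdivlMr// mulrC.
Qed.

Lemma vanishing_cvg0 u : (\forall n \near \oo, 0 <= u n) -> vanishing u ->
  u n @[n --> \oo] --> (0 : R).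
Proof.
move=> u_ge0 u0; apply/cvgrPdist_le => e /u0; apply: filterS2 u_ge0 => n un ue.
by rewrite sub0r normrN ger0_norm.
Qed.

Lemma near_S (P : nat -> Prop) : (\forall n \near \oo, P n) ->
  \forall m \near \oo, P m.+1.
Proof. by move=> [N _ H]; exists N => // m /= Nm; apply: H; exact: leqW. Qed.

Lemma vanishing_S u : vanishing u -> vanishing (fun m => u m.+1).
Proof. by move=> u0 e /u0; exact: near_S. Qed.

Lemma near_ln (A : R) : \forall n \near \oo, A <= ln n%:R.
Proof.
apply: filterS (nbhs_infty_ger (expR A)) => n An.
by rewrite -(expRK A) ler_ln ?posrE ?expR_gt0// (lt_le_trans (expR_gt0 A)).
Qed.

Lemma near_lnln (A : R) : \forall n \near \oo, A <= ln (ln n%:R).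
Proof.
apply: filterS (near_ln (expR A)) => n An.
by rewrite -{1}(expRK A) ler_ln ?posrE ?expR_gt0// (lt_le_trans (expR_gt0 A)).
Qed.

Lemma vanishing_lnln (K : R) u : 0 <= K ->
  (\forall n \near \oo, u n <= K / ln (ln n%:R)) -> vanishing u.
Proof.
move=> K0 uK e e0; apply: filterS2 uK (near_lnln ((K + 1) / e)) => n uK An.
have K1 : 0 < (K + 1) / e by rewrite divr_gt0// ltr_wpDl.
apply: le_trans uK _; rewrite ler_pdivrMr ?(lt_le_trans K1)//.
have : e * ((K + 1) / e) <= e * ln (ln n%:R) by rewrite ler_pM2l.
by rewrite mulrC divfK ?gt_eqF//; apply: le_trans; rewrite lerDl.
Qed.

End vanishing_sequences.

(** * Growth of the parameters *)

Section parameters.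
Variables (R : realType) (alpha : nat -> R) (c C : R).
Hypothesis c0 : 0 < c.
Local Open Scope classical_set_scope.
Hypothesis near_alpha : \forall n \near \oo, c <= alpha n <= C.

Local Notation L n := (ln n%:R : R).
Local Notation LL n := (ln (ln n%:R) : R).
Local Notation a n := (n%:R * q_ alpha n : R).
Local Notation w n := (LL n ^+ 2).

(** Eventually [dstar] is positive, as the proof of [near_depth] shows, and then [(depth n).+1]
    equals [dstar]. *)
Definition depth n : nat := `|dstar alpha n|%N.-1.
Local Notation D n := (depth n).

Record basic_bounds (A : R) (n : nat) : Prop := BasicBounds {
  bb_n : (0 < n)%N;
  bb_LL : A <= LL n;
  bb_L : expR (LL n) = L n;
  bb_nE : expR (L n) = n%:R;
  bb_lo : c * L n <= a n;
  bb_hi : a n <= C * L n }.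

Lemma near_basic (A : R) : \forall n \near \oo, basic_bounds A n.
Proof.
apply: filterS2 (filterI near_alpha (nbhs_infty_gt 0)) (filterI (near_lnln A) (near_ln (1 : R))).
move=> n [/andP[ca aC] n0] [LLA L1].
have nR : 0 < n%:R :> R by rewrite ltr0n.
have L0 : 0 < L n by exact: lt_le_trans L1.
have aE : a n = alpha n * L n by rewrite /q_ mulrC divfK// gt_eqF.
split => //; rewrite ?lnK ?posrE//.
- by rewrite aE ler_pM2r.
- by rewrite aE ler_pM2r.
Qed.

Lemma C_gt0 : 0 < C.
Proof.
have [N _ H] := near_alpha; have /andP[h1 h2] := H N (leqnn N).
by apply: lt_le_trans (le_trans h1 h2).
Qed.

(** Taylor minorants of the exponential: [24 = 4!] comes from comparing [log log n] with [log n],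
    and a quadratic one compares [log n] with [n]. *)
Lemma basic_growth (A : R) n : 4 <= A -> basic_bounds A n ->
  [/\ 4 <= LL n, LL n ^+ 4 / 24 <= L n, 4 <= L n & (L n / 2) ^+ 2 <= n%:R].
Proof.
move=> A4 bb; have LL4 : 4 <= LL n by apply: le_trans (bb_LL bb).
have LL0 : 0 <= LL n by apply: le_trans LL4.
have L1 : LL n ^+ 4 / 24 <= L n.
  have := expR_ge1Dxn 3 LL0; rewrite (bb_L bb); apply: le_trans.
  by rewrite lerDr.
have L4 : 4 <= L n by apply: le_trans LL4 _; rewrite -[leRHS](bb_L bb) expR_ge_id.
split => //; have := @expR_ge1Dxn R (L n) 1 (le_trans (ler0n _ 4) L4).
rewrite (bb_nE bb); apply: le_trans.
have -> : (L n / 2) ^+ 2 = L n ^+ 2 / 2 / 2 by field.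
apply: (@le_trans _ _ (L n ^+ 2 / 2)); last by rewrite lerDr.
by have := sqr_ge0 (L n); lra.
Qed.

(** Nonpositive powers of [a n] are at most 1, hence below [n / w], so [dstar] is positive. Its
    minimality bounds [a ^+ D] from above. *)
Lemma near_depth : \forall n \near \oo,
  [/\ a n ^+ D n <= n%:R / w n, n%:R / w n <= a n ^+ (D n).+1 &
      a n ^+ (D n).+1 / n%:R = ln (lambda_ alpha n)^-1].
Proof.
apply: filterS2 (near_basic 4) (near_ln (2 / c)) => n bb Lc.
have [LL4 L24 L4 nL] := basic_growth (lexx 4) bb.
have a1 : 1 < a n.
  apply: lt_le_trans (bb_lo bb); apply: (@lt_le_trans _ _ 2); first by rewrite ltr1n.
  by rewrite mulrC -ler_pdivrMr.
have L1 : 1 < L n by apply: lt_le_trans L4; rewrite ltr1n.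
have w0 : 0 < w n by rewrite exprn_gt0// (lt_le_trans _ LL4).
have nw : 1 < n%:R / w n.
  rewrite ltr_pdivlMr// mul1r; apply: lt_le_trans nL; rewrite ltrXn2r ?nnegrE//.
  - by apply: le_trans LL4.
  apply: (@lt_le_trans _ _ (LL n ^+ 4 / 24 / 2)); last by rewrite ler_pM2r.
  have : 64 <= LL n ^+ 3.
    rewrite (_ : 64 = 4 ^+ 3 :> R); last by ring.
    by rewrite lerXn2r ?nnegrE// (le_trans _ LL4).
  rewrite (_ : LL n ^+ 4 / 24 / 2 = LL n * (LL n ^+ 3 / 48)); last by field.
  move=> h; rewrite ltr_pMr ?(lt_le_trans _ LL4)//; lra.
have [] := @dstarP R alpha n L1 a1.
rewrite /depth ln_lambda_; case: (dstar alpha n) => [[|k]|k].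
- by rewrite expr0z leNgt nw.
- move=> h1 h2; rewrite /=; split => //.
  rewrite leNgt; apply/negP => /ltW h; have := h2 k h.
  by rewrite lez_nat ltnn.
move=> h1 _; move: h1; rewrite leNgt => /negP[]; apply: le_lt_trans nw.
rewrite NegzE -exprnN invf_le1 ?exprn_gt0 ?exprn_ege1 ?ltW//.
by rewrite (lt_trans _ a1).
Qed.

Lemma vanishing_aD : vanishing (fun n => a n ^+ D n / n%:R).
Proof.
apply: (@vanishing_lnln _ 1) => //.
apply: filterS2 (near_basic 4) near_depth => n bb [aD _ _].
have [LL4 _ _ _] := basic_growth (lexx 4) bb.
have n0 : 0 < n%:R :> R by rewrite ltr0n (bb_n bb).
have LL0 : 0 < LL n by exact: lt_le_trans LL4.
rewrite ler_pdivrMr//; apply: le_trans aD _.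
rewrite mulrC ler_pM2r// mul1r lef_pV2 ?posrE ?exprn_gt0// expr2 ler_peMr ?ltW//.
by apply: lt_le_trans LL4; rewrite ltr1n.
Qed.

Lemma vanishing_wa : vanishing (fun n => w n / a n).
Proof.
apply: (@vanishing_lnln _ (24 / c)); first by rewrite divr_ge0// ltW.
apply: filterS (near_basic 4) => n bb.
have [LL4 L24 L4 _] := basic_growth (lexx 4) bb.
have LL0 : 0 < LL n by exact: lt_le_trans LL4.
have L0 : 0 < L n by exact: lt_le_trans L4.
have a0 : 0 < a n by apply: lt_le_trans (bb_lo bb); rewrite mulr_gt0.
rewrite ler_pdivrMr//.
apply: (@le_trans _ _ (24 / c / LL n * (c * (LL n ^+ 4 / 24)))); last first.
  rewrite ler_pM2l ?divr_gt0//; apply: le_trans (bb_lo bb).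
  by rewrite ler_pM2l.
have -> : 24 / c / LL n * (c * (LL n ^+ 4 / 24)) = LL n ^+ 2 * LL n.
  by field; rewrite !gt_eqF.
by rewrite ler_peMr ?exprn_ge0 ?(ltW LL0)//; apply: le_trans LL4; rewrite ler1n.
Qed.

Lemma vanishing_sqrta : vanishing (fun n => (Num.sqrt (a n))^-1).
Proof.
have s0 : 0 < Num.sqrt (c / 24) by rewrite sqrtr_gt0 divr_gt0.
apply: (@vanishing_lnln _ (Num.sqrt (c / 24))^-1); first by rewrite invr_ge0 ltW.
apply: filterS (near_basic 4) => n bb.
have [LL4 L24 L4 _] := basic_growth (lexx 4) bb.
have LL0 : 0 < LL n by exact: lt_le_trans LL4.
have L0 : 0 < L n by exact: lt_le_trans L4.
have a0 : 0 < a n by apply: lt_le_trans (bb_lo bb); rewrite mulr_gt0.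
rewrite -invfM lef_pV2 ?posrE ?mulr_gt0 ?sqrtr_gt0//.
rewrite -{1}(ger0_norm (ltW LL0)) -sqrtr_sqr -sqrtrM ?exprn_ge0 ?(ltW LL0)//.
  apply: ler_wsqrtr; apply: le_trans (bb_lo bb).
  rewrite (_ : c / 24 * LL n ^+ 2 = c * (LL n ^+ 2 / 24)); last by field.
  rewrite ler_pM2l//; apply: le_trans L24; rewrite ler_pM2r ?invr_gt0//.
  by rewrite ler_weXn2l//; apply: le_trans LL4; rewrite ler1n.
  by rewrite divr_ge0// ltW.
by rewrite divr_gt0.
Qed.

Lemma vanishing_wn : vanishing (fun n => w n / Num.sqrt n%:R).
Proof.
apply: (@vanishing_lnln _ 48) => //.
apply: filterS (near_basic 4) => n bb.
have [LL4 L24 L4 nL] := basic_growth (lexx 4) bb.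
have LL0 : 0 < LL n by exact: lt_le_trans LL4.
have L0 : 0 < L n by exact: lt_le_trans L4.
have sn : L n / 2 <= Num.sqrt n%:R.
  rewrite -(@ger0_norm _ (L n / 2)) ?divr_ge0 ?(ltW L0)// -sqrtr_sqr.
  exact: ler_wsqrtr.
have sn0 : 0 < Num.sqrt n%:R :> R by apply: lt_le_trans sn; rewrite divr_gt0.
rewrite ler_pdivrMr//; apply: (@le_trans _ _ (48 / LL n * (LL n ^+ 4 / 24 / 2))).
  have -> : 48 / LL n * (LL n ^+ 4 / 24 / 2) = LL n ^+ 2 * LL n.
    by field; rewrite gt_eqF.
  by rewrite ler_peMr ?exprn_ge0 ?(ltW LL0)//; apply: le_trans LL4; rewrite ler1n.
rewrite ler_pM2l ?divr_gt0//; apply: le_trans sn.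
by rewrite ler_pM2r ?invr_gt0.
Qed.

Lemma vanishing_sqrtn : vanishing (fun n => (Num.sqrt n%:R)^-1 : R).
Proof.
apply: vanishing_le vanishing_wn; apply: filterS (near_basic 4) => n bb.
have [LL4 _ _ _] := basic_growth (lexx 4) bb.
rewrite -[leLHS]mul1r ler_wpM2r ?invr_ge0 ?sqrtr_ge0//.
by rewrite exprn_ege1//; apply: le_trans LL4; rewrite ler1n.
Qed.

Lemma vanishing_invn : vanishing (fun n => n%:R^-1 : R).
Proof.
apply: vanishing_le vanishing_sqrtn; apply: filterS (near_basic 4) => n bb.
have n1 : 1 <= n%:R :> R by rewrite ler1n (bb_n bb).
have s1 : 1 <= Num.sqrt n%:R :> R by rewrite -[leLHS]sqrtr1; exact: ler_wsqrtr.
rewrite -{1}(@sqr_sqrtr _ (n%:R : R)) ?ler0n//.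
rewrite lef_pV2 ?posrE ?exprn_gt0 ?(lt_le_trans ltr01)//.
by rewrite expr2 ler_peMr// (le_trans ler01).
Qed.

Lemma vanishing_q : vanishing (q_ alpha).
Proof.
have v : vanishing (fun n => C * (4 * (1 / LL n))).
  apply: vanishingZ; first exact: ltW C_gt0.
  by apply: vanishingZ => //; apply: (@vanishing_lnln _ 1) => //; exact: nearW.
apply: vanishing_le v.
apply: filterS (near_basic 4) => n bb.
have [LL4 L24 L4 nL] := basic_growth (lexx 4) bb.
have LL0 : 0 < LL n by exact: lt_le_trans LL4.
have L0 : 0 < L n by exact: lt_le_trans L4.
have n0 : 0 < n%:R :> R by rewrite ltr0n (bb_n bb).
have -> : q_ alpha n = a n / n%:R by rewrite mulrC mulKf// gt_eqF.
rewrite ler_pdivrMr//; apply: le_trans (bb_hi bb) _.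
rewrite -mulrA ler_pM2l ?C_gt0// mul1r.
apply: (@le_trans _ _ (4 / L n * (L n / 2) ^+ 2)).
  by rewrite (_ : 4 / L n * (L n / 2) ^+ 2 = L n)//; field; rewrite gt_eqF.
apply: ler_pM => //.
- by rewrite divr_ge0// ltW.
- by rewrite exprn_ge0// divr_ge0// ltW.
rewrite ler_pM2l// lef_pV2 ?posrE//.
by rewrite -[leRHS](bb_L bb) expR_ge_id.
Qed.

Definition derr n : R := 2 / Num.sqrt (a n) + 12 * a n ^+ D n / n%:R.
Definition lerr n : R :=
  2 * derr n + 4 * a n ^+ D n / n%:R + 16 * w n / Num.sqrt n%:R.

Lemma vanishing_derr : vanishing derr.
Proof.
apply: vanishing_le (vanishingD (vanishingZ (ler0n _ 2) vanishing_sqrta)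
  (vanishingZ (ler0n _ 12) vanishing_aD)).
by apply: nearW => n; rewrite /derr !mulrA.
Qed.

Lemma vanishing_lerr : vanishing lerr.
Proof.
apply: vanishing_le (vanishingD (vanishingD (vanishingZ (ler0n _ 2) vanishing_derr)
  (vanishingZ (ler0n _ 4) vanishing_aD)) (vanishingZ (ler0n _ 16) vanishing_wn)).
by apply: nearW => n; rewrite /lerr !mulrA.
Qed.

Record setup (n : nat) : Prop := Setup {
  st_q : 0 <= q_ alpha n <= 1;
  st_min : Num.min (q_ alpha n) 1 = q_ alpha n;
  st_a : 4 <= a n;
  st_w : 1 <= w n;
  st_D : n%:R / w n <= a n ^+ (D n).+1;
  st_LL : 4 <= LL n }.

Lemma near_setup : \forall n \near \oo, setup n.
Proof.
apply: filterS2 (filterI (near_basic 4) near_depth)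
  (filterI (vanishing_q ltr01) (near_ln (4 / c))) => n [bb [_ hD _]] [q1 Lc].
have [LL4 L24 L4 nL] := basic_growth (lexx 4) bb.
have a4 : 4 <= a n.
  by apply: le_trans (bb_lo bb); rewrite mulrC -ler_pdivrMr.
have n0 : 0 < n%:R :> R by rewrite ltr0n (bb_n bb).
split => //.
- by rewrite q1 andbT -(pmulr_rge0 _ n0) (le_trans _ a4).
- by apply/min_idPl.
- by rewrite exprn_ege1//; apply: le_trans LL4; rewrite ler1n.
Qed.

End parameters.

(** * Convergence of the overlap *)

Lemma alpha_bounds (R : realType) (alpha : nat -> R) :
  (0 < limn_einf (fun n : nat => (alpha n)%:E))%E ->
  (limn_esup (fun n : nat => (alpha n)%:E) < +oo)%E ->
  exists c C : R, 0 < c /\ \forall n \near \oo%classic, c <= alpha n <= C.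
Proof.
set u := fun n => _; rewrite limn_einf_lim limn_esup_lim => lo hi.
have [N HN] : exists N, (0 < einfs u N)%E.
  apply: contrapT => H; move: lo; rewrite ltNge => /negP; apply.
  apply: lime_le; first exact: is_cvg_einfs.
  by apply: nearW => n; rewrite leNgt; apply/negP => h; apply: H; exists n.
have [M HM] : exists M, (esups u M < +oo)%E.
  apply: contrapT => H; move: hi; rewrite ltNge => /negP; apply.
  apply: lime_ge; first exact: is_cvg_esups.
  by apply: nearW => n; rewrite leNgt; apply/negP => h; apply: H; exists n.
have lowN n : (N <= n)%N -> (einfs u N <= (alpha n)%:E)%E.
  by move=> Nn; apply: ereal_inf_lbound; exists n.
have upM n : (M <= n)%N -> ((alpha n)%:E <= esups u M)%E.
  by move=> Mn; apply: ereal_sup_ubound; exists n.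
case: (einfs u N) HN lowN => [c c0 lowN| _ lowN|//]; last first.
  by have := lowN N (leqnn N).
case: (esups u M) HM upM => [C _ upM|//| _ upM]; last first.
  by have := upM M (leqnn M).
exists c, C; split => //; exists (maxn N M) => // n /=.
rewrite geq_max => /andP[Nn Mn].
by rewrite -!lee_fin lowN// upM.
Qed.

Section convergence.
Variables (R : realType) (alpha : nat -> R) (beta c C : R).
Hypothesis c0 : 0 < c.
Hypothesis beta0 : 0 < beta.
Local Open Scope classical_set_scope.
Hypothesis near_alpha : \forall n \near \oo, c <= alpha n <= C.

Local Notation L n := (ln n%:R : R).
Local Notation LL n := (ln (ln n%:R) : R).
Local Notation a n := (n%:R * q_ alpha n : R).
Local Notation w n := (LL n ^+ 2).
Local Notation D n := (depth alpha n).
Local Notation theta n := (a n ^+ (D n).+1 / n%:R).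
Local Notation derr := (derr alpha).
Local Notation lerr := (lerr alpha).
Local Notation far n := (96 * w n / a n + lerr n).

Let near_set := near_setup c0 near_alpha.
Let C0 : 0 < C. Proof. exact: C_gt0 c0 near_alpha. Qed.

Let v_aD := vanishing_aD c0 near_alpha.
Let v_derr := vanishing_derr c0 near_alpha.
Let v_lerr := vanishing_lerr c0 near_alpha.
Let v_invn := vanishing_invn near_alpha.
Let v_q := vanishing_q c0 near_alpha.

Lemma vanishing_far : vanishing (fun n => far n).
Proof.
apply: vanishingD v_lerr.
apply: vanishing_le (vanishingZ (ler0n _ 96) (vanishing_wa c0 near_alpha)).
by apply: nearW => n; rewrite mulrA.
Qed.

Lemma overlap_cvg_of_vanishing (cc : R) :
  (forall eps, 0 < eps <= 1 -> vanishing (overlap_tail alpha beta cc eps)) ->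
  overlap_cvg_in_prob alpha beta cc.
Proof.
move=> H eps eps0; apply: vanishing_cvg0.
  apply: filterS (near_S near_set) => m st; rewrite /overlap_tail (st_min st).
  have H1 := @le_replica_prob R _ (@ord0 m) _ (beta * LL m.+1) (st_q st)
    (fun _ _ _ => false) (fun _ T T' => eps < `|overlap R ord0 T T' - cc|).
  apply: le_trans (H1 _) => //.
  by rewrite /replica_prob big1// => G _; rewrite big1 ?mulr0// => T _; rewrite big_pred0.
have e01 : 0 < Num.min eps 1 <= 1 by rewrite lt_min eps0 ltr01 ge_min lexx orbT.
apply: vanishing_le (H _ e01); apply: filterS (near_S near_set) => m st.
rewrite /overlap_tail (st_min st); apply: (le_replica_prob _ _ (st_q st)) => G T T'.
by apply: le_lt_trans; rewrite ge_min lexx.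
Qed.

Lemma expRN_le (x : R) : 0 < x -> expR (- x) <= x^-1.
Proof.
by move=> x0; rewrite expRN lef_pV2 ?posrE ?expR_gt0// expR_ge_id.
Qed.

Lemma tail_bfs_bound (cc eps E1 E2 : R) (m : nat)
    (H : {set {set 'I_m.+1}} -> R) :
  0 <= cc <= 1 -> 0 < eps <= 1 -> setup alpha m.+1 ->
  (forall G : {set {set 'I_m.+1}}, G \subset all_edges 'I_m.+1 ->
     2 * \sum_(v in component G ord0 :\ ord0)
       ln (1 + 9 * excess ord0 G (beta * LL m.+1) v) <= H G) ->
  (forall G, 0 <= H G) ->
  Ex (edge_prob (q_ alpha m.+1)) (fun G : {set {set 'I_m.+1}} =>
      `|inv_parents R ord0 G - cc * m.+1%:R|)
    <= m.+1%:R * E1 ->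
  Ex (edge_prob (q_ alpha m.+1)) H <= m.+1%:R * E2 ->
  overlap_tail alpha beta cc eps m <=
  64 / eps ^+ 2 * (E1 + 2 * m.+1%:R^-1 + far m.+1 + E2).
Proof.
move=> cc01 /andP[eps0 eps1] st HG H0 HE1 HE2.
have b0 : 0 <= beta * LL m.+1.
  by rewrite mulr_ge0 ?(ltW beta0)// (le_trans _ (st_LL st)).
have n0 : 0 < m.+1%:R :> R by rewrite ltr0n.
have := @replica_bfs R 'I_m.+1 ord0 (q_ alpha m.+1) (beta * LL m.+1) (st_q st) b0
  (D m.+1) cc eps H cc01 _ HG H0.
rewrite eps0 eps1 => /(_ isT); rewrite /overlap_tail (st_min st).
rewrite [in X in X -> _]card_ord => /le_trans; apply.
have F1 := @Ex_far_sum R 'I_m.+1 ord0 (q_ alpha m.+1) (st_q st) (D m.+1) (w m.+1).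
rewrite /layer_err /dev_err card_ord -/(derr m.+1) -/(lerr m.+1) in F1.
have {}F1 := F1 (st_a st) (st_w st) (st_D st).
have e2 : 0 < eps ^+ 2 by rewrite exprn_gt0.
have k0 : 0 < eps ^+ 2 / 64 * m.+1%:R by rewrite mulr_gt0// divr_gt0.
(* One of the two terms [m.+1%:R^-1] in the conclusion majorizes the exponential; the other comes
   from the summand 1 in [replica_bfs]. *)
have x32 : 2 * expR (- (eps ^+ 2 / 32 * m.+1%:R)) <= 64 / eps ^+ 2 * m.+1%:R^-1.
  have -> : 64 / eps ^+ 2 * m.+1%:R^-1 = 2 * (eps ^+ 2 / 32 * m.+1%:R)^-1.
    by field; rewrite !gt_eqF.
  by rewrite ler_pM2l// expRN_le// mulr_gt0// divr_gt0.
have alg (N z : R) : 0 < N -> 64 / eps ^+ 2 * (E1 + 2 * N^-1 + z + E2) =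
  (N * E1 + 1 + N * z + N * E2) / (eps ^+ 2 / 64 * N) + 64 / eps ^+ 2 * N^-1.
  by move=> N0; field; rewrite !gt_eqF.
rewrite alg//.
apply: lerD => //; rewrite ler_pM2r ?invr_gt0//.
apply: lerD => //; apply: lerD => //; exact: lerD.
Qed.

Let sdeg_le m : setup alpha m.+1 ->
  Ex (edge_prob (q_ alpha m.+1)) (fun G : {set {set 'I_m.+1}} =>
      \sum_(v : 'I_m.+1) (deg G v)%:R) <=
  m.+1%:R * a m.+1.
Proof.
move=> st; have := @Ex_sum_deg R 'I_m.+1 ord0 (q_ alpha m.+1).
by rewrite card_ord => /(_ (st_a st)).
Qed.

Lemma bfs_convergence (lambda : R) : 0 < lambda < 1 -> 1 < beta ->
  lambda_ alpha n @[n --> \oo] --> lambda ->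
  overlap_cvg_in_prob alpha beta (f_overlap lambda).
Proof.
move=> l01 beta1 lcvg; have /andP[l0 l1] := l01.
set mu := ln lambda^-1.
(* A deterministic substitute for the size of the layer [D]; [mm n * q_n] has the same limit as
   [theta n = log (1 / lambda_n)]. *)
pose mm n := Num.trunc (a n ^+ D n).
have th_cvg : theta n @[n --> \oo] --> mu.
  rewrite /mu lnV ?posrE//.
  have := cvg_comp _ _ lcvg (continuous_ln l0).
  move=> /cvgN; apply: cvg_trans; apply: near_eq_cvg.
  apply: filterS (near_depth c0 near_alpha) => n [_ _ ->] /=.
  by rewrite lnV// posrE expR_gt0.
have q_cvg : q_ alpha n @[n --> \oo] --> (0 : R).
  apply: vanishing_cvg0 v_q; apply: filterS near_set => n st.
  by case/andP: (st_q st).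
have q_pos : \forall n \near \oo, 0 < q_ alpha n.
  apply: filterS near_set => n st; have /andP[q0 _] := st_q st.
  rewrite lt0r q0 andbT; apply: contraTneq (st_a st) => ->.
  by rewrite mulr0 -ltNge.
have near_mm : \forall n \near \oo, `|a n ^+ D n - (mm n)%:R| <= 1 /\
    a n ^+ D n * q_ alpha n = theta n /\ (mm n)%:R <= a n ^+ D n.
  apply: filterS (filterI near_set (nbhs_infty_gt 0)) => n [st n0].
  have aD : 0 <= a n ^+ D n by rewrite exprn_ge0// (le_trans _ (st_a st)).
  have /andP[m1 m2] := truncn_itv aD; rewrite -/(mm n) in m1 m2.
  split; last split => //.
    by rewrite ger0_norm ?subr_ge0// lerBlDl natr1 ltW.
  rewrite (exprS _ (D n)); move: (_ ^+ D n) => z.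
  by rewrite [RHS]mulrAC [n%:R * _]mulrC mulfK ?pnatr_eq0 -?lt0n// mulrC.
have mm_cvg : (mm n)%:R * q_ alpha n @[n --> \oo] --> mu.
  apply: (@squeeze_cvgr _ _ _ _ (fun n => theta n - q_ alpha n) (fun n => theta n)) => //.
    apply: filterS2 near_mm q_pos => n [m1 [<- m2]] q0.
    rewrite (ler_pM2r q0) m2 andbT lerBlDr -[X in _ <= _ + X]mul1r -mulrDl ler_pM2r//.
    by move: m1; rewrite ger0_norm ?subr_ge0// lerBlDl.
  by rewrite -[X in _ --> X]subr0; exact: cvgB.
have b_cvg := cvg_binexp_inv l01 q_cvg mm_cvg q_pos.
have v_b : vanishing (fun n => `|binexp (q_ alpha n) (mm n) (fun j => j%:R^-1) -
    f_overlap lambda|).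
  move=> e e0; move/cvgrPdist_le: b_cvg => /(_ e e0).
  by apply: filterS => n; rewrite distrC.
pose bd n := (Num.sqrt n%:R)^-1 + 4 * a n ^+ D n / n%:R +
  q_ alpha n * (a n ^+ D n * derr n + `|a n ^+ D n - (mm n)%:R|) +
  `|binexp (q_ alpha n) (mm n) (fun j => j%:R^-1) - f_overlap lambda| + far n.
have mu0 : 0 < mu by rewrite ln_gt0// invf_gt1.
have v_bd : vanishing bd.
  apply: vanishingD vanishing_far; apply: vanishingD v_b.
  apply: vanishingD; first apply: vanishingD.
  - exact: vanishing_sqrtn near_alpha.
  - apply: vanishing_le (vanishingZ (ler0n _ 4) v_aD).
    by apply: nearW => n; rewrite -[leLHS]mulrA.
  apply: vanishing_le (vanishingD (vanishingZ (_ : 0 <= mu + 1) v_derr) v_q); last first.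
    by rewrite addr_ge0// ltW.
  have th1 : \forall n \near \oo, theta n < mu + 1.
    by apply: (cvgr_lt mu) => //; rewrite ltrDl.
  apply: filterS3 near_mm th1 (filterI q_pos near_set) => n [m1 [tE _]] t1 [q0 st].
  rewrite mulrDr; apply: lerD; last by rewrite ler_piMr// ltW.
  rewrite mulrA [q_ _ _ * _]mulrC tE ler_wpM2r ?(ltW t1)//.
  have a0 : 0 <= a n by rewrite (le_trans _ (st_a st)).
  by rewrite addr_ge0// divr_ge0 ?sqrtr_ge0// mulr_ge0// exprn_ge0.
(* This is where [beta > 1] enters: the quantity is at most a constant times
   [(log n)^(1 - beta)]. *)
have v_eb : vanishing (fun n => 18 * (expR (- (beta * LL n)) * a n)).
  apply: vanishingZ => //.
  have b1 : 0 < beta - 1 by rewrite subr_gt0.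
  apply: (@vanishing_lnln _ (C / (beta - 1))); first by rewrite divr_ge0 ?ltW.
  apply: filterS (near_basic near_alpha 4) => n bb.
  have LL0 : 0 < LL n by apply: lt_le_trans (bb_LL bb).
  apply: (@le_trans _ _ (expR (- (beta * LL n)) * (C * L n))).
    by rewrite ler_wpM2l ?expR_ge0// (bb_hi bb).
  rewrite mulrCA -{2}(bb_L bb) -expRD -mulrA ler_pM2l//.
  rewrite (_ : - (beta * LL n) + LL n = - ((beta - 1) * LL n)); last by ring.
  by rewrite -invfM expRN_le// mulr_gt0.
have f01 : 0 <= f_overlap lambda <= 1.
  apply/andP; split.
    rewrite /f_overlap mulr_ge0 ?subr_ge0 ?(ltW l1)// divr_ge0 ?fine_ge0//.
    by apply: integral_ge0 => k _; rewrite lee_fin invr_ge0.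
  have := f_overlap_approx l01 0; rewrite big_ord_recl big_ord0 /= invr0 mulr0 addr0.
  by rewrite subr0 invr1; apply: le_trans; exact: ler_norm.
apply: overlap_cvg_of_vanishing => eps eps01; have /andP[eps0 _] := eps01.
have k0 : 0 <= 64 / eps ^+ 2 by rewrite divr_ge0// sqr_ge0.
have V := vanishingZ k0 (vanishingD (vanishingD (vanishingD v_bd
  (vanishingZ (ler0n _ 2) v_invn)) vanishing_far) v_eb).
apply: vanishing_le (vanishing_S V).
apply: filterS (near_S near_set) => m st /=.
apply: (@tail_bfs_bound _ _ _ _ _
  (fun G : {set {set 'I_m.+1}} =>
    18 * expR (- (beta * LL m.+1)) * \sum_(v : 'I_m.+1) (deg G v)%:R)) => //.
- by move=> G _; exact: sum_ln_excess_le.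
- by move=> G; rewrite !mulr_ge0 ?expR_ge0// sumr_ge0.
- have := @Ex_inv_parents_dev R 'I_m.+1 ord0 (q_ alpha m.+1) (st_q st) (D m.+1) (w m.+1).
  rewrite /layer_err /dev_err card_ord -/(derr m.+1) -/(lerr m.+1).
  by move=> /(_ (st_a st) (st_w st) (st_D st) (f_overlap lambda) (mm m.+1)).
rewrite ExZ mulrCA -mulrA ler_pM2l// mulrCA ler_pM2l ?expR_gt0//.
exact: sdeg_le.
Qed.

Lemma bfs_convergence0 : 1 <= beta ->
  lambda_ alpha n @[n --> \oo] --> (0 : R) ->
  overlap_cvg_in_prob alpha beta 0.
Proof.
move=> beta1 lcvg.
have v_th : vanishing (fun n => n%:R / a n ^+ (D n).+1).
  move=> e e0.
  have : \forall n \near \oo, lambda_ alpha n < expR (- e^-1).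
    by apply: (cvgr_lt 0) => //; rewrite expR_gt0.
  apply: filterS2 (filterI (near_depth c0 near_alpha) near_set) => n [[_ _ tE] st] ln.
  have : e^-1 <= theta n.
    rewrite tE lnV ?posrE ?expR_gt0// lerNr -[leRHS]expRK ler_ln ?posrE ?expR_gt0//.
    exact: ltW.
  move=> te; rewrite -[leLHS]invf_div -[leRHS]invrK lef_pV2 ?posrE ?invr_gt0//.
  by apply: lt_le_trans te; rewrite invr_gt0.
pose S n := 12 * n%:R / a n ^+ (D n).+1 + 2 * derr n + 2 * a n ^+ D n / n%:R + far n.
have v_S : vanishing S.
  apply: vanishingD vanishing_far; apply: vanishingD; first apply: vanishingD.
  - apply: vanishing_le (vanishingZ (ler0n _ 12) v_th).
    by apply: nearW => n; rewrite -[leLHS]mulrA.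
  - exact: vanishingZ.
  apply: vanishing_le (vanishingZ (ler0n _ 2) v_aD).
  by apply: nearW => n; rewrite -[leLHS]mulrA.
(* For [beta >= 1] this is only bounded, so the logarithms are split with a constant [K]. *)
have near_eb : \forall n \near \oo, expR (- (beta * LL n)) * a n <= C.
  apply: filterS (near_basic near_alpha 4) => n bb.
  have LL0 : 0 < LL n by apply: lt_le_trans (bb_LL bb).
  apply: (@le_trans _ _ (expR (- (beta * LL n)) * (C * L n))).
    by rewrite ler_wpM2l ?expR_ge0// (bb_hi bb).
  rewrite mulrCA -{2}(bb_L bb) -expRD ler_piMr ?(ltW C0)//.
  rewrite -[leRHS]expR0 ler_expR addrC subr_le0.
  by rewrite ler_peMl// ltW.
apply: overlap_cvg_of_vanishing => eps eps01 e e0; have /andP[eps0 _] := eps01.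
have k0 : 0 < 64 / eps ^+ 2 by rewrite divr_gt0// exprn_gt0.
(* Fixed before [n] grows: the degree term then contributes at most [e / 2], while [K * S n] still
   vanishes. *)
pose K := 12 * C * (64 / eps ^+ 2) / e.
have K0 : 0 < K by rewrite !mulr_gt0 ?invr_gt0// exprn_gt0.
have CK : 64 / eps ^+ 2 * (6 * (C / K)) = e / 2.
  by rewrite /K; field; rewrite !gt_eqF.
clearbody K.
have V := vanishingZ (ltW k0) (vanishingD (vanishingD (vanishingD v_S
  (vanishingZ (ler0n _ 2) v_invn)) vanishing_far)
  (vanishingZ (ler0n _ 6) (vanishingZ (ltW K0) v_S))).
have e2 : 0 < e / 2 by rewrite divr_gt0.
apply: filterS3 (near_S near_set) (near_S near_eb) (vanishing_S V e2) => m st eb Vm.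
have := @tail_bfs_bound 0 eps (S m.+1) (6 * (C / K + K * S m.+1)) m
  (fun G : {set {set 'I_m.+1}} =>
     6 * (expR (- (beta * LL m.+1)) / K * \sum_(v : 'I_m.+1) (deg G v)%:R
     + K * inv_parents R ord0 G)).
have inv0 (G : {set {set 'I_m.+1}}) : 0 <= inv_parents R ord0 G.
  by apply: sumr_ge0 => v _; rewrite invr_ge0.
have M1 : Ex (edge_prob (q_ alpha m.+1)) (fun G : {set {set 'I_m.+1}} =>
    inv_parents R ord0 G) <= m.+1%:R * S m.+1.
  have := @Ex_inv_parents_small R 'I_m.+1 ord0 (q_ alpha m.+1) (st_q st) (D m.+1) (w m.+1).
  rewrite /layer_err /dev_err card_ord -/(derr m.+1) -/(lerr m.+1).
  by move=> /(_ (st_a st) (st_w st) (st_D st)).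
move=> /(_ _ eps01 st _ _ _ _)/le_trans; apply.
- by rewrite lexx ler01.
- by move=> G _; exact: sum_ln_excess_amgm.
- move=> G; rewrite mulr_ge0// addr_ge0// ?mulr_ge0 ?inv0 ?invr_ge0 ?expR_ge0 ?(ltW K0)//.
  by rewrite sumr_ge0.
- under eq_Ex do rewrite mul0r subr0 ger0_norm//.
  exact: M1.
- rewrite ExZ mulrCA ler_pM2l// ExD !ExZ mulrDr; apply: lerD.
    apply: (@le_trans _ _ (expR (- (beta * LL m.+1)) / K * (m.+1%:R * a m.+1))).
      by rewrite ler_wpM2l ?sdeg_le// divr_ge0 ?expR_ge0// ltW.
    rewrite (_ : _ / K * _ = m.+1%:R * (expR (- (beta * LL m.+1)) * a m.+1 / K)); last by ring.
    by rewrite ler_pM2l ?ltr0n// ler_pM2r ?invr_gt0.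
  by rewrite mulrCA ler_pM2l.
have alg (k s f x y : R) : k * (s + f + 6 * (x + y)) = k * (s + f + 6 * y) + k * (6 * x).
  by ring.
by rewrite alg CK [leRHS]splitr lerD2r.
Qed.

Lemma displaced_convergence :
  beta < 1 \/ lambda_ alpha n @[n --> \oo] --> (1 : R) ->
  overlap_cvg_in_prob alpha beta 0.
Proof.
move=> hyp.
(* The Chernoff parameter will be [kp * ln (ln n)]. As [kp < 1], its exponential [(log n)^kp] is
   eventually below [a]; if [kp + beta < 1], displacing a vertex is affordable too. Otherwise
   [lambda = 1], and the whole layer [D.+1] will be selected with high probability. *)
have [kp [kp0 kp2 kpb]] : exists kp : R, [/\ 0 < kp, kp <= 2^-1 &
    kp + beta < 1 \/ lambda_ alpha n @[n --> \oo] --> (1 : R)].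
  case: hyp => [b1|l1].
    by exists ((1 - beta) / 2); split; [lra|have := beta0; lra|left; lra].
  by exists 2^-1; split => //; right.
have near_z (x : R) : x < 1 -> \forall n \near \oo, expR (x * LL n) <= a n.
  move=> x1; have x10 : 0 < 1 - x by rewrite subr_gt0.
  apply: filterS2 (near_basic near_alpha 4) (near_lnln (- ln c / (1 - x))) => n bb Ln.
  apply: le_trans (bb_lo bb); rewrite -{2}(bb_L bb) -{1}(@lnK _ c) ?posrE//.
  rewrite -expRD ler_expR.
  by move: Ln; rewrite ler_pdivrMr// mulrBr mulr1; lra.
apply: overlap_cvg_of_vanishing => eps eps01 e e0; have /andP[eps0 eps1] := eps01.
(* The irregular vertices then cost at most [4 * eta * 3 * LL n = kp * eps / 8 * LL n], up to a
   constant. *)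
pose eta := kp * eps / 96.
have eta0 : 0 < eta by rewrite divr_gt0// mulr_gt0.
have eta4 : eta <= 4^-1.
  have : kp * eps <= 2^-1 * 1 by apply: ler_pM; rewrite // ltW.
  by rewrite /eta; lra.
pose K := 2 / e.
have K0 : 0 < K by rewrite divr_gt0.
pose x0 n := Num.trunc (eta * n%:R).
(* A common lower bound for [x0] and for the size of the layer [D.+1], hence for the selected
   set. *)
pose xi n := eta * n%:R / (16 * w n).
have near_x0 : \forall n \near \oo, eta * n%:R / 2 <= (x0 n)%:R <= eta * n%:R.
  apply: filterS (nbhs_infty_ger (2 / eta)) => n.
  rewrite ler_pdivrMr// => n2.
  have en0 : 0 <= eta * n%:R by rewrite mulr_ge0// ltW.
  have /andP[h1 h2] := truncn_itv en0.
  rewrite -/(x0 n) -natr1 in h1 h2; rewrite h1 andbT.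
  by move: n2 h2; rewrite [n%:R * eta]mulrC; lra.
(* From [ln (LL n) <= LL n / M + ln M], the loss [4 * ln (LL n)] is at most [kp * eps / 8 * LL n] up
   to a constant. *)
pose M := 32 / (kp * eps).
have ke0 : 0 < kp * eps by rewrite mulr_gt0.
have M0 : 0 < M by rewrite divr_gt0.
pose k1 := ln (8 * (32 / eta) ^+ 2) + 4 * ln M + 4 * eta * (ln 8 + 2 * ln C) + 2 * K.
(* The gain [kp * eps / 2 * LL n] exceeds the two losses of [kp * eps / 8 * LL n] by
   [kp * eps / 4 * LL n], which eventually outweighs the constants gathered in [k1]. *)
have near_br : \forall n \near \oo,
    - (kp * LL n * eps / 2) + ln (8 * (32 * w n / eta) ^+ 2) +
    4 * eta * ln (8 * expR (kp * LL n) * a n ^+ 2) + 2 * K <= -1.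
  apply: filterS2 (near_basic near_alpha 4) (near_lnln ((k1 + 1) / (kp * eps / 4))) => n bb.
  rewrite ler_pdivrMr ?divr_gt0// => Lk.
  have [LL4 _ L4 _] := basic_growth (lexx 4) bb.
  have LL0 : 0 < LL n by exact: lt_le_trans LL4.
  have L0 : 0 < L n by exact: lt_le_trans L4.
  have a0 : 0 < a n by apply: lt_le_trans (bb_lo bb); rewrite mulr_gt0.
  have lnle y : 0 < y -> ln y <= y :> R.
    by move=> y0; rewrite -[leRHS]expRK ler_ln ?posrE ?expR_gt0// expR_ge_id.
  have l1 : ln (8 * (32 * w n / eta) ^+ 2) = ln (8 * (32 / eta) ^+ 2) + 4 * ln (LL n).
    rewrite (_ : 8 * (32 * w n / eta) ^+ 2 = 8 * (32 / eta) ^+ 2 * LL n ^+ 4); last first.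
      by field; rewrite gt_eqF.
    have e8 : 0 < 8 * (32 / eta) ^+ 2 by rewrite mulr_gt0// exprn_gt0// divr_gt0.
    rewrite lnM ?posrE//; last by rewrite exprn_gt0.
    by congr (_ + _); rewrite lnXn// -[LHS]mulr_natl.
  have l2 : ln (LL n) <= LL n * (kp * eps / 32) + ln M.
    rewrite (_ : ln (LL n) = ln (LL n / M) + ln M); last first.
      by rewrite -lnM ?posrE ?divr_gt0// divfK// gt_eqF.
    rewrite lerD2r.
    by apply: le_trans (lnle _ _) _; rewrite ?divr_gt0// invf_div.
  have l3 : ln (8 * expR (kp * LL n) * a n ^+ 2) = ln 8 + kp * LL n + 2 * ln (a n).
    move: (a n) a0 => A A0; rewrite lnM ?posrE; last by rewrite exprn_gt0.
      rewrite [ln (8 * _)]lnM ?posrE ?expR_gt0// expRK lnXn//.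
      by congr (_ + _); rewrite -[LHS]mulr_natl.
    by rewrite mulr_gt0// expR_gt0.
  have l4 : ln (a n) <= ln C + LL n.
    rewrite -lnM ?posrE// ler_ln ?posrE ?(mulr_gt0 C0 L0)//; exact: bb_hi bb.
  rewrite l1 l3.
  have l5 : 4 * eta * (ln 8 + kp * LL n + 2 * ln (a n)) <=
      4 * eta * (ln 8 + 2 * ln C) + kp * eps / 8 * LL n.
    have : 4 * eta * (kp * LL n + 2 * ln (a n)) <=
        4 * eta * (3 * LL n + 2 * ln C).
      rewrite ler_pM2l ?mulr_gt0//.
      have : kp * LL n <= LL n by rewrite ler_piMl ?(ltW LL0)//; lra.
      by move: l4; lra.
    by rewrite /eta; lra.
  move: Lk l2 l5; rewrite /k1.
  move: (ln (8 * (32 / eta) ^+ 2)) (ln M) (4 * eta * (ln 8 + 2 * ln C))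
    (4 * eta * (ln 8 + _ + _)) (ln (LL n)) => z1 z2 z3 z4 z5.
  lra.
have [ovf [vO nO]] : exists ovf : nat -> R, vanishing ovf /\ \forall m \near \oo,
    overflow (@ord0 m) (q_ alpha m.+1) (beta * LL m.+1) (D m.+1) (x0 m.+1)
      (kp * LL m.+1) <= ovf m.+1.
  case: kpb => [kb1|l1].
    exists (fun=> 0); split; first by move=> e' e'0; apply: nearW => _; exact: ltW.
    apply: filterS (near_S (near_z _ kb1)) => m.
    by rewrite mulrDl expRD /overflow card_ord => ->.
  (* When [lambda = 1], [theta n] tends to 0 and the layer [D.+1] has expected size [o(n)], so
     Markov's inequality makes it unlikely to exceed [x0], which is at least [eta * n / 2]. *)
  exists (fun n => 2 / eta * theta n); split.
    apply: vanishingZ; first by rewrite divr_ge0// ltW.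
    move=> e' e'0.
    have := cvg_comp _ _ l1 (continuous_ln ltr01); rewrite ln1 => l1'.
    have : \forall n \near \oo, - e' < ln (lambda_ alpha n).
      by apply: (cvgr_gt 0) => //; rewrite oppr_lt0.
    apply: filterS2 (near_depth c0 near_alpha) => n [_ _ ->] h.
    by rewrite lnV ?posrE ?expR_gt0// lerNl ltW.
  apply: filterS2 (near_S near_set) (near_S near_x0) => m st /andP[x01 _].
  have n0 : 0 < m.+1%:R :> R by rewrite ltr0n.
  have x0p : 0 < (x0 m.+1)%:R :> R.
    by apply: lt_le_trans x01; rewrite divr_gt0// mulr_gt0.
  have th0 : 0 <= theta m.+1.
    by rewrite divr_ge0// exprn_ge0// (le_trans _ (st_a st)).
  rewrite /overflow; case: ifP => _; first by rewrite mulr_ge0// divr_ge0// ltW.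
  have ep01 : forall e1 : {set 'I_m.+1}, 0 <= edge_prob (q_ alpha m.+1) e1 <= 1.
    by apply: edge_prob01; exact: st_q st.
  apply: le_trans (le_Pr ep01 (B := fun G => (x0 m.+1)%:R <=
    #|bfs_layer ord0 G (D m.+1).+1|%:R :> R) _) _.
    by move=> G; rewrite ler_nat => /ltnW.
  apply: le_trans (markov_Ex ep01 x0p _) _ => //.
  have := @Ex_layer_le R 'I_m.+1 (q_ alpha m.+1) (st_q st) ord0.
  rewrite card_ord => /(_ (st_a st) (D m.+1).+1) El.
  rewrite ler_pdivrMr//; apply: le_trans El _.
  rewrite [leLHS](_ : _ = 2 / eta * theta m.+1 * (eta * m.+1%:R / 2)); last first.
    by move: (_ ^+ (D m.+1).+1) => z; field; rewrite !gt_eqF.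
  by rewrite ler_wpM2l// mulr_ge0// divr_ge0// ltW.
clearbody eta.
have ie0 : 0 <= eta^-1 by rewrite invr_ge0 ltW.
have ke1 : 0 <= 64 / eta by rewrite divr_ge0// ltW.
have V := vanishingD (vanishingD (vanishingD (vanishingZ ie0 (vanishingD (vanishingD
  (vanishingZ (ler0n _ 2) v_aD) (vanishingZ ke1 (vanishing_wa c0 near_alpha)))
  v_lerr)) v_lerr) vO) v_invn.
have e2 : 0 < e / 2 by rewrite divr_gt0.
have kp1 : kp < 1 by lra.
have eta1 : eta <= 1 by lra.
apply: filterS2 (filterI (near_S near_set) (filterI (near_S (near_z _ kp1)) nO))
  (filterI (vanishing_S V e2) (filterI (near_S near_x0) (near_S near_br))) =>
  m [st [za Om]] [Vm [/andP[x01 x02] br]].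
have n0 : 0 < m.+1%:R :> R by rewrite ltr0n.
have LL0 : 0 < LL m.+1 by exact: lt_le_trans (st_LL st).
have w0 : 0 < w m.+1 by rewrite exprn_gt0.
have a0 : 0 < a m.+1 by exact: lt_le_trans (st_a st).
have q0 : 0 < q_ alpha m.+1 by move: a0; rewrite pmulr_rgt0.
have xi0 : 0 < xi m.+1 by rewrite divr_gt0 ?mulr_gt0.
have xie : xi m.+1 = eta * (m.+1%:R / (16 * w m.+1)) by rewrite [RHS]mulrA.
have xix : xi m.+1 <= (x0 m.+1)%:R.
  apply: le_trans x01; rewrite ler_pM2l ?mulr_gt0//.
  rewrite lef_pV2 ?posrE ?mulr_gt0//; apply: (@le_trans _ _ (16 * 1)).
    by rewrite mulr1 ler_nat.
  by rewrite ler_pM2l// (st_w st).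
have xin : xi m.+1 <= m.+1%:R / (16 * w m.+1).
  rewrite xie ler_piMl//.
  by rewrite divr_ge0// mulr_ge0// ltW.
have := @replica_displaced R 'I_m.+1 ord0 (q_ alpha m.+1) (beta * LL m.+1) (st_q st)
  _ (D m.+1) (x0 m.+1) (w m.+1) eps (kp * LL m.+1) (xi m.+1) eta K.
rewrite /layer_err /dev_err card_ord -/(derr m.+1) -/(lerr m.+1).
rewrite /overlap_tail (st_min st) => /(_ _ (st_a st) (st_w st) (st_D st) eps0 _ za
  xi0 xix xin eta0 eta4 x02 K0)/le_trans; apply.
- by rewrite mulr_ge0// ltW.
- by rewrite mulr_ge0// ltW.
have -> : 2 * m.+1%:R / xi m.+1 = 32 * w m.+1 / eta.
  by rewrite /xi; field; rewrite !gt_eqF.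
have -> : 4 / (xi m.+1 * q_ alpha m.+1) = 64 / eta * (w m.+1 / a m.+1).
  by rewrite /xi; field; rewrite !gt_eqF.
have ex : expR (m.+1%:R * (- (kp * LL m.+1 * eps / 2) + ln (8 * (32 * w m.+1 / eta) ^+ 2) +
    4 * eta * ln (8 * expR (kp * LL m.+1) * a m.+1 ^+ 2) + 2 * K)) <= m.+1%:R^-1.
  apply: le_trans (expRN_le n0); rewrite ler_expR -[leRHS]mulrN1.
  by rewrite ler_pM2l.
have -> : K^-1 = e / 2 by rewrite /K invf_div.
move: Vm ex Om => /=; rewrite [eta^-1 * _]mulrC -[2 * _ / _]mulrA.
move: (overflow _ _ _ _ _ _) (ovf _) (expR _) => ov ov' ex1.
move: (_ / eta + _) => z1 zO exN ovO.
rewrite [leRHS]splitr [_ + e / 2]addrC -addrA lerD2l.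
by apply: le_trans zO; apply: lerD => //; exact: lerD.
Qed.

End convergence.

Local Open Scope classical_set_scope.

Theorem theorem1p13 (R : realType) (alpha : nat -> R) (beta lambda : R)
  (alpha_gt0 : forall n : nat, (0 < n)%N -> 0 < alpha n)
  (alpha_liminf : (0 < limn_einf (fun n : nat => (alpha n)%:E))%E)
  (alpha_limsup : (limn_esup (fun n : nat => (alpha n)%:E) < +oo)%E)
  (beta_gt0 : 0 < beta)
  (lambda01 : 0 <= lambda <= 1)
  (lambda_cvg : lambda_ alpha n @[n --> \oo] --> lambda) :
  (lambda = 0 \/ lambda = 1 \/ beta < 1 ->
     overlap_cvg_in_prob alpha beta 0) /\
  (0 < lambda < 1 -> 1 < beta ->
     overlap_cvg_in_prob alpha beta (f_overlap lambda)).
Proof.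
have [c [C [c0 near_alpha]]] := alpha_bounds alpha_liminf alpha_limsup.
split; last first.
  by move=> l01 beta1; exact: (bfs_convergence c0 beta_gt0 near_alpha l01 beta1).
(* Below 1 the displaced comparison works for every [lambda]; from 1 on, only the two extreme values
   of [lambda] remain. *)
have [beta1 _|beta1] := ltP beta 1.
  by apply: (displaced_convergence c0 beta_gt0 near_alpha); left.
case=> [l0|[l1|//]].
- by apply: (bfs_convergence0 c0 beta_gt0 near_alpha beta1); rewrite -l0.
- by apply: (displaced_convergence c0 beta_gt0 near_alpha); right; rewrite -l1.
Qed.
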